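(* Let $\varepsilon=(\varepsilon_1,\varepsilon_2),\delta=(\delta_1,\delta_2)\in\{\pm\}^2$ and $\lambda=(\lambda_1,\lambda_2),\nu=(\nu_1,\nu_2)\in\mathbb C^2$. Then, regarding operators on $C^\infty(\mathbb R^3)$ via restriction to the open Bruhat cell, $$\mathrm{Diff}_G\big(I(\lambda_1,\lambda_2)^{(\varepsilon_1,\varepsilon_2)},I(\nu_1,\nu_2)^{(\delta_1,\delta_2)}\big)=\begin{cases}\mathbb C\,\mathrm{id}&\text{if }(\delta;\nu)=(\varepsilon;\lambda),\\ \mathbb C\,\mathcal D_1^{\,1-\lambda_1}&\text{if }(\varepsilon,\delta;\lambda,\nu)\in\Xi_a,\\ \mathbb C\,\mathcal D_2^{\,1-\lambda_2}&\text{if }(\varepsilon,\delta;\lambda,\nu)\in\Xi_a',\\ \mathbb C\,\mathcal D_+^{(1-\lambda_1,\,2-\lambda_1-\lambda_2)}&\text{if }(\varepsilon,\delta;\lambda,\nu)\in\Xi_b,\\ \mathbb C\,\mathcal D_-^{(2-\lambda_1-\lambda_2,\,1-\lambda_2)}&\text{if }(\varepsilon,\delta;\lambda,\nu)\in\Xi_b',\\ \mathbb C\,\mathcal D_c^{(\lambda_2-\lambda_1;\,2-\lambda_1-\lambda_2)}&\text{if }(\varepsilon,\delta;\lambda,\nu)\in\Xi_c,\\ \{0\}&\text{otherwise.}\end{cases}$$ In particular in each of the nonzero cases the displayed operator is a $G$-intertwining differential operator and the space is one-dimensional.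
   Context: $G=SL(3,\mathbb R)$. $E_{i,j}$ are matrix units; $N_1^+=E_{1,2},N_2^+=E_{2,3},N_3^+=E_{1,3}$, $N_1^-=E_{2,1},N_2^-=E_{3,2},N_3^-=E_{3,1}$; $H_1=\mathrm{diag}(1,-1,0)$, $H_2=\mathrm{diag}(0,1,-1)$. $A=\exp(\mathbb RH_1+\mathbb RH_2)$, $N_+$ = upper unitriangular matrices, $N_-=\exp(\mathrm{span}_{\mathbb R}\{N_1^-,N_2^-,N_3^-\})$, $M$ = diagonal matrices in $G$ with entries $\pm1$, $B=MAN_+$. For $\lambda\in\mathbb C^2$, $\chi_A^{\lambda}(\exp(t_1H_1+t_2H_2))=e^{\lambda_1t_1+\lambda_2t_2}$; for $\varepsilon\in\{\pm\}^2$, $\chi_M^{\varepsilon}(\mathrm{diag}(b_1,b_2,b_3))=|b_1|_{\varepsilon_1}|b_3|_{\varepsilon_2}$ with $|b|_+=|b|$, $|b|_-=b$. $I(\lambda_1,\lambda_2)^{(\varepsilon_1,\varepsilon_2)}=\{f\in C^\infty(G): f(gman)=\chi_M^\varepsilon(m)^{-1}\chi_A^\lambda(a)^{-1}f(g)\ (m\in M,a\in A,n\in N_+)\}$ with $G$ acting by left translation. $f\mapsto F$, $F(x)=f(\exp(x_1N_1^-+x_2N_2^-+x_3N_3^-))$, embeds it into $C^\infty(\mathbb R^3)$; a differential operator $\mathcal D$ on $C^\infty(\mathbb R^3)$ belongs to $\mathrm{Diff}_G(I(\lambda)^{(\varepsilon)},I(\nu)^{(\delta)})$ if it maps (restrictions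 of) $I(\lambda)^{(\varepsilon)}$ into $I(\nu)^{(\delta)}$ and the induced map commutes with the $G$-actions. $\mathcal D_1=\partial_{x_1}+\frac{x_2}{2}\partial_{x_3}$, $\mathcal D_2=\partial_{x_2}-\frac{x_1}{2}\partial_{x_3}$, $\mathcal D_3=\partial_{x_3}$. Symmetrization: $\mathbf s(a_1^{p}a_2^{q}a_3^{r})$ = average over all orderings of the product containing $a_1$ $p$ times, $a_2$ $q$ times, $a_3$ $r$ times. Cayley continuants: $\mathrm{Cay}_m(x;y)=\sum_{j=0}^m\binom mj\big(\frac{x+y}2\big)^{\underline j}\big(\frac{x-y}2\big)^{\overline{m-j}}$ with $r^{\underline j}=r(r-1)\cdots(r-j+1)$, $r^{\overline j}=r(r+1)\cdots(r+j-1)$ (equivalently the $m\times m$ tridiagonal determinant with diagonal $x$, superdiagonal $1,2,\dots,m-1$, subdiagonal $y,y-1,\dots,y-m+2$; $\mathrm{Cay}_0=1$). For $k,\ell\in\mathbb Z_{\ge0}$, $s\in\mathbb C$: $\mathcal D_\pm^{(k,\ell)}=\sum_{m=0}^{\min(k,\ell)}\frac{(\pm1)^m}{2^m}m!\binom km\binom\ell m\mathbf s(\mathcal D_1^{k-m}\mathcal D_2^{\ell-m}\mathcal D_3^m)$, $\mathcal D_c^{(s;k)}=\sum_{m=0}^k\frac1{2^m}\binom km\mathrm{Cay}_m(s;k)\mathbf s(\mathcal D_1^{k-m}\mathcal D_2^{k-m}\mathcal D_3^m)$. Signs: for $n\in\mathbb Z$, $(-)^n$ is $+$ if $n$ even and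 $-$ if $n$ odd; signs multiply in $\{\pm\}$. Parameter sets: $\Xi_a$: $\lambda_1\in\mathbb Z_{\le0}$, $\lambda_2\in\mathbb C$, $\nu=(2-\lambda_1,\lambda_1+\lambda_2-1)$, $\delta=(\varepsilon_1,\varepsilon_2(-)^{1-\lambda_1})$. $\Xi_a'$: $\lambda_2\in\mathbb Z_{\le0}$, $\lambda_1\in\mathbb C$, $\nu=(\lambda_1+\lambda_2-1,2-\lambda_2)$, $\delta=(\varepsilon_1(-)^{1-\lambda_2},\varepsilon_2)$. $\Xi_b$: $\lambda=(1-k,1-\ell+k)$ with $k,\ell\in\mathbb Z_{\ge1}$, $\nu=(\lambda_2,3-\lambda_1-\lambda_2)$, $\delta=(\varepsilon_1(-)^{2-\lambda_1-\lambda_2},\varepsilon_2(-)^{1-\lambda_1})$. $\Xi_b'$: $\lambda=(1-k+\ell,1-\ell)$ with $k,\ell\in\mathbb Z_{\ge1}$, $\nu=(3-\lambda_1-\lambda_2,\lambda_1)$, $\delta=(\varepsilon_1(-)^{1-\lambda_2},\varepsilon_2(-)^{2-\lambda_1-\lambda_2})$. $\Xi_c$: $\lambda=(\frac{2-k-s}2,\frac{2-k+s}2)$ with $k\in\mathbb Z_{\ge1}$, $s\in\mathbb C$, $\nu=(2-\lambda_2,2-\lambda_1)$, $\delta=(\varepsilon_1(-)^{2-\lambda_1-\lambda_2},\varepsilon_2(-)^{2-\lambda_1-\lambda_2})$. *)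

(* Defs.v *)
From mathcomp Require Import all_boot all_order all_algebra.
From mathcomp Require Import all_classical all_reals all_analysis.
From mathcomp Require Import complex.

Set Implicit Arguments.
Unset Strict Implicit.
Unset Printing Implicit Defensive.

Import Order.TTheory GRing.Theory Num.Theory.
Import numFieldTopology.Exports numFieldNormedType.Exports.
Local Open Scope ring_scope.
Local Open Scope classical_set_scope.

Section Defs.
Variable R : realType.
Local Notation C := (R[i]).

Definition RC (x : R) : C := Complex x 0.

Definition cexp (z : C) : C :=
  RC (expR (complex.Re z)) * Complex (cos (complex.Im z)) (sin (complex.Im z)).

Definition ffact (r : C) (j : nat) : C := \prod_(i < j) (r - i%:R).
Definition rfact (r : C) (j : nat) : C := \prod_(i < j) (r + i%:R).

Definition Cay (m : nat) (x y : C) : C :=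
  \sum_(j < m.+1) 'C(m, j)%:R * ffact ((x + y) / 2%:R) j
                              * rfact ((x - y) / 2%:R) (m - j).

Definition ebasis n (i : 'I_n) : 'rV[R]_n := \row_(j < n) (i == j)%:R.

Definition pd n (i : 'I_n) (F : 'rV[R]_n -> C) : 'rV[R]_n -> C :=
  fun x => Complex ('D_(ebasis i) (fun y => complex.Re (F y)) x)
                   ('D_(ebasis i) (fun y => complex.Im (F y)) x).

Definition ipd n (w : seq 'I_n) (F : 'rV[R]_n -> C) : 'rV[R]_n -> C :=
  foldr (@pd n) F w.

Definition smooth_on n (U : set 'rV[R]_n) (F : 'rV[R]_n -> C) : Prop :=
  open U /\
  forall (w : seq 'I_n) (x : 'rV[R]_n), U x ->
    {for x, continuous (fun y => complex.Re (ipd w F y))} /\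
    {for x, continuous (fun y => complex.Im (ipd w F y))} /\
    forall i : 'I_n,
      derivable (fun y => complex.Re (ipd w F y)) x (ebasis i) /\
      derivable (fun y => complex.Im (ipd w F y)) x (ebasis i).

Definition smooth3 (F : 'rV[R]_3 -> C) : Prop := smooth_on setT F.

Definition SL3 (g : 'M[R]_3) : Prop := \det g = 1.

(** f is smooth on the embedded submanifold SL(3,R) of R^9 = M_3(R):
    it is the restriction of a smooth function on an open neighbourhood *)
Definition smooth_G (f : 'M[R]_3 -> C) : Prop :=
  exists (U : set 'rV[R]_(3 * 3)) (Fx : 'rV[R]_(3 * 3) -> C),
    smooth_on U Fx /\ (forall g, SL3 g -> U (mxvec g)) /\
    (forall g, SL3 g -> Fx (mxvec g) = f g).

(** matrix units E_{i,j} (1-based as in the paper) *)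
Definition E (i j : nat) : 'M[R]_3 :=
  \matrix_(a < 3, b < 3) ((a == i.-1 :> nat) && (b == j.-1 :> nat))%:R.

Definition N1m := E 2 1.
Definition N2m := E 3 2.
Definition N3m := E 3 1.

(** exponential of a matrix X with X^3 = 0 (the series terminates) *)
Definition nexp (X : 'M[R]_3) : 'M[R]_3 := 1 + X + 2%:R^-1 *: (X * X).

(** exp(t1 H1 + t2 H2) = diag(e^{t1}, e^{t2 - t1}, e^{-t2}) *)
Definition aexp (t1 t2 : R) : 'M[R]_3 :=
  diag_mx (\row_(j < 3) [:: expR t1; expR (t2 - t1); expR (- t2)]`_j).

Definition mdiag (b1 b2 b3 : R) : 'M[R]_3 :=
  diag_mx (\row_(j < 3) [:: b1; b2; b3]`_j).
Definition pm1 (b : R) : Prop := b = 1 \/ b = -1.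

Definition nplus (a b c : R) : 'M[R]_3 :=
  \matrix_(i < 3, j < 3)
    nth 0 (nth [::] [:: [:: 1; a; c]; [:: 0; 1; b]; [:: 0; 0; 1]] i) j.

Inductive sgn := Pl | Mi.
Definition smul (a b : sgn) : sgn :=
  match a, b with Pl, Pl | Mi, Mi => Pl | _, _ => Mi end.
Definition spow (n : int) : sgn := if odd `|n|%N then Mi else Pl.
Definition sabs (e : sgn) (b : R) : R := if e is Pl then `|b| else b.

Definition chiM (e : sgn * sgn) (b1 b2 b3 : R) : C :=
  RC (sabs e.1 b1 * sabs e.2 b3).
Definition chiA (lam : C * C) (t1 t2 : R) : C :=
  cexp (lam.1 * RC t1 + lam.2 * RC t2).

Definition Iser (lam : C * C) (e : sgn * sgn) (f : 'M[R]_3 -> C) : Prop :=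
  smooth_G f /\
  forall g b1 b2 b3 t1 t2 a b c, SL3 g ->
    pm1 b1 -> pm1 b2 -> pm1 b3 -> b1 * b2 * b3 = 1 ->
    f (g * mdiag b1 b2 b3 * aexp t1 t2 * nplus a b c)
    = (chiM e b1 b2 b3)^-1 * (chiA lam t1 t2)^-1 * f g.

Definition ltr (g : 'M[R]_3) (f : 'M[R]_3 -> C) : 'M[R]_3 -> C :=
  fun x => f (invmx g * x).

(** restriction to the open Bruhat cell:
    F(x) = f(exp(x1 N1^- + x2 N2^- + x3 N3^-)) *)
Definition nbar (x : 'rV[R]_3) : 'M[R]_3 :=
  nexp (x 0 0 *: N1m + x 0 1 *: N2m + x 0 2 *: N3m).
Definition res (f : 'M[R]_3 -> C) : 'rV[R]_3 -> C := fun x => f (nbar x).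

Definition diffop := seq (('rV[R]_3 -> C) * seq 'I_3).
Definition diffop_wf (D : diffop) : Prop := forall p, p \in D -> smooth3 p.1.
Definition dapply (D : diffop) (F : 'rV[R]_3 -> C) : 'rV[R]_3 -> C :=
  fun x => \sum_(p <- D) p.1 x * ipd p.2 F x.

Definition DiffG (e : sgn * sgn) (lam : C * C) (d : sgn * sgn) (nu : C * C)
    (D : diffop) : Prop :=
  diffop_wf D /\
  (forall f, Iser lam e f ->
     exists f', Iser nu d f' /\ forall x, res f' x = dapply D (res f) x) /\
  (forall f f', Iser lam e f -> Iser nu d f' ->
     (forall x, res f' x = dapply D (res f) x) ->
     forall g, SL3 g -> forall x,
       res (ltr g f') x = dapply D (res (ltr g f)) x).

Definition DiffG_eq (e : sgn * sgn) (lam : C * C) (d : sgn * sgn) (nu : C * C)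
    (T : ('rV[R]_3 -> C) -> ('rV[R]_3 -> C)) : Prop :=
  forall D : diffop, DiffG e lam d nu D <->
    (diffop_wf D /\ exists c : C, forall F, smooth3 F ->
       forall x, dapply D F x = c * T F x).

Definition DiffG_zero (e : sgn * sgn) (lam : C * C) (d : sgn * sgn)
    (nu : C * C) : Prop :=
  forall D : diffop, DiffG e lam d nu D <->
    (diffop_wf D /\ forall F, smooth3 F -> forall x, dapply D F x = 0).

Definition Dj (j : 'I_3) (F : 'rV[R]_3 -> C) : 'rV[R]_3 -> C :=
  fun x =>
    match val j with
    | 0%N => pd 0 F x + RC (x 0 1 / 2%:R) * pd 2%:R F x
    | 1%N => pd 1 F x - RC (x 0 0 / 2%:R) * pd 2%:R F x
    | _ => pd 2%:R F x
    end.

Definition D1 := Dj 0.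
Definition D2 := Dj 1.
Definition D3 := Dj 2%:R.

Definition Dword (w : seq 'I_3) (F : 'rV[R]_3 -> C) := foldr Dj F w.

(** symmetrization s(D1^p D2^q D3^r): average over all orderings *)
Definition words (p q r : nat) : seq ((p + q + r).-tuple 'I_3) :=
  seq.filter (fun w : (p + q + r).-tuple 'I_3 =>
     [&& count_mem (0 : 'I_3) w == p, count_mem (1 : 'I_3) w == q
       & count_mem (2%:R : 'I_3) w == r])
    (enum {: (p + q + r).-tuple 'I_3}).

Definition symD (p q r : nat) (F : 'rV[R]_3 -> C) : 'rV[R]_3 -> C :=
  fun x => (size (words p q r))%:R^-1 *
           \sum_(w <- words p q r) Dword w F x.

Definition Dpm (sg : bool) (k l : nat) (F : 'rV[R]_3 -> C) : 'rV[R]_3 -> C :=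
  fun x => \sum_(m < (minn k l).+1)
     ((if sg then 1 else -1) ^+ m / 2%:R ^+ m * m`!%:R
       * 'C(k, m)%:R * 'C(l, m)%:R) * symD (k - m) (l - m) m F x.
Definition Dplus := Dpm true.
Definition Dminus := Dpm false.

Definition Dc (s : C) (k : nat) (F : 'rV[R]_3 -> C) : 'rV[R]_3 -> C :=
  fun x => \sum_(m < k.+1)
     (1 / 2%:R ^+ m * 'C(k, m)%:R * Cay m s k%:R) * symD (k - m) (k - m) m F x.

Definition Xi_id (e d : sgn * sgn) (lam nu : C * C) : Prop :=
  d = e /\ nu = lam.

Definition Xi_a_at (e d : sgn * sgn) (lam nu : C * C) (m : nat) : Prop :=
  lam.1 = - m%:R /\
  nu = (2%:R - lam.1, lam.1 + lam.2 - 1) /\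
  d = (e.1, smul e.2 (spow (1 - (- (m%:Z))))).
Definition Xi_a e d lam nu := exists m, Xi_a_at e d lam nu m.

Definition Xi_a'_at (e d : sgn * sgn) (lam nu : C * C) (m : nat) : Prop :=
  lam.2 = - m%:R /\
  nu = (lam.1 + lam.2 - 1, 2%:R - lam.2) /\
  d = (smul e.1 (spow (1 - (- (m%:Z)))), e.2).
Definition Xi_a' e d lam nu := exists m, Xi_a'_at e d lam nu m.

Definition Xi_b_at (e d : sgn * sgn) (lam nu : C * C) (k l : nat) : Prop :=
  (1 <= k)%N /\ (1 <= l)%N /\
  lam = (1 - k%:R, 1 - l%:R + k%:R) /\
  nu = (lam.2, 3%:R - lam.1 - lam.2) /\
  d = (smul e.1 (spow (2 - (1 - k%:Z) - (1 - l%:Z + k%:Z))),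
       smul e.2 (spow (1 - (1 - k%:Z)))).
Definition Xi_b e d lam nu := exists k l, Xi_b_at e d lam nu k l.

Definition Xi_b'_at (e d : sgn * sgn) (lam nu : C * C) (k l : nat) : Prop :=
  (1 <= k)%N /\ (1 <= l)%N /\
  lam = (1 - k%:R + l%:R, 1 - l%:R) /\
  nu = (3%:R - lam.1 - lam.2, lam.1) /\
  d = (smul e.1 (spow (1 - (1 - l%:Z))),
       smul e.2 (spow (2 - (1 - k%:Z + l%:Z) - (1 - l%:Z)))).
Definition Xi_b' e d lam nu := exists k l, Xi_b'_at e d lam nu k l.

(* Xi_c with lam = ((2-k-s)/2, (2-k+s)/2), k >= 1, s complex;
   note 2 - lam_1 - lam_2 = k *)
Definition Xi_c_at (e d : sgn * sgn) (lam nu : C * C) (k : nat) (s : C)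
  : Prop :=
  (1 <= k)%N /\
  lam = ((2%:R - k%:R - s) / 2%:R, (2%:R - k%:R + s) / 2%:R) /\
  nu = (2%:R - lam.2, 2%:R - lam.1) /\
  d = (smul e.1 (spow k%:Z), smul e.2 (spow k%:Z)).
Definition Xi_c e d lam nu := exists k s, Xi_c_at e d lam nu k s.

End Defs.

(* Main.v *)
From HB Require Import structures.
Require Import Defs.
From mathcomp Require Import all_boot all_order all_algebra.
From mathcomp Require Import all_classical all_reals all_analysis.
From mathcomp Require Import complex ring lra zify.

Set Implicit Arguments.
Unset Strict Implicit.
Unset Printing Implicit Defensive.

Import Order.TTheory GRing.Theory Num.Theory.
Import numFieldTopology.Exports numFieldNormedType.Exports.
Local Open Scope ring_scope.
Local Open Scope classical_set_scope.

(** Reading an intertwining operator at the origin of the open cell turns it into a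
    constant-coefficient functional [P] on jets at [0], and the operator is recovered by
    translating with the Heisenberg group [N_-].  Since [I(lambda)] realizes every jet,
    intertwining means exactly that [P] is equivariant under [MA] and killed by the
    infinitesimal action of [E_{1,2}] and [E_{2,3}], that is, that [P] is a singular vector of
    a Verma module.  Equivariance under [MA] fixes a bidegree [(k, l)] and shifts the
    parameters by [k (2, -1) + l (-1, 2)]; symmetrized monomials in [D_1, D_2, D_3] are
    partial derivatives at the origin in exponential coordinates, so that
    [P = sum_m c_m d_1^(k-m) d_2^(l-m) d_3^m].  The two annihilation conditions become
    three-term recurrences for [c_m].  The first one determines [c] from [c_0]; comparing
    both for [m = 0, 1] leaves only the listed parameters, for which binomial products and
    Cayley continuants solve them. *)

(** * Real functions of class C^k *)

Section RealCalculus.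
Variable R : realType.

(** Much of the work is analytic. Smoothness on the group means extension to an open set of 3 x 3
    matrices, and smoothness there means existence and continuity of iterated partials. Total
    differentiability, symmetry of mixed partials and the chain rule are derived from this, because
    functionals are moved around by differentiating [f (g * nbar y)] jointly in [g] and [y]. Three
    facts link an operator to its jet functional. The one-parameter groups of [E_{1,2}] and
    [E_{2,3}] generate [N_+], so two infinitesimal conditions integrate to invariance. The open cell
    is dense, so an element of a principal series is determined by its restriction. The lengths of
    the first column and of the vector of 2 x 2 minors of the first two columns never vanish; their
    complex powers times polynomials have any prescribed weight and any prescribed jet. In the
    recurrences, adding the two conditions for the same [m] cancels the new unknown [c_(m+1)]. For
    positive [k] and [l] the sums for [m = 0, 1] leave a product of three factors equal to zero, one
    factor for each of the families c, b and b'. *)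

Lemma derivable_line (V : normedModType R) (f : V -> R) (x v : V) (s : R) :
  derivable f (s *: v + x) v ->
  is_derive s (1 : R) (fun t => f (t *: v + x)) ('D_v f (s *: v + x)).
Proof.
have e : (fun h : R => h^-1 *: (((fun t => f (t *: v + x)) \o shift s) (h *: (1 : R)) - f (s *: v + x)))
       = (fun h : R => h^-1 *: ((f \o shift (s *: v + x)) (h *: v) - f (s *: v + x))).
  by apply/funext => h /=; rewrite [h%:A]mulr1 scalerDl addrA.
by move=> df; split; rewrite /derivable /derive /= e.
Qed.

Lemma mvt_dir (V : normedModType R) (f : V -> R) (x v : V) (t : R) :
  (forall s, `|s| <= `|t| -> derivable f (s *: v + x) v) ->
  exists2 s, `|s| <= `|t| & f (t *: v + x) - f x = t * 'D_v f (s *: v + x).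
Proof.
move=> df; pose g s := f (s *: v + x).
have dg s : `|s| <= `|t| -> is_derive s (1 : R) g ('D_v f (s *: v + x)).
  by move=> /df; exact: derivable_line.
have cg a b : (forall s, s \in `[a, b]%R -> `|s| <= `|t|) -> {within `[a, b], continuous g}.
  by move=> H; apply: derivable_within_continuous => s sab; have [] := dg s (H s sab).
have g0 : g 0 = f x by rewrite /g scale0r add0r.
have [t0|t0] := leP 0 t.
  have b s : s \in `[0, t]%R -> `|s| <= `|t|.
    by rewrite in_itv /= => /andP[s0 st]; rewrite !ger0_norm.
  have [] := @MVT_segment R g (fun s => 'D_v f (s *: v + x)) 0 t t0.
  - by move=> s st; apply: dg; apply: b; apply: subset_itv_oo_cc.
  - exact: cg.
  by move=> c /b ct; rewrite g0 subr0 mulrC => e; exists c.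
have b s : s \in `[t, 0]%R -> `|s| <= `|t|.
  by rewrite in_itv /= => /andP[s0 st]; rewrite !ler0_norm ?lerN2 // ltW.
have [] := @MVT_segment R g (fun s => 'D_v f (s *: v + x)) t 0 (ltW t0).
- by move=> s st; apply: dg; apply: b; apply: subset_itv_oo_cc.
- exact: cg.
move=> c /b ct; rewrite g0 sub0r mulrN => e; exists c => //.
by rewrite mulrC -[RHS]opprK -e opprB.
Qed.

Definition rpd n (i : 'I_n) (f : 'rV[R]_n -> R) : 'rV[R]_n -> R :=
  fun x => 'D_(ebasis R i) f x.

Lemma norm_coord n (h : 'rV[R]_n) i : `|h 0 i| <= `|h|.
Proof.
rewrite [leRHS]/Num.Def.normr/= mx_normrE.
exact: (le_bigmax _ (fun j => `|h j.1 j.2|) (0, i)).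
Qed.

Lemma norm_le_coord n (h : 'rV[R]_n) e : 0 <= e -> (forall i, `|h 0 i| <= e) -> `|h| <= e.
Proof.
move=> e0 he; rewrite [leLHS]/Num.Def.normr/= mx_normrE (bigmax_le _ e0)//= => -[j i] _.
by rewrite (ord1 j).
Qed.

Lemma continuous_bigsum (T : topologicalType) I (r : seq I) (P : pred I)
    (F : I -> T -> R) x : (forall i, {for x, continuous (F i)}) ->
  {for x, continuous (fun y => \sum_(i <- r | P i) F i y)}.
Proof.
move=> cF; change ((fun y => \sum_(i <- r | P i) F i y) @ x --> \sum_(i <- r | P i) F i x).
elim: r => [|i r IH].
  by under eq_fun do rewrite big_nil; rewrite big_nil; exact: cvg_cst.
under eq_fun do rewrite big_cons; rewrite big_cons; case: (P i) => //.
by apply: cvgD; [exact: cF|exact: IH].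
Qed.

Lemma differentiable_littleo (V W : normedModType R) (f : V -> W)
    (L : {linear V -> W}) p : continuous L ->
  (forall e : R, 0 < e -> \forall h \near 0, `|f (h + p) - f p - L h| <= e * `|h|) ->
  differentiable f p /\ 'd f p = L :> (V -> W).
Proof.
move=> cL H.
have E : f \o shift p = cst (f p) + L +o_ 0 id.
  apply/eqaddoP => _/posnumP[e]; near=> h.
  rewrite /= opprD addrA; near: h.
  exact: H.
have dE := diff_unique cL E.
by split=> //; apply/diff_locallyP; rewrite dE; split.
Unshelve. all: by end_near. Qed.

(** Balls around [0] are norm-saturated. This is what a path from [p] to [h + p] requires: all its
    points are [p] plus a vector of norm at most that of [h]. *)
Lemma near0_norm (V : normedModType R) (P : V -> Prop) :
  (\forall k \near (0 : V), P k) ->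
  \forall h \near (0 : V), forall k : V, `|k| <= `|h| -> P k.
Proof.
move=> /nbhs_norm0P [d d0 Hd]; apply/nbhs_norm0P; exists d => //= h /= hd k kh.
by apply: Hd => /=; apply: le_lt_trans kh hd.
Qed.

(** The increment is telescoped along a path that moves one coordinate at a time. The mean value
    theorem on each edge and continuity of the partials at [p] bound the error. *)
Lemma C1_differentiable n (U : set 'rV[R]_n) (f : 'rV[R]_n -> R) p :
  open U -> U p -> (forall i x, U x -> derivable f x (ebasis R i)) ->
  (forall i, {for p, continuous (rpd i f)}) ->
  differentiable f p /\ forall v, 'd f p v = \sum_i v 0 i * rpd i f p.
Proof.
move=> oU Up df cf.
pose d (v : 'rV[R]_n) := \sum_i v 0 i * rpd i f p.
have lin_d : linear d.
  move=> a u v; rewrite /d scaler_sumr -big_split /=; apply: eq_bigr => i _.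
  by rewrite !mxE mulrDl -mulrA.
pose dM := GRing.isLinear.Build _ _ _ _ _ lin_d.
pose L : {linear _ -> _} := HB.pack d dM.
have cL : continuous L.
  move=> x; rewrite -[L : _ -> _]/d; apply: continuous_bigsum => i.
  have ci := @coord_continuous R 1 n 0 i x.
  exact: (cvgM ci (cvg_cst (rpd i f p))).
have [] := @differentiable_littleo _ _ f L p cL; last by move=> df' ->.
  move=> _/posnumP[e]; near=> h.
  (* [hm m] keeps the first [m] coordinates of [h]. Each edge gets the error [e / n.+1], where the
     successor also covers [n = 0]. *)
  pose hm (m : nat) : 'rV[R]_n := \row_(j < n) (if (j < m)%N then h 0 j else 0).
  have hmS (i : 'I_n) : hm i.+1 + p = h 0 i *: ebasis R i + (hm i + p).
    rewrite addrA; congr (_ + p); apply/rowP => j; rewrite !mxE ltnS leq_eqVlt.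
    have [/eqP/val_inj -> /=|ji] := boolP (j == i :> nat).
      by rewrite ltnn eqxx mulr1 addr0.
    have -> : (i == j) = false by apply/negbTE; apply: contra ji => /eqP ->.
    by rewrite mulr0 add0r.
  have hm0 : hm 0%N + p = p.
    by rewrite (_ : hm 0%N = 0) ?add0r //; apply/rowP => j; rewrite !mxE.
  have hmn : hm n + p = h + p.
    by congr (_ + p); apply/rowP => j; rewrite !mxE ltn_ord.
  have small (i : 'I_n) s : `|s| <= `|h 0 i| ->
      `|s *: ebasis R i + hm i| <= `|h|.
    move=> sh; apply: norm_le_coord => // j; rewrite !mxE.
    case: eqVneq => [<-|_]; first by rewrite ltnn mulr1 addr0 (le_trans sh)// norm_coord.
    by rewrite mulr0 add0r; case: ifP => _; rewrite ?normr0// norm_coord.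
  have nbh : forall k : 'rV[R]_n, `|k| <= `|h| -> U (k + p) /\
      forall i, `|rpd i f (k + p) - rpd i f p| <= e%:num / n.+1%:R.
    near: h.
    apply: (@near0_norm _ (fun k : 'rV[R]_n => U (k + p) /\
      forall i, `|rpd i f (k + p) - rpd i f p| <= e%:num / n.+1%:R)).
      have sh : (fun k => k + p) @ (0 : 'rV[R]_n) --> p.
        rewrite -[X in _ --> X]add0r.
        exact: (@cvgD _ _ _ (nbhs (0 : 'rV[R]_n)) _ id (cst p) 0 p cvg_id (cvg_cst p)).
      have pU : nbhs p U by apply: open_nbhs_nbhs; split.
      near=> k; split; first by near: k; exact: (sh _ pU).
      move=> i; move: i; near: k; apply: filter_forall => i.
      have /cvgrPdist_le /(_ (e%:num / n.+1%:R)) := cvg_comp _ _ sh (cf i).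
      by move=> /(_ _)/[!divr_gt0]// /(_ isT); apply: filterS => k; rewrite distrC.
  have step (i : 'I_n) : exists2 q, `|rpd i f q - rpd i f p| <= e%:num / n.+1%:R &
      f (hm i.+1 + p) - f (hm i + p) = h 0 i * rpd i f q.
    have [] := @mvt_dir _ f (hm i + p) (ebasis R i) (h 0 i).
      by move=> s /small ssm; rewrite addrA; apply: df; have [] := nbh _ ssm.
    move=> s /small ssm; rewrite -hmS => ->.
    exists (s *: ebasis R i + (hm i + p)) => //.
    by rewrite addrA; have [_] := nbh _ ssm; apply.
  have tele : f (h + p) - f p = \sum_(i < n) (f (hm i.+1 + p) - f (hm i + p)).
    rewrite -(big_mkord xpredT (fun i => f (hm i.+1 + p) - f (hm i + p))).
    by rewrite telescope_sumr // hm0 hmn.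
  rewrite tele.
  rewrite -[L h]/(d h) /d -sumrB.
  apply: (@le_trans _ _ (\sum_(i < n) `|h| * (e%:num / n.+1%:R))).
    apply: (le_trans (ler_norm_sum _ _ _)); apply: ler_sum => i _.
    have [q qe ->] := step i.
    by rewrite -mulrBr normrM ler_pM // norm_coord.
  rewrite sumr_const card_ord -mulrnAr mulrC ler_wpM2r // -mulr_natr -mulrA.
  by rewrite ler_piMr // mulrC ler_pdivrMr ?ltr0n // mul1r ler_nat.
Unshelve. all: by end_near. Qed.

Notation e_ := (ebasis R).

Lemma is_derive_shift_arg (V : normedModType R) (f : V -> R) (a x v : V) d :
  is_derive (a + x) v f d -> is_derive x v (fun y => f (a + y)) d.
Proof.
have e : (fun h : R => h^-1 *: (((fun y => f (a + y)) \o shift x) (h *: v) - f (a + x)))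
       = (fun h : R => h^-1 *: ((f \o shift (a + x)) (h *: v) - f (a + x))).
  by apply/funext => h /=; rewrite addrCA.
by case=> df <-; split; rewrite /derivable /derive /= e.
Qed.

(** The mean value theorem is used twice: along [e_ i] for [g], the difference of [f] in direction
    [e_ j], and then along [e_ j] for the partial of [f]. Both intermediate shifts have size at most
    that of [h], whence the radius. *)
Lemma second_difference n (f : 'rV[R]_n -> R) p (i j : 'I_n) (h : R) :
  (forall k, `|k| <= `|h| + `|h| -> derivable f (k + p) (e_ i)) ->
  (forall k, `|k| <= `|h| + `|h| -> derivable (rpd i f) (k + p) (e_ j)) ->
  exists2 k, `|k| <= `|h| + `|h| &
    f (h *: e_ j + (h *: e_ i + p)) - f (h *: e_ i + p) - (f (h *: e_ j + p) - f p)
    = h * (h * rpd j (rpd i f) (k + p)).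
Proof.
move=> df ddf; pose g x := f (h *: e_ j + x) - f x.
have eb (l : 'I_n) (s : R) : `|s| <= `|h| -> `|s *: e_ l| <= `|h|.
  move=> sh; rewrite normrZ; apply: (le_trans _ sh); rewrite ler_piMr //.
  by apply: norm_le_coord => // l'; rewrite mxE; case: eqP => _; rewrite ?normr1 ?normr0.
have dg s : `|s| <= `|h| ->
    is_derive (s *: e_ i + p) (e_ i) g (rpd i f (h *: e_ j + (s *: e_ i + p)) - rpd i f (s *: e_ i + p)).
  move=> sh; apply: is_deriveB.
    apply: is_derive_shift_arg; apply/derivableP; rewrite addrA.
    by apply: df; rewrite (le_trans (ler_normD _ _)) // lerD // eb.
  apply/derivableP; apply: df.
  by rewrite (le_trans (eb _ _ sh)) // lerDl.
have [s sh] : exists2 s, `|s| <= `|h| & g (h *: e_ i + p) - g p = h * 'D_(e_ i) g (s *: e_ i + p).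
  by apply: mvt_dir => s /dg [].
have [_ ->] := dg s sh.
have [t th] : exists2 t, `|t| <= `|h| & rpd i f (h *: e_ j + (s *: e_ i + p)) - rpd i f (s *: e_ i + p)
    = h * 'D_(e_ j) (rpd i f) (t *: e_ j + (s *: e_ i + p)).
  apply: mvt_dir => t th; rewrite addrA; apply: ddf.
  by rewrite (le_trans (ler_normD _ _)) // lerD // eb.
move=> E Eg; exists (t *: e_ j + s *: e_ i).
  by rewrite (le_trans (ler_normD _ _)) // lerD // eb.
by rewrite -[LHS]/(g (h *: e_ i + p) - g p) Eg E /rpd -addrA.
Qed.

Opaque rpd.

(** The second difference is symmetric in [i] and [j], so the two mixed partials agree at two points
    near [p]; continuity transfers this to [p] up to [e]. *)
Lemma schwarz n (U : set 'rV[R]_n) (f : 'rV[R]_n -> R) p (i j : 'I_n) :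
  open U -> U p -> (forall k x, U x -> derivable f x (e_ k)) ->
  (forall k l x, U x -> derivable (rpd k f) x (e_ l)) ->
  (forall k l, {for p, continuous (rpd k (rpd l f))}) ->
  rpd i (rpd j f) p = rpd j (rpd i f) p.
Proof.
move=> oU Up df ddf cf; apply/eqP; rewrite -subr_eq0 -normr_le0; apply/ler_addgt0Pr => e e0.
rewrite add0r.
have sh : (fun k => k + p) @ (0 : 'rV[R]_n) --> p.
  rewrite -[X in _ --> X]add0r.
  exact: (@cvgD _ _ _ (nbhs (0 : 'rV[R]_n)) _ id (cst p) 0 p cvg_id (cvg_cst p)).
have pU : nbhs p U by apply: open_nbhs_nbhs; split.
have e20 : 0 < e / 2 by rewrite divr_gt0.
have H1 : nbhs (0 : 'rV[R]_n) [set k | U (k + p)] := sh _ pU.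
have H2 : nbhs (0 : 'rV[R]_n) [set k | `|rpd i (rpd j f) p - rpd i (rpd j f) (k + p)| <= e / 2].
  exact: (cvgrPdist_le _ _).1 (cvg_comp _ _ sh (cf i j)) _ e20.
have H3 : nbhs (0 : 'rV[R]_n) [set k | `|rpd j (rpd i f) p - rpd j (rpd i f) (k + p)| <= e / 2].
  exact: (cvgrPdist_le _ _).1 (cvg_comp _ _ sh (cf j i)) _ e20.
have [d /= d0 Hd] := nbhs_norm0P.1 (filterI H1 (filterI H2 H3)).
(* The points supplied by [second_difference] lie within twice the norm of [h], which must stay
   below [d]. *)
pose h := d / 4.
have h0 : 0 < h by rewrite divr_gt0.
have hd : `|h| + `|h| < d by rewrite gtr0_norm // /h; lra.
have [k1 k1h E1] := @second_difference n f p i j h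
  (fun k kh => df _ _ ((Hd k (le_lt_trans kh hd)).1))
  (fun k kh => ddf _ _ _ ((Hd k (le_lt_trans kh hd)).1)).
have [k2 k2h E2] := @second_difference n f p j i h
  (fun k kh => df _ _ ((Hd k (le_lt_trans kh hd)).1))
  (fun k kh => ddf _ _ _ ((Hd k (le_lt_trans kh hd)).1)).
have E : rpd i (rpd j f) (k2 + p) = rpd j (rpd i f) (k1 + p).
  apply: (mulfI (lt0r_neq0 h0)); apply: (mulfI (lt0r_neq0 h0)).
  apply: etrans (esym E2) (etrans _ E1).
  rewrite [h *: e_ i + (_ + _)]addrCA.
  by move: (f _) (f _) (f _) (f _) => u1 u2 u3 u4; ring.
have [_ [/= L2 _]] := Hd k2 (le_lt_trans k2h hd).
have [_ [_ /= L1]] := Hd k1 (le_lt_trans k1h hd).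
apply: (le_trans (ler_distD (rpd i (rpd j f) (k2 + p)) _ _)).
rewrite [e]splitr; apply: lerD; first exact: L2.
by rewrite E distrC; exact: L1.
Qed.

(** Restriction to a line reduces the chain rules below to the one-variable chain rule and to
    composition of differentials. *)
Lemma derive_line (V W : normedModType R) (F : V -> W) x v :
  'D_v F x = 'D_1 (fun t : R => F (t *: v + x)) 0.
Proof.
have e : (fun h : R => h^-1 *: ((F \o shift x) (h *: v) - F x)) =
    (fun h : R => h^-1 *: (((fun t : R => F (t *: v + x)) \o shift 0) (h *: (1 : R)) - F (0 *: v + x))).
  by apply/funext => h /=; rewrite addr0 scale0r add0r [_%:A]mulr1.
by rewrite /derive e.
Qed.

Lemma is_derive_comp1 (V : normedModType R) (f : V -> R) (h : R -> R) x v df dh :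
  is_derive x v f df -> is_derive (f x) 1 h dh ->
  is_derive x v (h \o f) (df * dh).
Proof.
move=> [Df <-] [Dh Eh].
pose g (t : R) := f (t *: v + x).
have g0 : g 0 = f x by rewrite /g scale0r add0r.
have Dg : derivable g 0 1 := (derivable1P f x v).1 Df.
have Dh' : derivable h (g 0) 1 := @eq_ind_r _ (f x) (fun z => derivable h z 1) Dh _ g0.
have D : derivable (h \o g) 0 1.
  have D1 := (derivable1_diffP _ _).1 Dg; have D2 := (derivable1_diffP _ _).1 Dh'.
  exact: (derivable1_diffP _ _).2 (differentiable_comp D1 D2).
split; first exact: (derivable1P (h \o f) x v).2 D.
rewrite (derive_line f x v) (derive_line (h \o f) x v).
transitivity ('D_1 (h \o g) 0) => //.
apply: etrans (esym (derive1E _ _)) (etrans (derive1_comp Dg Dh') _).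
by rewrite (derive1E h) (derive1E g) g0 Eh mulrC.
Qed.

Lemma derivable_rowP (V : normedModType R) n (phi : V -> 'rV[R]_n) x v :
  (forall j, derivable (fun z => phi z 0 j) x v) -> derivable phi x v.
Proof. by move=> H; apply/derivable_mxP => i j; rewrite (ord1 i). Qed.

Lemma is_derive_chain (V : normedModType R) n (phi : V -> 'rV[R]_n) (f : 'rV[R]_n -> R) x v
    (a : 'I_n -> R) :
  (forall j, is_derive x v (fun z => phi z 0 j) (a j)) -> differentiable f (phi x) ->
  is_derive x v (f \o phi) ('d f (phi x) (\row_j a j)).
Proof.
move=> H Df.
have Dphi : derivable phi x v by apply: derivable_rowP => j; have [] := H j.
have Ephi : 'D_v phi x = \row_j a j.
  by rewrite derive_mx //; apply/rowP => j; rewrite !mxE; have [_ ->] := H j.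
pose g (t : R) := phi (t *: v + x).
have g0 : g 0 = phi x by rewrite /g scale0r add0r.
have Dg : differentiable g 0.
  by apply/derivable1_diffP; exact: (derivable1P phi x v).1 Dphi.
have Df' : differentiable f (g 0) := @eq_ind_r _ (phi x) (fun z => differentiable f z) Df _ g0.
have D : differentiable (f \o g) 0 := differentiable_comp Dg Df'.
split; first exact: (derivable1P (f \o phi) x v).2 ((derivable1_diffP _ _).2 D).
rewrite (derive_line (f \o phi) x v).
transitivity ('D_1 (f \o g) 0) => //.
rewrite (deriveE _ D) (diff_comp Dg Df') /= g0; congr ('d f _ _).
by rewrite -(deriveE _ Dg) -Ephi (derive_line phi x v).
Qed.

End RealCalculus.

(** * Classes of [C^N] functions and their closure properties *)

Section Ck.
Variable R : realType.
Notation e_ := (ebasis R).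

(** Recursion on the order makes closure under products, inverses and composition an induction.
    [smooth_onE] links it to [smooth_on], which quantifies over words of partials. *)
Fixpoint Ck n (N : nat) (U : set 'rV[R]_n) (f : 'rV[R]_n -> R) : Prop :=
  (forall x, U x -> {for x, continuous f}) /\
  if N is N'.+1 then forall i, (forall x, U x -> derivable f x (e_ i)) /\ Ck N' U (rpd i f)
  else True.

Lemma Ck_cont n N (U : set 'rV[R]_n) f : Ck N U f -> forall x, U x -> {for x, continuous f}.
Proof. by case: N => [|N] []. Qed.

Lemma CkW n N (U : set 'rV[R]_n) f : Ck N.+1 U f -> Ck N U f.
Proof.
elim: N f => [|N IH] f [cf df]; split => // i; have [d1 d2] := df i.
by split => //; exact: IH.
Qed.

Lemma Ck_le n N M (U : set 'rV[R]_n) f : (M <= N)%N -> Ck N U f -> Ck M U f.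
Proof. by move=> /subnK <-; elim: (N - M)%N => // k IH /CkW /IH. Qed.

Lemma near_open (T : topologicalType) (U : set T) (P : T -> Prop) x : open U -> U x ->
  (forall y, U y -> P y) -> \forall y \near x, P y.
Proof.
move=> oU Ux H; have : nbhs x U by apply: open_nbhs_nbhs; split.
exact: filterS H.
Qed.

Lemma continuous_eq_on (T V : topologicalType) (U : set T) (f g : T -> V) x :
  open U -> U x -> (forall y, U y -> f y = g y) ->
  {for x, continuous f} -> {for x, continuous g}.
Proof.
move=> oU Ux fg cf; change (g @ x --> g x); rewrite -(fg x Ux).
by apply: cvg_trans cf; apply: near_eq_cvg; apply: (near_open oU Ux).
Qed.

Lemma Ck_eq n N (U : set 'rV[R]_n) f g : open U -> (forall x, U x -> f x = g x) ->
  Ck N U f -> Ck N U g.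
Proof.
move=> oU; elim: N f g => [|N IH] f g fg [cf df].
  by split=> // x Ux; exact: continuous_eq_on oU Ux fg (cf x Ux).
split=> [x Ux|i]; first exact: continuous_eq_on oU Ux fg (cf x Ux).
have [d1 d2] := df i; split=> [x Ux|].
  by apply: (near_eq_derivable _ (d1 x Ux)); apply: (near_open oU Ux).
apply: (IH (rpd i f)) => // x Ux.
by apply: near_eq_derive; apply: (near_open oU Ux).
Qed.

(** Continuity of [f] comes from its continuous partials through [C1_differentiable], so a closure
    property only has to exhibit the partials. *)
Lemma Ck_step n N (U : set 'rV[R]_n) f (f' : 'I_n -> 'rV[R]_n -> R) : open U ->
  (forall x i, U x -> is_derive x (e_ i) f (f' i x)) -> (forall i, Ck N U (f' i)) ->
  Ck N.+1 U f.
Proof.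
move=> oU df cf'.
have dE i x : U x -> f' i x = rpd i f x by move=> Ux; have [_ <-] := df x i Ux.
have cr i : Ck N U (rpd i f) by apply: (@Ck_eq _ _ _ (f' i)) => //; exact: dE.
have dd i x : U x -> derivable f x (e_ i) by move=> Ux; have [] := df x i Ux.
split=> [x Ux|i]; last by split=> // x; exact: dd.
have [] := @C1_differentiable R n U f x oU Ux dd (fun i => Ck_cont (cr i) Ux).
by move=> /differentiable_continuous.
Qed.

Lemma Ck_inv n N (U : set 'rV[R]_n) f i : Ck N.+1 U f ->
  Ck N U (rpd i f) /\ forall x, U x -> is_derive x (e_ i) f (rpd i f x).
Proof.
move=> [_ /(_ i)[d1 d2]]; split => // x Ux.
by apply/derivableP; exact: d1.
Qed.

Lemma Ck_differentiable n N (U : set 'rV[R]_n) f x : open U -> U x -> Ck N.+1 U f ->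
  differentiable f x /\ forall v, 'd f x v = \sum_i v 0 i * rpd i f x.
Proof.
move=> oU Ux [cf df]; apply: (C1_differentiable oU Ux) => [i y Uy|i].
  by have [d1 _] := df i; exact: d1.
by have [_ d2] := df i; exact: (Ck_cont d2 Ux).
Qed.

Lemma Ck_cst n N (U : set 'rV[R]_n) (a : R) : open U -> Ck N U (fun=> a).
Proof.
move=> oU; elim: N a => [|N IH] a; first by split=> // x _; exact: cst_continuous.
exact: (Ck_step (f' := fun _ _ => 0)).
Qed.

Lemma CkD n N (U : set 'rV[R]_n) f g : open U -> Ck N U f -> Ck N U g ->
  Ck N U (fun x => f x + g x).
Proof.
move=> oU; elim: N f g => [|N IH] f g Cf Cg.
  by split=> // x Ux; exact: (cvgD (Ck_cont Cf Ux) (Ck_cont Cg Ux)).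
apply: (Ck_step (f' := fun i x => rpd i f x + rpd i g x)) => // [x i Ux|i].
  have [_ df] := Ck_inv i Cf; have [_ dg] := Ck_inv i Cg.
  exact: (is_deriveD (df x Ux) (dg x Ux)).
by apply: IH; [have [] := Ck_inv i Cf|have [] := Ck_inv i Cg].
Qed.

Lemma CkM n N (U : set 'rV[R]_n) f g : open U -> Ck N U f -> Ck N U g ->
  Ck N U (fun x => f x * g x).
Proof.
move=> oU; elim: N f g => [|N IH] f g Cf Cg.
  by split=> // x Ux; exact: (cvgM (Ck_cont Cf Ux) (Ck_cont Cg Ux)).
apply: (Ck_step (f' := fun i x => f x * rpd i g x + g x * rpd i f x)) => // [x i Ux|i].
  have [_ df] := Ck_inv i Cf; have [_ dg] := Ck_inv i Cg.
  exact: (is_deriveM (df x Ux) (dg x Ux)).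
have [f1 _] := Ck_inv i Cf; have [g1 _] := Ck_inv i Cg.
by apply: CkD => //; apply: IH => //; exact: CkW.
Qed.

Lemma CkN n N (U : set 'rV[R]_n) f : open U -> Ck N U f -> Ck N U (fun x => - f x).
Proof.
move=> oU Cf; apply: (@Ck_eq _ _ _ (fun x => -1 * f x)) => //.
  by move=> x _; rewrite mulN1r.
by apply: CkM => //; exact: Ck_cst.
Qed.

Lemma is_derive_coord n (x v : 'rV[R]_n) i : is_derive x v (fun y : 'rV[R]_n => y 0 i) (v 0 i).
Proof.
have D := @derivable_id R _ x v.
split; first exact: ((derivable_mxP id x v).1 D 0 i).
by move: (derive_mx D); rewrite derive_id => /rowP /(_ i); rewrite mxE => <-.
Qed.

Lemma Ck_coord n N (U : set 'rV[R]_n) i : open U -> Ck N U (fun x => x 0 i).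
Proof.
move=> oU; case: N => [|N].
  by split=> // x Ux; exact: coord_continuous.
apply: (Ck_step (f' := fun j _ => e_ j 0 i)) => // [x j Ux|j]; last exact: Ck_cst.
exact: is_derive_coord.
Qed.

(** The last hypothesis asks for the composite with [h'] at lower orders only. This suits inverse,
    exponential, sine and cosine, whose derivatives are expressed by the same functions, so that
    induction on the order supplies it. *)
Lemma Ck_comp1 n N (U : set 'rV[R]_n) (D : set R) (h : R -> R) (h' : R -> R) f :
  open U -> (forall x, U x -> D (f x)) ->
  (forall y, D y -> is_derive y 1 h (h' y)) -> Ck N U f ->
  (forall M, (M < N)%N -> Ck M U (h' \o f)) -> Ck N U (h \o f).
Proof.
move=> oU UD dh; case: N => [|N] Cf Ch.
  split=> // x Ux; have [dh1 _] := dh _ (UD _ Ux).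
  exact: (cvg_comp _ _ (Ck_cont Cf Ux)
    (differentiable_continuous ((derivable1_diffP _ _).1 dh1))).
apply: (Ck_step (f' := fun i x => rpd i f x * h' (f x))) => // [x i Ux|i].
  have [_ df] := Ck_inv i Cf.
  exact: (is_derive_comp1 (df x Ux) (dh _ (UD _ Ux))).
by have [f1 _] := Ck_inv i Cf; apply: CkM => //; exact: Ch.
Qed.

Lemma is_derive1_inv (y : R) : y != 0 -> is_derive y 1 (fun z : R => z^-1) (- y ^- 2).
Proof.
move=> y0; have D : derivable (@id R) y 1 := @derivable_id R _ y 1.
split; first exact: (derivableV (f := @id R)).
by rewrite (@deriveV _ _ (@id R)) // derive_id scaleNr [_%:A]mulr1.
Qed.

Lemma CkV n N (U : set 'rV[R]_n) f : open U -> (forall x, U x -> f x != 0) ->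
  Ck N U f -> Ck N U (fun x => (f x)^-1).
Proof.
move=> oU f0; elim: N => [|N IH] Cf.
  apply: (@Ck_comp1 _ _ _ [set y | y != 0] (fun y => y^-1) (fun y => - (y ^- 2))) => //.
  exact: is_derive1_inv.
apply: (@Ck_comp1 _ _ _ [set y | y != 0] (fun y => y^-1) (fun y => - (y ^- 2))) => //.
  exact: is_derive1_inv.
move=> M; rewrite ltnS => MN; have Ci := Ck_le MN (IH (CkW Cf)).
apply: (@Ck_eq _ _ _ (fun x => - ((f x)^-1 * (f x)^-1))) => //.
  by move=> x _ /=; rewrite -expr2 exprVn.
by apply: CkN => //; apply: CkM.
Qed.

Lemma Ck_ln n N (U : set 'rV[R]_n) f : open U -> (forall x, U x -> 0 < f x) ->
  Ck N U f -> Ck N U (fun x => ln (f x)).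
Proof.
move=> oU f0 Cf.
apply: (@Ck_comp1 _ _ _ [set y | 0 < y] (@ln R) (fun y => y^-1)) => //.
move=> M MN; apply: CkV => //; last exact: Ck_le (ltnW MN) Cf.
by move=> x Ux; rewrite gt_eqF // f0.
Qed.

Lemma Ck_expR n N (U : set 'rV[R]_n) f : open U -> Ck N U f -> Ck N U (fun x => expR (f x)).
Proof.
move=> oU; elim: N => [|N IH] Cf;
  apply: (@Ck_comp1 _ _ _ setT (@expR R) (@expR R)) => //.
by move=> M; rewrite ltnS => MN; exact: Ck_le MN (IH (CkW Cf)).
Qed.

(** Proved together because each is, up to sign, the derivative of the other. *)
Lemma Ck_sincos n N (U : set 'rV[R]_n) f : open U -> Ck N U f ->
  Ck N U (fun x => sin (f x)) /\ Ck N U (fun x => cos (f x)).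
Proof.
move=> oU; elim: N => [|N IH] Cf; split.
- by apply: (@Ck_comp1 _ _ _ setT (@sin R) (@cos R)).
- by apply: (@Ck_comp1 _ _ _ setT (@cos R) (fun x => - sin x)).
- apply: (@Ck_comp1 _ _ _ setT (@sin R) (@cos R)) => // M; rewrite ltnS => MN.
  by apply: Ck_le MN _; have [] := IH (CkW Cf).
- apply: (@Ck_comp1 _ _ _ setT (@cos R) (fun x => - sin x)) => // M; rewrite ltnS => MN.
  by apply: CkN => //; apply: Ck_le MN _; have [] := IH (CkW Cf).
Qed.

Lemma continuous_row (T : topologicalType) n (phi : T -> 'rV[R]_n) x :
  (forall j, {for x, continuous (fun y => phi y 0 j)}) -> {for x, continuous phi}.
Proof.
move=> H; apply/cvgrPdist_le => e e0.
have : \forall t \near x, forall j, `|phi x 0 j - phi t 0 j| <= e.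
  by apply: filter_forall => j; have /cvgrPdist_le := H j; apply.
apply: filterS => t Ht; apply: norm_le_coord; first exact: ltW.
by move=> j; rewrite !mxE.
Qed.

Lemma Ck_sum n N (U : set 'rV[R]_n) I (r : seq I) (P : pred I) (f : I -> 'rV[R]_n -> R) :
  open U -> (forall i, Ck N U (f i)) -> Ck N U (fun x => \sum_(i <- r | P i) f i x).
Proof.
move=> oU Cf; elim: r => [|i r IH].
  by apply: (@Ck_eq _ _ _ (fun=> 0)) => //; [move=> x _; rewrite big_nil|exact: Ck_cst].
apply: (@Ck_eq _ _ _ (fun x => (if P i then f i x else 0) + \sum_(j <- r | P j) f j x)) => //.
  by move=> x _; rewrite big_cons; case: (P i) => //; rewrite add0r.
by apply: CkD => //; case: (P i) => //; exact: Ck_cst.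
Qed.

Lemma Ck_comp m n N (V : set 'rV[R]_m) (U : set 'rV[R]_n) (phi : 'rV[R]_m -> 'rV[R]_n) f :
  open V -> open U -> (forall x, V x -> U (phi x)) ->
  (forall j, Ck N V (fun x => phi x 0 j)) -> Ck N U f -> Ck N V (f \o phi).
Proof.
move=> oV oU VU; elim: N f => [|N IH] f Cphi Cf.
  split=> // x Vx; have cphi := continuous_row (fun j => Ck_cont (Cphi j) Vx).
  exact: (cvg_comp _ _ cphi (Ck_cont Cf (VU _ Vx))).
apply: (Ck_step (f' := fun i x => \sum_j rpd i (fun y => phi y 0 j) x * rpd j f (phi x))) => //.
  move=> x i Vx; have [Df dE] := Ck_differentiable oU (VU _ Vx) Cf.
  have H j : is_derive x (e_ i) (fun z => phi z 0 j) (rpd i (fun y => phi y 0 j) x).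
    by have [_ /(_ _ Vx)] := Ck_inv i (Cphi j).
  have := is_derive_chain H Df; rewrite dE; congr (is_derive _ _ _ _).
  by apply: eq_bigr => j _; rewrite mxE.
move=> i; apply: Ck_sum => // j; apply: CkM => //.
  by have [] := Ck_inv i (Cphi j).
apply: IH; last by have [] := Ck_inv j Cf.
by move=> k; apply: CkW.
Qed.

End Ck.

(** * Complex-valued smooth functions *)

Section ComplexCalculus.
Variable R : realType.
Notation C := (R[i]).
Notation e_ := (ebasis R).
Notation Re := complex.Re.
Notation Im := complex.Im.
Implicit Types (a b : C).

Lemma RecD a b : Re (a + b) = Re a + Re b. Proof. by case: a b => ? ? []. Qed.
Lemma ImcD a b : Im (a + b) = Im a + Im b. Proof. by case: a b => ? ? []. Qed.
Lemma RecM a b : Re (a * b) = Re a * Re b - Im a * Im b. Proof. by case: a b => ? ? []. Qed.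
Lemma ImcM a b : Im (a * b) = Re a * Im b + Im a * Re b. Proof. by case: a b => ? ? []. Qed.

Lemma RCD (x y : R) : RC (x + y) = RC x + RC y. Proof. by rewrite /RC; simpc. Qed.
Lemma RCN (x : R) : RC (- x) = - RC x. Proof. by rewrite /RC; simpc. Qed.
Lemma RCM (x y : R) : RC (x * y) = RC x * RC y. Proof. by rewrite /RC; simpc. Qed.
Lemma RC0 : RC (0 : R) = 0. Proof. by []. Qed.
Lemma RC1 : RC (1 : R) = 1. Proof. by []. Qed.
Lemma RCX (x : R) n : RC (x ^+ n) = RC x ^+ n.
Proof. by elim: n => // n IH; rewrite !exprS RCM IH. Qed.
Lemma RC_nat n : RC (n%:R : R) = n%:R.
Proof. by elim: n => // n IH; rewrite -!natr1 RCD IH. Qed.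
Lemma RC_eq0 (x : R) : (RC x == 0) = (x == 0).
Proof. by rewrite eq_complex /= eqxx andbT. Qed.
Lemma RCV (x : R) : RC x^-1 = (RC x)^-1.
Proof.
have [->|x0] := eqVneq x 0; first by rewrite invr0 !RC0 invr0.
have rx0 : RC x != 0 by rewrite RC_eq0.
by apply: (mulfI rx0); rewrite mulfV // -RCM mulfV.
Qed.

Definition is_cderive (V : normedModType R) (x v : V) (F : V -> C) (d : C) : Prop :=
  is_derive x v (fun y => Re (F y)) (Re d) /\ is_derive x v (fun y => Im (F y)) (Im d).

Lemma is_cderive_pd n (x : 'rV[R]_n) i F d : is_cderive x (e_ i) F d -> pd i F x = d.
Proof. by case: d => d1 d2 [[_ h1] [_ h2]]; rewrite /pd h1 h2. Qed.

Lemma is_cderive_cst (V : normedModType R) (x v : V) a : is_cderive x v (fun=> a) 0.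
Proof. by split; exact: is_derive_cst. Qed.

Lemma is_cderiveD (V : normedModType R) (x v : V) F G a b :
  is_cderive x v F a -> is_cderive x v G b -> is_cderive x v (fun y => F y + G y) (a + b).
Proof.
move=> [F1 F2] [G1 G2]; split.
  by rewrite RecD; under eq_fun do rewrite RecD; exact: is_deriveD.
by rewrite ImcD; under eq_fun do rewrite ImcD; exact: is_deriveD.
Qed.

Lemma is_cderiveM (V : normedModType R) (x v : V) F G a b :
  is_cderive x v F a -> is_cderive x v G b ->
  is_cderive x v (fun y => F y * G y) (a * G x + F x * b).
Proof.
move=> [F1 F2] [G1 G2]; split.
  under eq_fun do rewrite RecM.
  have := is_deriveB (is_deriveM F1 G1) (is_deriveM F2 G2).
  congr (is_derive _ _ _ _); rewrite RecD !RecM /GRing.scale /=; ring.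
under eq_fun do rewrite ImcM.
have := is_deriveD (is_deriveM F1 G2) (is_deriveM F2 G1).
congr (is_derive _ _ _ _); rewrite ImcD !ImcM /GRing.scale /=; ring.
Qed.

Lemma is_cderive_RC (V : normedModType R) (x v : V) (f : V -> R) d :
  is_derive x v f d -> is_cderive x v (fun y => RC (f y)) (RC d).
Proof. by split=> //; exact: is_derive_cst. Qed.

Lemma is_cderive_near (V : normedModType R) (x v : V) (F G : V -> C) d :
  (\forall y \near x, F y = G y) -> is_cderive x v F d -> is_cderive x v G d.
Proof.
move=> FG [F1 F2]; split.
  by apply: near_eq_is_derive F1; apply: filterS FG => y ->.
by apply: near_eq_is_derive F2; apply: filterS FG => y ->.
Qed.

Definition csm n (U : set 'rV[R]_n) (F : 'rV[R]_n -> C) : Prop :=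
  forall N, Ck N U (fun x => Re (F x)) /\ Ck N U (fun x => Im (F x)).

Lemma csm_pd n (U : set 'rV[R]_n) F i : csm U F -> csm U (pd i F).
Proof. by move=> sF N; have [/(Ck_inv i) [? _] /(Ck_inv i) [? _]] := sF N.+1. Qed.

Lemma csm_ipd n (U : set 'rV[R]_n) F w : csm U F -> csm U (ipd w F).
Proof. by move=> sF; elim: w => //= i w; exact: csm_pd. Qed.

Lemma csm_der n (U : set 'rV[R]_n) F i x : csm U F -> U x -> is_cderive x (e_ i) F (pd i F x).
Proof.
by move=> sF Ux; have [/(Ck_inv i) [_ d1] /(Ck_inv i) [_ d2]] := sF 1%N; split;
  [exact: d1|exact: d2].
Qed.

Lemma ipd_rcons n (w : seq 'I_n) i (F : 'rV[R]_n -> C) : ipd (rcons w i) F = ipd w (pd i F).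
Proof. by rewrite /ipd foldr_rcons. Qed.

Lemma ipd_cat n (w1 w2 : seq 'I_n) (F : 'rV[R]_n -> C) : ipd (w1 ++ w2) F = ipd w1 (ipd w2 F).
Proof. by rewrite /ipd foldr_cat. Qed.

(** In [ipd] the last letter of a word is the derivative taken first; peeling it off matches the
    recursion of [Ck]. *)
Lemma smooth_onE n (U : set 'rV[R]_n) F : smooth_on U F <-> open U /\ csm U F.
Proof.
split=> [[oU sF]|[oU sF]]; split=> //.
  move=> N; elim: N F sF => [|N IH] F sF.
    by split; split=> // x /(sF [::]) [? [? _]].
  have sp i : Ck N U (fun x => Re (pd i F x)) /\ Ck N U (fun x => Im (pd i F x)).
    by apply: IH => w x Ux; rewrite -ipd_rcons; exact: sF.
  split; split=> [x /(sF [::]) [? [? _]]|i] //; split; try by have [] := sp i.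
    by move=> x /(sF [::]) [_ [_ /(_ i)[]]].
  by move=> x /(sF [::]) [_ [_ /(_ i)[]]].
move=> w x Ux; have sw := csm_ipd w sF.
have [c1 c2] := sw 0%N; split; first exact: Ck_cont c1 _ Ux.
split; first exact: Ck_cont c2 _ Ux.
by move=> i; have [[d1 _] [d2 _]] := csm_der i sw Ux.
Qed.

Section SmoothOn.
Variables (n : nat) (U : set 'rV[R]_n).
Implicit Types F G : 'rV[R]_n -> C.

Lemma smooth_open F : smooth_on U F -> open U. Proof. by case. Qed.
Lemma smooth_csm F : smooth_on U F -> csm U F. Proof. by move/smooth_onE => []. Qed.

Lemma smooth_der F i x : smooth_on U F -> U x -> is_cderive x (e_ i) F (pd i F x).
Proof. by move=> /smooth_csm; exact: csm_der. Qed.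

Lemma smooth_pd F i : smooth_on U F -> smooth_on U (pd i F).
Proof. by move=> /smooth_onE [oU sF]; apply/smooth_onE; split => //; exact: csm_pd. Qed.

Lemma smooth_ipd F w : smooth_on U F -> smooth_on U (ipd w F).
Proof. by move=> /smooth_onE [oU sF]; apply/smooth_onE; split => //; exact: csm_ipd. Qed.

Lemma smooth_eq F G : (forall x, U x -> F x = G x) -> smooth_on U F -> smooth_on U G.
Proof.
move=> FG /smooth_onE [oU sF]; apply/smooth_onE; split => // N.
have [c1 c2] := sF N; split.
  by apply: (Ck_eq oU _ c1) => x /FG ->.
by apply: (Ck_eq oU _ c2) => x /FG ->.
Qed.

Lemma smooth_cst a : open U -> smooth_on U (fun=> a).
Proof. by move=> oU; apply/smooth_onE; split => // N; split; exact: Ck_cst. Qed.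

Lemma smoothD F G : smooth_on U F -> smooth_on U G -> smooth_on U (fun x => F x + G x).
Proof.
move=> /smooth_onE [oU sF] /smooth_onE [_ sG]; apply/smooth_onE; split => // N.
have [f1 f2] := sF N; have [g1 g2] := sG N; split.
  by apply: (Ck_eq oU _ (CkD oU f1 g1)) => x _; rewrite RecD.
by apply: (Ck_eq oU _ (CkD oU f2 g2)) => x _; rewrite ImcD.
Qed.

Lemma smoothM F G : smooth_on U F -> smooth_on U G -> smooth_on U (fun x => F x * G x).
Proof.
move=> /smooth_onE [oU sF] /smooth_onE [_ sG]; apply/smooth_onE; split => // N.
have [f1 f2] := sF N; have [g1 g2] := sG N; split.
  apply: (Ck_eq oU _ (CkD oU (CkM oU f1 g1) (CkN oU (CkM oU f2 g2)))) => x _.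
  by rewrite RecM.
by apply: (Ck_eq oU _ (CkD oU (CkM oU f1 g2) (CkM oU f2 g1))) => x _; rewrite ImcM.
Qed.

Lemma smoothZ a F : smooth_on U F -> smooth_on U (fun x => a * F x).
Proof. by move=> sF; apply: smoothM => //; apply: smooth_cst; case: sF. Qed.

Lemma smoothN F : smooth_on U F -> smooth_on U (fun x => - F x).
Proof. by move=> /(smoothZ (-1)); apply: smooth_eq => x _; rewrite mulN1r. Qed.

Lemma smoothB F G : smooth_on U F -> smooth_on U G -> smooth_on U (fun x => F x - G x).
Proof. by move=> sF /smoothN; exact: smoothD. Qed.

Lemma smooth_sum I (r : seq I) (P : pred I) (F : I -> 'rV[R]_n -> C) : open U ->
  (forall i, smooth_on U (F i)) -> smooth_on U (fun x => \sum_(i <- r | P i) F i x).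
Proof.
move=> oU sF; elim: r => [|i r IH].
  by apply: smooth_eq (smooth_cst 0 oU) => x _; rewrite big_nil.
apply: (@smooth_eq (fun x => (if P i then F i x else 0) + \sum_(j <- r | P j) F j x)).
  by move=> x _; rewrite big_cons; case: (P i) => //; rewrite add0r.
by apply: smoothD => //; case: (P i) => //; exact: smooth_cst.
Qed.

Lemma smooth_RC (f : 'rV[R]_n -> R) : open U -> (forall N, Ck N U f) -> smooth_on U (fun x => RC (f x)).
Proof. by move=> oU Cf; apply/smooth_onE; split=> // N; split => //; exact: Ck_cst. Qed.

Lemma smooth_coord i : open U -> smooth_on U (fun x => RC (x 0 i)).
Proof. by move=> oU; apply: smooth_RC => // N; exact: Ck_coord. Qed.

(** The function is the complex power [f ^ z]; its modulus and its phase are treated as real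
    functions. *)
Lemma smooth_power (f : 'rV[R]_n -> R) (z : C) : open U -> (forall x, U x -> 0 < f x) ->
  (forall N, Ck N U f) -> smooth_on U (fun x => cexp (z * RC (ln (f x)))).
Proof.
move=> oU f0 Cf.
have Cl (a : R) N : Ck N U (fun x => a * ln (f x)).
  by apply: CkM => //; [exact: Ck_cst|exact: Ck_ln].
apply: (@smooth_eq (fun x => RC (expR (Re z * ln (f x))) *
   Complex (cos (Im z * ln (f x))) (sin (Im z * ln (f x))))).
  by move=> x _; rewrite /cexp RecM ImcM /= !mulr0 subr0 add0r.
apply: smoothM; first by apply: smooth_RC => // N; exact: Ck_expR.
by apply/smooth_onE; split => // N; have [] := Ck_sincos oU (Cl (Im z) N).
Qed.

Lemma pd_comm F i j x : smooth_on U F -> U x -> pd i (pd j F) x = pd j (pd i F) x.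
Proof.
move=> /smooth_onE [oU sF] Ux.
have S (f : 'rV[R]_n -> R) : (forall N, Ck N U f) -> rpd i (rpd j f) x = rpd j (rpd i f) x.
  move=> Cf; have C1 k : Ck 2 U (rpd k f) by have [] := Ck_inv k (Cf 3%N).
  apply: (@schwarz R n U f x i j oU Ux).
  - by move=> k y Uy; have [_ /(_ y Uy) []] := Ck_inv k (Cf 1%N).
  - by move=> k l y Uy; have [_ /(_ y Uy) []] := Ck_inv l (C1 k).
  - by move=> k l; have [c _] := Ck_inv k (C1 l); exact: Ck_cont c _ Ux.
have S1 := S _ (fun N => (sF N).1); have S2 := S _ (fun N => (sF N).2).
change (Complex (rpd i (rpd j (fun y => Re (F y))) x) (rpd i (rpd j (fun y => Im (F y))) x) =
  Complex (rpd j (rpd i (fun y => Re (F y))) x) (rpd j (rpd i (fun y => Im (F y))) x)).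
by rewrite S1 S2.
Qed.

Lemma pd_eq F G i x : open U -> U x -> (forall y, U y -> F y = G y) -> pd i F x = pd i G x.
Proof.
move=> oU Ux FG; rewrite /pd; congr Complex; apply: near_eq_derive;
  by apply: (near_open oU Ux) => y /FG ->.
Qed.

Lemma ipd_eq F G w x : open U -> U x -> (forall y, U y -> F y = G y) -> ipd w F x = ipd w G x.
Proof.
move=> oU Ux FG; elim: w x Ux => [|i w IH] x Ux /=; first exact: FG.
by apply: pd_eq => // y Uy; exact: IH.
Qed.

Lemma is_cderive_chain (V : normedModType R) (phi : V -> 'rV[R]_n) F x v (a : 'I_n -> R) :
  smooth_on U F -> U (phi x) -> (forall j, is_derive x v (fun z => phi z 0 j) (a j)) ->
  is_cderive x v (F \o phi) (\sum_j RC (a j) * pd j F (phi x)).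
Proof.
move=> /smooth_onE [oU sF] Ux H; have [f1 f2] := sF 1%N.
have [D1 E1] := Ck_differentiable oU Ux f1; have [D2 E2] := Ck_differentiable oU Ux f2.
split.
  have := is_derive_chain H D1; rewrite E1; congr (is_derive _ _ _ _).
  rewrite (big_morph (@complex.Re R) RecD (erefl : Re (0 : C) = 0)).
  by apply: eq_bigr => j _; rewrite !mxE RecM /= mul0r subr0.
have := is_derive_chain H D2; rewrite E2; congr (is_derive _ _ _ _).
rewrite (big_morph (@complex.Im R) ImcD (erefl : Im (0 : C) = 0)).
by apply: eq_bigr => j _; rewrite !mxE ImcM /= mul0r addr0.
Qed.

End SmoothOn.

Lemma smooth_comp m n (V : set 'rV[R]_m) (U : set 'rV[R]_n) (phi : 'rV[R]_m -> 'rV[R]_n) F :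
  open V -> (forall x, V x -> U (phi x)) ->
  (forall N j, Ck N V (fun x => phi x 0 j)) -> smooth_on U F -> smooth_on V (F \o phi).
Proof.
move=> oV VU Cphi /smooth_onE [oU sF]; apply/smooth_onE; split=> // N.
have [f1 f2] := sF N; split; first exact: (Ck_comp oV oU VU (Cphi N) f1).
exact: (Ck_comp oV oU VU (Cphi N) f2).
Qed.

End ComplexCalculus.

(** * Iterated partial derivatives along words *)

Section Words.
Variable R : realType.
Notation C := (R[i]).
Notation e_ := (ebasis R).

Section OnU.
Variables (n : nat) (U : set 'rV[R]_n).
Implicit Types F G : 'rV[R]_n -> C.

Lemma pdD F G i x : smooth_on U F -> smooth_on U G -> U x ->
  pd i (fun y => F y + G y) x = pd i F x + pd i G x.
Proof. by move=> sF sG Ux; apply: is_cderive_pd (is_cderiveD (smooth_der i sF Ux) (smooth_der i sG Ux)). Qed.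

Lemma pdM F G i x : smooth_on U F -> smooth_on U G -> U x ->
  pd i (fun y => F y * G y) x = pd i F x * G x + F x * pd i G x.
Proof. by move=> sF sG Ux; apply: is_cderive_pd (is_cderiveM (smooth_der i sF Ux) (smooth_der i sG Ux)). Qed.

Lemma pd_cst (a : C) i (x : 'rV[R]_n) : pd i (fun=> a) x = 0.
Proof. exact: is_cderive_pd (is_cderive_cst _ _ _). Qed.

Lemma pdZ F a i x : smooth_on U F -> U x -> pd i (fun y => a * F y) x = a * pd i F x.
Proof.
move=> sF Ux; rewrite (pdM i (smooth_cst a (smooth_open sF)) sF Ux).
by rewrite (pd_cst a i x) mul0r add0r.
Qed.

Lemma pd_coord i j (x : 'rV[R]_n) : pd i (fun y => RC (y 0 j)) x = (i == j)%:R.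
Proof.
have := is_cderive_RC (is_derive_coord x (e_ i) j); rewrite mxE RC_nat.
exact: is_cderive_pd.
Qed.

Lemma ipdD F G w x : smooth_on U F -> smooth_on U G -> U x ->
  ipd w (fun y => F y + G y) x = ipd w F x + ipd w G x.
Proof.
move=> sF sG; have oU := smooth_open sF.
elim: w x => //= i w IH x Ux; rewrite -(pdD i (smooth_ipd w sF) (smooth_ipd w sG) Ux).
exact: (pd_eq i oU Ux IH).
Qed.

Lemma ipdZ F a w x : smooth_on U F -> U x -> ipd w (fun y => a * F y) x = a * ipd w F x.
Proof.
move=> sF; have oU := smooth_open sF.
elim: w x => //= i w IH x Ux; rewrite -(pdZ a i (smooth_ipd w sF) Ux).
exact: (pd_eq i oU Ux IH).
Qed.

Lemma ipd_sum I (r : seq I) (P : pred I) (F : I -> 'rV[R]_n -> C) w x :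
  open U -> (forall i, smooth_on U (F i)) -> U x ->
  ipd w (fun y => \sum_(i <- r | P i) F i y) x = \sum_(i <- r | P i) ipd w (F i) x.
Proof.
move=> oU sF Ux; elim: r => [|i r IH].
  rewrite big_nil (ipd_eq w oU Ux (G := fun y => 0 * (fun=> 0) y)).
    by rewrite (ipdZ 0 w (smooth_cst 0 oU) Ux) mul0r.
  by move=> y _; rewrite big_nil mul0r.
have sr := smooth_sum r P oU sF.
rewrite big_cons; case: ifP => Pi.
  rewrite -IH -(ipdD w (sF i) sr Ux).
  by apply: (ipd_eq w oU Ux) => y _; rewrite big_cons Pi.
by rewrite -IH; apply: (ipd_eq w oU Ux) => y _; rewrite big_cons Pi.
Qed.

Lemma pd_ipd F i w x : smooth_on U F -> U x -> pd i (ipd w F) x = ipd w (pd i F) x.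
Proof.
move=> sF; have oU := smooth_open sF.
elim: w x => //= j w IH x Ux; rewrite (pd_comm i j (smooth_ipd w sF) Ux).
exact: (pd_eq j oU Ux IH).
Qed.

Lemma ipd_perm F w w' x : perm_eq w w' -> smooth_on U F -> U x -> ipd w F x = ipd w' F x.
Proof.
move=> + sF; have oU := smooth_open sF.
elim: w w' x => [|i w IH] w' x; first by rewrite perm_sym => /perm_nilP ->.
move=> pw Ux; have iw' : i \in w' by rewrite -(perm_mem pw) mem_head.
move: pw; case/splitPr: iw' => w1 w2; rewrite perm_sym perm_catC /= perm_cons perm_catC perm_sym.
move=> pw; rewrite ipd_cat /= -(pd_ipd i w1 (smooth_ipd w2 sF) Ux).
by apply: (pd_eq i oU Ux) => y Uy; rewrite -ipd_cat; exact: IH.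
Qed.

(* Leibniz for a coordinate function: each occurrence of [i] in [w] may hit it once. *)
Lemma ipd_coordM G i w x : smooth_on U G -> U x ->
  ipd w (fun y => RC (y 0 i) * G y) x =
  RC (x 0 i) * ipd w G x + (count_mem i w)%:R * ipd (rem i w) G x.
Proof.
move=> sG; have oU := smooth_open sG.
elim: w x => [|j w IH] x Ux; first by rewrite /= mul0r addr0.
rewrite /= (pd_eq j oU Ux IH).
have sx := smooth_coord i oU; have sw := smooth_ipd w sG; have sr := smooth_ipd (rem i w) sG.
rewrite (pdD j (smoothM sx sw) (smoothZ _ sr) Ux) (pdM j sx sw Ux) (pdZ _ j sr Ux) pd_coord.
case: eqVneq => [->|ji]; last by rewrite mul0r add0r add0n.
have -> : (count_mem i w)%:R * pd i (ipd (rem i w) G) x = (count_mem i w)%:R * ipd w G x.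
  have [iw|niw] := boolP (i \in w); last by rewrite (count_memPn niw) !mul0r.
  by congr (_ * _); apply: (@ipd_perm G (i :: rem i w)) => //; rewrite perm_sym; exact: perm_to_rem.
by rewrite ?eqxx /= natrD; ring.
Qed.

End OnU.

(** [psi] carries steps in direction [i] to steps in direction [k i], so the difference quotients on
    both sides coincide. *)
Lemma ipd_slice m n (psi : 'rV[R]_m -> 'rV[R]_n) (k : 'I_m -> 'I_n) (F : 'rV[R]_n -> C) w x :
  (forall i (h : R) y, psi (h *: e_ i + y) = h *: e_ (k i) + psi y) ->
  ipd w (F \o psi) x = ipd (map k w) F (psi x).
Proof.
move=> H; elim: w x => //= i w IH x.
rewrite (_ : ipd w (F \o psi) = ipd (map k w) F \o psi); last exact/funext.
move: (ipd _ F) => {IH}F; rewrite /pd /derive.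
have E (f : 'rV[R]_n -> R) : (fun h : R => h^-1 *: (((fun y => f (psi y)) \o shift x) (h *: e_ i) - f (psi x)))
   = (fun h : R => h^-1 *: ((f \o shift (psi x)) (h *: e_ (k i)) - f (psi x))).
  by apply/funext => h /=; rewrite H.
by have := E (fun y => complex.Re (F y)); have := E (fun y => complex.Im (F y)) => /= -> ->.
Qed.

Lemma ebasis_lshift m n (i : 'I_m) : e_ (lshift n i) = row_mx (e_ i) 0.
Proof.
apply/rowP => j; rewrite !mxE; case: splitP => k jk; rewrite !mxE.
  by congr ((_ : bool)%:R); apply/eqP/eqP => [/(congr1 val)|/(congr1 val)] E; apply/val_inj;
    rewrite /= ?jk //= in E *; rewrite ?jk.
case: eqP => // /(congr1 val) /= E; move: (ltn_ord i).
by rewrite E jk ltnNge leq_addr.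
Qed.

Lemma ebasis_rshift m n (i : 'I_n) : e_ (rshift m i) = row_mx 0 (e_ i).
Proof.
apply/rowP => j; rewrite !mxE; case: splitP => k jk; rewrite !mxE.
  case: eqP => // /(congr1 val) /= E; move: (ltn_ord k).
  by rewrite -jk -E ltnNge leq_addr.
congr ((_ : bool)%:R); apply/eqP/eqP => [/(congr1 val) /=|/(congr1 val) /=] E; apply/val_inj => /=.
  by move: E; rewrite jk => /addnI.
by rewrite jk E.
Qed.

Lemma ipd_rslice m n (F : 'rV[R]_(m + n) -> C) u w x :
  ipd w (fun y => F (row_mx u y)) x = ipd (map (@rshift m n) w) F (row_mx u x).
Proof.
apply: (@ipd_slice _ _ (fun y => row_mx u y)) => i h y.
by rewrite ebasis_rshift scale_row_mx scaler0 add_row_mx add0r.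
Qed.

Lemma ipd_lslice m n (F : 'rV[R]_(m + n) -> C) u w x :
  ipd w (fun y => F (row_mx y u)) x = ipd (map (@lshift m n) w) F (row_mx x u).
Proof.
apply: (@ipd_slice _ _ (fun y => row_mx y u)) => i h y.
by rewrite ebasis_lshift scale_row_mx scaler0 add_row_mx add0r.
Qed.

(** Differentiation in a parameter and in the variable are both partials of one function of the
    joined variable, where they commute. *)
Lemma pd_ipd_param m n (U : set 'rV[R]_(m + n)) (F : 'rV[R]_(m + n) -> C) u x i w :
  smooth_on U F -> U (row_mx u x) ->
  pd i (fun u => ipd w (fun y => F (row_mx u y)) x) u =
  ipd w (fun y => pd i (fun u => F (row_mx u y)) u) x.
Proof.
move=> sF Ux.
have E u' : ipd w (fun y => F (row_mx u' y)) x = ipd (map (@rshift m n) w) F (row_mx u' x).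
  exact: ipd_rslice.
rewrite (_ : (fun u => _) = (fun u' => ipd (map (@rshift m n) w) F (row_mx u' x))); last exact/funext.
rewrite -[LHS]/(ipd [:: i] _ u) (ipd_lslice _ x [:: i]) /= (pd_ipd _ _ sF Ux).
rewrite -(ipd_rslice _ u); congr (ipd w _ x); apply/funext => y.
by rewrite -[RHS]/(ipd [:: i] _ u) (ipd_lslice F y [:: i]).
Qed.

Lemma Ck_row_mxl m n N (V : set 'rV[R]_m) (x : 'rV[R]_n) j : open V ->
  Ck N V (fun u => row_mx u x 0 j).
Proof.
move=> oV; case: (split_ordP j) => k ->.
  by apply: (Ck_eq oV _ (Ck_coord N k oV)) => u _; rewrite row_mxEl.
by apply: (Ck_eq oV _ (Ck_cst N (x 0 k) oV)) => u _; rewrite row_mxEr.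
Qed.

Lemma smooth_param m n (U : set 'rV[R]_(m + n)) (V : set 'rV[R]_m) F w x :
  smooth_on U F -> open V -> (forall u, V u -> U (row_mx u x)) ->
  smooth_on V (fun u => ipd w (fun y => F (row_mx u y)) x).
Proof.
move=> sF oV VU.
apply: (@smooth_eq _ _ _ (ipd (map (@rshift m n) w) F \o (fun u => row_mx u x))).
  by move=> u _; rewrite ipd_rslice.
by apply: (smooth_comp oV VU _ (smooth_ipd _ sF)) => N j; exact: Ck_row_mxl.
Qed.

End Words.

Opaque pd rpd.

(** * The Heisenberg group and symmetrized derivatives *)

Section Heisenberg.
Variable R : realType.
Notation C := (R[i]).
Notation i0 := (0 : 'I_3).
Notation i1 := (1 : 'I_3).
Notation i2 := (2%:R : 'I_3).
Implicit Types F G : 'rV[R]_3 -> C.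

Lemma ord3P (j : 'I_3) : [\/ j = i0, j = i1 | j = i2].
Proof.
by case: j => [[|[|[|//]]] Hj]; [constructor 1|constructor 2|constructor 3]; apply/val_inj.
Qed.

Lemma sum3E (V : nmodType) (f : 'I_3 -> V) : \sum_j f j = f i0 + f i1 + f i2.
Proof.
rewrite !big_ord_recl big_ord0 addr0 addrA.
by congr (_ + _ + _); congr f; apply/val_inj.
Qed.

Lemma row3P (T : Type) (x y : 'rV[T]_3) :
  x 0 i0 = y 0 i0 -> x 0 i1 = y 0 i1 -> x 0 i2 = y 0 i2 -> x = y.
Proof. by move=> E0 E1 E2; apply/rowP => j; case: (ord3P j) => ->. Qed.

Definition dd (p q r : nat) F : 'rV[R]_3 -> C := ipd (nseq p i0 ++ nseq q i1 ++ nseq r i2) F.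

Lemma dd_word F w x : smooth3 F ->
  ipd w F x = dd (count_mem i0 w) (count_mem i1 w) (count_mem i2 w) F x.
Proof.
move=> sF; apply: (ipd_perm _ sF) => //.
apply/allP => j _ /=; apply/eqP; rewrite !count_cat !count_nseq /=.
by case: (ord3P j) => ->; rewrite /= ?mul1n ?mul0n ?addn0.
Qed.

Lemma dd_pd F j p q r x : smooth3 F ->
  dd p q r (pd j F) x = dd (p + (j == i0)) (q + (j == i1)) (r + (j == i2)) F x.
Proof.
move=> sF; rewrite /dd -ipd_rcons (dd_word _ _ sF).
rewrite -cats1 !count_cat !count_nseq /= !addn0 ?mul1n ?mul0n ?addn0 ?add0n.
by case: (ord3P j) => ->; rewrite /= ?mul1n ?mul0n ?addn0 ?add0n.
Qed.

(** At the origin only the Leibniz terms in which a derivative hits the coordinate survive. If the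
    index is already zero, the truncated subtraction is harmless because the coefficient
    vanishes. *)
Lemma dd_coordM0 F j p q r : smooth3 F ->
  dd p q r (fun y => RC (y 0 j) * F y) 0 =
  (if j == i0 then p else if j == i1 then q else r)%:R *
  dd (p - (j == i0)) (q - (j == i1)) (r - (j == i2)) F 0.
Proof.
move=> sF; rewrite /dd (ipd_coordM _ _ sF) // mxE RC0 mul0r add0r.
have H i : count_mem i (nseq p i0 ++ nseq q i1 ++ nseq r i2) =
    (if i == i0 then p else if i == i1 then q else r).
  by rewrite !count_cat !count_nseq /=; case: (ord3P i) => ->; rewrite /= ?mul1n ?mul0n ?addn0 ?add0n.
rewrite H; set c := (if _ then _ else _)%:R; have [c0|c0] := eqVneq c 0; first by rewrite c0 !mul0r.
congr (_ * _); rewrite (dd_word _ _ sF) !count_rem !H /=.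
have -> : j \in nseq p i0 ++ nseq q i1 ++ nseq r i2.
  by rewrite -has_pred1 has_count H lt0n; apply: contra c0 => /eqP c0; rewrite /c c0.
by case: (ord3P j) => ->.
Qed.

Lemma ddD F G p q r x : smooth3 F -> smooth3 G ->
  dd p q r (fun y => F y + G y) x = dd p q r F x + dd p q r G x.
Proof. by move=> sF sG; apply: (ipdD _ sF sG). Qed.

Lemma ddZ F a p q r x : smooth3 F -> dd p q r (fun y => a * F y) x = a * dd p q r F x.
Proof. by move=> sF; apply: (ipdZ _ _ sF). Qed.

Lemma eq_dd F G p q r x : F =1 G -> dd p q r F x = dd p q r G x.
Proof. by move=> FG; rewrite (_ : F = G) //; apply/funext. Qed.

(** The Baker-Campbell-Hausdorff law of [N_-] in exponential coordinates: the last summand is half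
    the commutator, with [[N1m, N2m] = - N3m]. See [nbar_hmul]. *)
Definition hmul (x y : 'rV[R]_3) : 'rV[R]_3 := \row_j
  [:: x 0 i0 + y 0 i0; x 0 i1 + y 0 i1;
      x 0 i2 + y 0 i2 + (x 0 i1 * y 0 i0 - x 0 i0 * y 0 i1) / 2%:R]`_j.

Lemma hmulx0 x : hmul x 0 = x.
Proof. by apply: row3P; rewrite !mxE /=; ring. Qed.

Lemma is_derive_eqd (V : normedModType R) (x v : V) (f : V -> R) d d' :
  is_derive x v f d -> d = d' -> is_derive x v f d'.
Proof. by move=> ? <-. Qed.

Lemma is_derive_addf (V : normedModType R) (x v : V) (f g : V -> R) a b :
  is_derive x v f a -> is_derive x v g b -> is_derive x v (fun y => f y + g y) (a + b).
Proof. exact: is_deriveD. Qed.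

Lemma is_derive_oppf (V : normedModType R) (x v : V) (f : V -> R) a :
  is_derive x v f a -> is_derive x v (fun y => - f y) (- a).
Proof. exact: is_deriveN. Qed.

Lemma is_derive_mulf (V : normedModType R) (x v : V) (f g : V -> R) a b :
  is_derive x v f a -> is_derive x v g b -> is_derive x v (fun y => f y * g y) (f x * b + g x * a).
Proof. exact: is_deriveM. Qed.

Lemma is_derive_fun_eq (V : normedModType R) (x v : V) (f g : V -> R) d :
  f =1 g -> is_derive x v f d -> is_derive x v g d.
Proof. by move=> /funext ->. Qed.

End Heisenberg.

Ltac der := repeat first
  [ exact: is_derive_coord | exact: is_derive_cst | apply: is_derive_addf
  | apply: is_derive_oppf | apply: is_derive_mulf ].
Ltac solve_Ck := repeat first
  [ exact: (Ck_coord _ _ openT) | exact: (Ck_cst _ _ openT)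
  | apply: (CkD openT) | apply: (CkN openT) | apply: (CkM openT) ].

(** * Translations of the Heisenberg group and invariant vector fields *)

Section Heisenberg2.
Variable R : realType.
Notation C := (R[i]).
Notation e_ := (ebasis R).
Notation i0 := (0 : 'I_3).
Notation i1 := (1 : 'I_3).
Notation i2 := (2%:R : 'I_3).
Implicit Types F G : 'rV[R]_3 -> C.

Lemma is_derive_hmulr (x y v : 'rV[R]_3) j :
  is_derive y v (fun y => hmul x y 0 j)
    (v 0 j + (j == i2)%:R * ((x 0 i1 * v 0 i0 - x 0 i0 * v 0 i1) / 2%:R)).
Proof.
case: (ord3P j) => ->.
- apply: (@is_derive_fun_eq _ _ _ _ (fun y : 'rV[R]_3 => x 0 i0 + y 0 i0)); first by move=> z; rewrite mxE.
  by apply: is_derive_eqd; first der; rewrite /=; ring.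
- apply: (@is_derive_fun_eq _ _ _ _ (fun y : 'rV[R]_3 => x 0 i1 + y 0 i1)); first by move=> z; rewrite mxE.
  by apply: is_derive_eqd; first der; rewrite /=; ring.
apply: (@is_derive_fun_eq _ _ _ _ (fun y : 'rV[R]_3 => x 0 i2 + y 0 i2 + (x 0 i1 * y 0 i0 - x 0 i0 * y 0 i1) / 2%:R)).
  by move=> z; rewrite mxE.
by apply: is_derive_eqd; first der; rewrite /=; ring.
Qed.

Lemma is_derive_hmull (x y v : 'rV[R]_3) j :
  is_derive x v (fun x => hmul x y 0 j)
    (v 0 j + (j == i2)%:R * ((v 0 i1 * y 0 i0 - v 0 i0 * y 0 i1) / 2%:R)).
Proof.
case: (ord3P j) => ->.
- apply: (@is_derive_fun_eq _ _ _ _ (fun x : 'rV[R]_3 => x 0 i0 + y 0 i0)); first by move=> z; rewrite mxE.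
  by apply: is_derive_eqd; first der; rewrite /=; ring.
- apply: (@is_derive_fun_eq _ _ _ _ (fun x : 'rV[R]_3 => x 0 i1 + y 0 i1)); first by move=> z; rewrite mxE.
  by apply: is_derive_eqd; first der; rewrite /=; ring.
apply: (@is_derive_fun_eq _ _ _ _ (fun x : 'rV[R]_3 => x 0 i2 + y 0 i2 + (x 0 i1 * y 0 i0 - x 0 i0 * y 0 i1) / 2%:R)).
  by move=> z; rewrite mxE.
by apply: is_derive_eqd; first der; rewrite /=; ring.
Qed.

(** At [y = 0] the right side is [Dj j F x]: the fields [D_j] are those invariant under left
    translation. [pd_hmull] differentiates in the other factor, and its commutator term has the
    opposite sign. *)
Lemma pd_hmulr F j x y : smooth3 F -> pd j (F \o hmul x) y =
  pd j F (hmul x y) + RC ((x 0 i1 * (j == i0)%:R - x 0 i0 * (j == i1)%:R) / 2%:R) * pd i2 F (hmul x y).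
Proof.
move=> sF; apply: is_cderive_pd.
have := is_cderive_chain sF (I : setT (hmul x y)) (fun k => is_derive_hmulr x y (e_ j) k).
congr (is_cderive _ _ _ _); rewrite sum3E !mxE !(RCD, RCN, RCM, RC_nat, RCV).
have -> : pd j F (hmul x y) = (j == i0)%:R * pd i0 F (hmul x y) +
    (j == i1)%:R * pd i1 F (hmul x y) + (j == i2)%:R * pd i2 F (hmul x y).
  by case: (ord3P j) => -> /=; rewrite !mul0r ?mul1r ?addr0 ?add0r.
move: (pd i0 F _) (pd i1 F _) (pd i2 F _) (RC (x 0 i0)) (RC (x 0 i1)).
case: (ord3P j) => -> a b c u v /=; ring.
Qed.

Lemma pd_hmull F j x y : smooth3 F -> pd j (fun x => F (hmul x y)) x =
  pd j F (hmul x y) + RC (((j == i1)%:R * y 0 i0 - (j == i0)%:R * y 0 i1) / 2%:R) * pd i2 F (hmul x y).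
Proof.
move=> sF; apply: is_cderive_pd.
have := @is_cderive_chain _ _ _ _ (fun x => hmul x y) _ _ _ _ sF (I : setT (hmul x y)) (fun k => is_derive_hmull x y (e_ j) k).
congr (is_cderive _ _ _ _); rewrite sum3E !mxE !(RCD, RCN, RCM, RC_nat, RCV).
have -> : pd j F (hmul x y) = (j == i0)%:R * pd i0 F (hmul x y) +
    (j == i1)%:R * pd i1 F (hmul x y) + (j == i2)%:R * pd i2 F (hmul x y).
  by case: (ord3P j) => -> /=; rewrite !mul0r ?mul1r ?addr0 ?add0r.
move: (pd i0 F _) (pd i1 F _) (pd i2 F _) (RC (y 0 i0)) (RC (y 0 i1)).
case: (ord3P j) => -> a b c u v /=; ring.
Qed.

Lemma Ck_hmul m N (f g : 'rV[R]_m -> 'rV[R]_3) j :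
  (forall k, Ck N setT (fun z => f z 0 k)) -> (forall k, Ck N setT (fun z => g z 0 k)) ->
  Ck N setT (fun z => hmul (f z) (g z) 0 j).
Proof.
move=> Cf Cg; have oT := @openT ('rV[R]_m).
case: (ord3P j) => ->.
- apply: (Ck_eq oT _ (CkD oT (Cf i0) (Cg i0))) => z _; by rewrite mxE.
- apply: (Ck_eq oT _ (CkD oT (Cf i1) (Cg i1))) => z _; by rewrite mxE.
apply: (@Ck_eq _ _ _ _ (fun z => f z 0 i2 + g z 0 i2 + (f z 0 i1 * g z 0 i0 - f z 0 i0 * g z 0 i1) / 2%:R)) => //.
  by move=> z _; rewrite mxE.
by repeat first [exact: Cf | exact: Cg | exact: Ck_cst | apply: CkD => // | apply: CkN => // | apply: CkM => // ].
Qed.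

Lemma smooth_hmulr F x : smooth3 F -> smooth3 (F \o hmul x).
Proof.
move=> sF; apply: (smooth_comp openT _ _ sF) => // N j.
by apply: Ck_hmul => k; [exact: Ck_cst openT|exact: Ck_coord openT].
Qed.

Lemma smooth_hmul2 F : smooth3 F -> smooth_on setT (fun z : 'rV[R]_(3 + 3) => F (hmul (lsubmx z) (rsubmx z))).
Proof.
move=> sF; apply: (@smooth_comp _ _ _ _ _ (fun z : 'rV[R]_(3 + 3) => hmul (lsubmx z) (rsubmx z)) _ openT _ _ sF) => // N j.
have oT := @openT ('rV[R]_(3 + 3)).
by apply: Ck_hmul => k; [apply: (Ck_eq oT _ (Ck_coord N (lshift 3 k) oT))|
   apply: (Ck_eq oT _ (Ck_coord N (rshift 3 k) oT))] => z _; rewrite mxE.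
Qed.

(** The symmetrized monomial [s(D_1^p D_2^q D_3^r)] in closed form (see [symD_Nop]): translate
    [x] to the origin and apply the commuting partials there. *)
Definition Nop (p q r : nat) F : 'rV[R]_3 -> C := fun x => dd p q r (F \o hmul x) 0.

Lemma smooth_Nop p q r F : smooth3 F -> smooth3 (Nop p q r F).
Proof.
move=> sF; have := @smooth_param R 3 3 setT setT _ (nseq p i0 ++ nseq q i1 ++ nseq r i2) 0 (smooth_hmul2 sF) openT (fun _ _ => I).
apply: smooth_eq => x _; rewrite /Nop; apply: eq_dd => y /=.
by rewrite row_mxKl row_mxKr.
Qed.

Lemma pd_Nop p q r F j x : smooth3 F ->
  pd j (Nop p q r F) x = dd p q r (fun y => pd j (fun x => F (hmul x y)) x) 0.
Proof.
move=> sF; have := @pd_ipd_param R 3 3 setT _ x 0 j (nseq p i0 ++ nseq q i1 ++ nseq r i2) (smooth_hmul2 sF) I.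
have H u y : F (hmul (lsubmx (row_mx u y)) (rsubmx (row_mx u y))) = F (hmul u y).
  by rewrite row_mxKl row_mxKr.
have -> : (fun u => ipd (nseq p i0 ++ nseq q i1 ++ nseq r i2)
    (fun y => F (hmul (lsubmx (row_mx u y)) (rsubmx (row_mx u y)))) 0) = Nop p q r F.
  by apply/funext => u; rewrite /Nop; apply: eq_dd => y; rewrite H.
move=> ->; apply: eq_dd => y; congr (pd j _ x); apply/funext => u; exact: H.
Qed.

(** Moving the base point [x] produces a coefficient linear in [y], which vanishes at the origin
    unless one of the [q] (or [p]) derivatives hits it. This leaves half a commutator, traded for
    one more derivative in the central direction. *)
Lemma Dj_Nop j p q r F x : smooth3 F -> Dj j (Nop p q r F) x =
  Nop (p + (j == i0)) (q + (j == i1)) (r + (j == i2)) F x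
  + (if j == i0 then - (q%:R / 2%:R) * Nop p q.-1 r.+1 F x
     else if j == i1 then p%:R / 2%:R * Nop p.-1 q r.+1 F x else 0).
Proof.
move=> sF; have sG := smooth_hmulr x sF; have s2G := smooth_pd i2 sG.
have dF2 y : pd i2 F (hmul x y) = pd i2 (F \o hmul x) y.
  by rewrite (pd_hmulr i2 x y sF) /= !mulr0 subrr mul0r RC0 mul0r addr0.
have dF k y : pd k F (hmul x y) = pd k (F \o hmul x) y -
    RC ((x 0 i1 * (k == i0)%:R - x 0 i0 * (k == i1)%:R) / 2%:R) * pd i2 (F \o hmul x) y.
  by rewrite (pd_hmulr k x y sF) (dF2 y) addrK.
(* Everything is expressed by derivatives of the translate [F \o hmul x]. The part of the
   coefficient depending on [x] cancels against the variable coefficient in [Dj], and the part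
   linear in [y] gives the correction. *)
have P k : pd k (Nop p q r F) x = dd p q r (fun y => pd k (F \o hmul x) y +
   (- RC ((x 0 i1 * (k == i0)%:R - x 0 i0 * (k == i1)%:R) / 2%:R) +
    RC (((k == i1)%:R * y 0 i0 - (k == i0)%:R * y 0 i1) / 2%:R)) * pd i2 (F \o hmul x) y) 0.
  rewrite (pd_Nop _ _ _ _ _ sF); apply: eq_dd => y.
  rewrite (pd_hmull k x y sF) (dF k y) (dF2 y).
  by move: (pd k _ _) (pd i2 _ _) (RC _) (RC _) => a b c d; ring.
have P2 : pd i2 (Nop p q r F) x = Nop p q r.+1 F x.
  have E : dd p q r.+1 (F \o hmul x) 0 = dd p q r (pd i2 (F \o hmul x)) 0.
    by rewrite (dd_pd _ _ _ _ _ sG) /= !addn0 addn1.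
  rewrite P /= /Nop E; apply: eq_dd => y.
  by rewrite !mulr0 !mul0r subrr !mul0r RC0 oppr0 addr0 mul0r addr0.
have A k a l : dd p q r (fun y => pd k (F \o hmul x) y + a * pd i2 (F \o hmul x) y +
     l * (RC (y 0 (if k == i0 then i1 else i0)) * pd i2 (F \o hmul x) y)) 0
  = dd p q r (pd k (F \o hmul x)) 0 + a * dd p q r (pd i2 (F \o hmul x)) 0 +
    l * dd p q r (fun y => RC (y 0 (if k == i0 then i1 else i0)) * pd i2 (F \o hmul x) y) 0.
  have sk := smooth_pd k sG.
  have sy := smoothM (smooth_coord (if k == i0 then i1 else i0) (@openT 'rV[R]_3)) s2G.
  rewrite (ddD _ _ _ _ (smoothD sk (smoothZ a s2G)) (smoothZ l sy)).
  by rewrite (ddD _ _ _ _ sk (smoothZ a s2G)) (ddZ _ _ _ _ _ s2G) (ddZ _ _ _ _ _ sy).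
case: (ord3P j) => -> /=; rewrite ?addn0 ?addn1.
- rewrite /Dj /= P2 P.
  rewrite (eq_dd _ _ _ _ (G := fun y => pd i0 (F \o hmul x) y + (- RC (x 0 i1 / 2%:R)) * pd i2 (F \o hmul x) y +
     (- 2%:R^-1) * (RC (y 0 i1) * pd i2 (F \o hmul x) y))); last first.
    move=> y /=; rewrite !mulr0 !mul0r !mulr1 !mul1r !subr0 !sub0r mulNr RCN !(RCM _ 2%:R^-1) RCV RC_nat.
    by move: (pd i0 _ y) (pd i2 _ y) (RC (x 0 i1)) (RC (y 0 i1)) => a b u v; ring.
  rewrite (A i0) (dd_coordM0 _ _ _ _ s2G) !(dd_pd _ _ _ _ _ sG) /= !addn0 !subn0 !addn1 subn1.
  by rewrite -!/(Nop _ _ _ F x); ring.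
- rewrite /Dj /= P2 P.
  rewrite (eq_dd _ _ _ _ (G := fun y => pd i1 (F \o hmul x) y + RC (x 0 i0 / 2%:R) * pd i2 (F \o hmul x) y +
     2%:R^-1 * (RC (y 0 i0) * pd i2 (F \o hmul x) y))); last first.
    move=> y /=; rewrite !mulr0 !mul0r !mulr1 !mul1r !subr0 !sub0r mulNr RCN !(RCM _ 2%:R^-1) RCV RC_nat.
    by move: (pd i1 _ y) (pd i2 _ y) (RC (x 0 i0)) (RC (y 0 i0)) => a b u v; ring.
  rewrite (A i1) (dd_coordM0 _ _ _ _ s2G) !(dd_pd _ _ _ _ _ sG) /= !addn0 !subn0 !addn1 subn1.
  by rewrite -!/(Nop _ _ _ F x); ring.
by rewrite /Dj /= P2 addr0.
Qed.

End Heisenberg2.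

(** * Symmetrized monomials as partial derivatives at the origin *)

Section Symmetrization.
Variable R : realType.
Notation C := (R[i]).
Notation i0 := (0 : 'I_3).
Notation i1 := (1 : 'I_3).
Notation i2 := (2%:R : 'I_3).
Implicit Types F : 'rV[R]_3 -> C.

Lemma big_tuple_cons (V : nmodType) (T : finType) n (P : pred (seq T)) (f : seq T -> V) :
  \sum_(w : n.+1.-tuple T | P w) f w = \sum_(i : T) \sum_(w : n.-tuple T | P (i :: w)) f (i :: w).
Proof.
rewrite pair_big_dep /=.
rewrite (reindex (fun p : T * n.-tuple T => [tuple of p.1 :: p.2])) //=.
exists (fun w => (thead w, [tuple of behead w])) => [[i w] _|w _] /=.
  by congr pair; apply/val_inj.
by apply/val_inj; case: w => -[].
Qed.

Definition has_content (p q r : nat) (w : seq 'I_3) :=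
  [&& count_mem i0 w == p, count_mem i1 w == q & count_mem i2 w == r].

(** The length [n] is separate from [p + q + r], so that removing the first letter lowers the length
    without changing the shape of the sum. *)
Definition word_sum (V : nmodType) (f : seq 'I_3 -> V) n p q r :=
  \sum_(w : n.-tuple 'I_3 | has_content p q r w) f w.

Lemma word_sum0 (V : nmodType) (f : seq 'I_3 -> V) : word_sum f 0 0 0 0 = f [::].
Proof.
rewrite /word_sum (big_pred1 [tuple]) // => w.
by rewrite (tuple0 w) /= eqxx.
Qed.

Lemma word_sumS (V : nmodType) (f : seq 'I_3 -> V) n p q r :
  word_sum f n.+1 p q r =
    (if p is p'.+1 then word_sum (fun w => f (i0 :: w)) n p' q r else 0)
  + (if q is q'.+1 then word_sum (fun w => f (i1 :: w)) n p q' r else 0)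
  + (if r is r'.+1 then word_sum (fun w => f (i2 :: w)) n p q r' else 0).
Proof.
rewrite /word_sum big_tuple_cons sum3E; congr (_ + _ + _).
- case: p => [|p]; last by apply: eq_bigl => w; rewrite /has_content /= ?eqxx ?add1n eqSS !add0n.
  by rewrite big_pred0 // => w; rewrite /has_content /= ?eqxx ?add1n.
- case: q => [|q]; last by apply: eq_bigl => w; rewrite /has_content /= ?eqxx ?add1n eqSS !add0n.
  by rewrite big_pred0 // => w; rewrite /has_content /= ?eqxx ?add1n andbF.
case: r => [|r]; last by apply: eq_bigl => w; rewrite /has_content /= ?eqxx ?add1n eqSS !add0n.
by rewrite big_pred0 // => w; rewrite /has_content /= ?eqxx ?add1n !andbF.
Qed.

(** The multinomial count, cleared of denominators so that the induction on the first letter needs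
    no division. *)
Lemma word_count n p q r : (p + q + r = n)%N ->
  (p`! * q`! * r`!)%:R * word_sum (fun=> 1) n p q r = n`!%:R :> C.
Proof.
elim: n p q r => [|n IH] p q r.
  case: p q r => [|//] [|//] [|//] _.
  by rewrite word_sum0 mulr1.
move=> E; rewrite word_sumS.
have H0 : (p`! * q`! * r`!)%:R * (if p is p'.+1 then word_sum (fun=> 1) n p' q r else 0) = p%:R * n`!%:R :> C.
  case: p E => [|p] E; first by rewrite mulr0 mul0r.
  rewrite factS -!mulnA natrM -mulrA mulnA IH //; lia.
have H1 : (p`! * q`! * r`!)%:R * (if q is q'.+1 then word_sum (fun=> 1) n p q' r else 0) = q%:R * n`!%:R :> C.
  case: q E {H0} => [|q] E; first by rewrite mulr0 mul0r.
  by rewrite factS mulnCA -!mulnA natrM -mulrA mulnA IH //; lia.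
have H2 : (p`! * q`! * r`!)%:R * (if r is r'.+1 then word_sum (fun=> 1) n p q r' else 0) = r%:R * n`!%:R :> C.
  case: r E {H0 H1} => [|r] E; first by rewrite mulr0 mul0r.
  by rewrite factS mulnCA natrM -mulrA IH //; lia.
by rewrite !mulrDr H0 H1 H2 -!mulrDl -!natrD E factS natrM.
Qed.

Lemma DjE j F x : Dj j F x =
  pd j F x + RC (((j == i0)%:R * x 0 i1 - (j == i1)%:R * x 0 i0) / 2%:R) * pd i2 F x.
Proof.
case: (ord3P j) => -> /=; rewrite /Dj /= ?mul1r ?mul0r ?subr0 ?sub0r ?mul0r ?RC0 ?mul0r ?addr0 //.
by rewrite !mulNr RCN mulNr.
Qed.

Lemma smooth_Dj j F : smooth3 F -> smooth3 (Dj j F).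
Proof.
move=> sF; have oT := @openT ('rV[R]_3).
apply: (@smooth_eq _ _ _ (fun x => pd j F x + RC (((j == i0)%:R * x 0 i1 - (j == i1)%:R * x 0 i0) / 2%:R) * pd i2 F x)).
  by move=> x _; rewrite DjE.
apply: smoothD; first exact: smooth_pd.
apply: smoothM; last exact: smooth_pd.
by apply: smooth_RC => // N; solve_Ck.
Qed.

Lemma smooth_Dword w F : smooth3 F -> smooth3 (Dword w F).
Proof. by move=> sF; elim: w => [|j w IH]; [exact: sF|exact: (smooth_Dj j IH)]. Qed.

Lemma DjZ j (a : C) F x : smooth3 F -> Dj j (fun y => a * F y) x = a * Dj j F x.
Proof.
move=> sF; rewrite !DjE (pdZ a j sF (I : setT x)) (pdZ a i2 sF (I : setT x)).
by rewrite mulrDr mulrCA.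
Qed.

Lemma Dj_sum j J (s : seq J) (P : pred J) (F : J -> 'rV[R]_3 -> C) x :
  (forall i, smooth3 (F i)) ->
  Dj j (fun y => \sum_(i <- s | P i) F i y) x = \sum_(i <- s | P i) Dj j (F i) x.
Proof.
move=> sF; rewrite DjE; under [RHS]eq_bigr do rewrite DjE.
rewrite big_split -mulr_sumr /=; congr (_ + _ * _).
  exact: (ipd_sum _ _ [:: j] openT sF I).
exact: (ipd_sum _ _ [:: i2] openT sF I).
Qed.

Lemma fact_neq0 n : n`!%:R != 0 :> C.
Proof. by rewrite pnatr_eq0 -lt0n fact_gt0. Qed.

(** Sort the words by first letter and apply [Dj_Nop]. The corrections from [D_1] and [D_2] are
    [- p q / 2] and [p q / 2] times the same term and cancel, which is why averaging over orderings
    yields exactly [Nop]. *)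
Lemma word_sum_Nop n p q r F x : smooth3 F -> (p + q + r = n)%N ->
  (p`! * q`! * r`!)%:R * word_sum (fun w => Dword w F x) n p q r = n`!%:R * Nop p q r F x.
Proof.
move=> sF; elim: n p q r x => [|n IH] p q r x.
  case: p q r => [|//] [|//] [|//] _.
  by rewrite word_sum0 /Nop /dd /= hmulx0.
move=> E; rewrite word_sumS.
have step j a b c : (a + b + c = n)%N ->
    (a`! * b`! * c`!)%:R * word_sum (fun w => Dword (j :: w) F x) n a b c
    = n`!%:R * Dj j (Nop a b c F) x.
  move=> Eabc; rewrite /word_sum /= -Dj_sum; last by move=> w; exact: smooth_Dword.
  rewrite -(DjZ _ _ _ (smooth_Nop a b c sF)) -DjZ.
    by congr (Dj j _ x); apply/funext => y; exact: IH.
  apply: smooth_sum; first exact: openT.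
  by move=> w; exact: smooth_Dword.
(* [N'] is the one correction term shared by the first letters [i0] and [i1]. *)
move E1 : (Nop p q r F x) => N; move E2 : (Nop p.-1 q.-1 r.+1 F x) => N'.
have H0 : (p`! * q`! * r`!)%:R * (if p is p'.+1 then word_sum (fun w => Dword (i0 :: w) F x) n p' q r else 0)
    = n`!%:R * (p%:R * (N - q%:R / 2%:R * N')).
  rewrite -E1 -E2 {N N' E1 E2}; case: p E => [|p] E; first by rewrite mulr0 mul0r mulr0.
  rewrite factS -!mulnA natrM -mulrA mulnA step; last by lia.
  by rewrite (Dj_Nop _ _ _ _ _ sF) /= !addn0 addn1; ring.
have H1 : (p`! * q`! * r`!)%:R * (if q is q'.+1 then word_sum (fun w => Dword (i1 :: w) F x) n p q' r else 0)
    = n`!%:R * (q%:R * (N + p%:R / 2%:R * N')).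
  clear H0; rewrite -E1 -E2 {N N' E1 E2}; case: q E => [|q] E; first by rewrite mulr0 mul0r mulr0.
  rewrite factS mulnCA -!mulnA natrM -mulrA mulnA step; last by lia.
  by rewrite (Dj_Nop _ _ _ _ _ sF) /= !addn0 addn1; ring.
have H2 : (p`! * q`! * r`!)%:R * (if r is r'.+1 then word_sum (fun w => Dword (i2 :: w) F x) n p q r' else 0)
    = n`!%:R * (r%:R * N).
  clear H0 H1 E2; rewrite -E1 {N E1}; case: r E => [|r] E; first by rewrite mulr0 mul0r mulr0.
  rewrite factS mulnCA natrM -mulrA step; last by lia.
  by rewrite (Dj_Nop _ _ _ _ _ sF) /= !addn0 addn1; ring.
rewrite !mulrDr H0 H1 H2 factS natrM -{1}E !natrD.
by clear H0 H1 H2; move: (n`!%:R : C) => c; field.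
Qed.

Lemma symD_Nop p q r F x : smooth3 F -> symD p q r F x = Nop p q r F x.
Proof.
move=> sF; rewrite /symD.
have W (V : nmodType) (f : seq 'I_3 -> V) :
    \sum_(w <- words p q r) f w = word_sum f (p + q + r) p q r.
  by rewrite /words big_filter big_enum_cond.
have c := word_count (erefl (p + q + r)%N).
have N := word_sum_Nop x sF (erefl (p + q + r)%N).
rewrite -sum1_size natr_sum (W _ (fun=> 1)) (W _ (fun w => Dword w F x)).
have M0 : (p`! * q`! * r`!)%:R != 0 :> C by rewrite !natrM !mulf_neq0 ?fact_neq0.
have w0 : word_sum (fun=> 1) (p + q + r) p q r != 0 :> C.
  by apply: contraTneq (fact_neq0 (p + q + r)) => e; rewrite -c e mulr0 eqxx.
apply: (mulfI w0); rewrite mulVKf //; apply: (mulfI M0).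
by rewrite N mulrA c.
Qed.

Lemma iter_D1 m F x : smooth3 F -> iter m (@D1 R) F x = Nop m 0 0 F x.
Proof.
move=> sF; elim: m x => [|m IH] x /=; first by rewrite /Nop /dd /= hmulx0.
rewrite (_ : iter m (@D1 R) F = Nop m 0 0 F); last exact/funext.
by rewrite /D1 (Dj_Nop _ _ _ _ _ sF) /= addn1 mul0r oppr0 mul0r addr0.
Qed.

Lemma iter_D2 m F x : smooth3 F -> iter m (@D2 R) F x = Nop 0 m 0 F x.
Proof.
move=> sF; elim: m x => [|m IH] x /=; first by rewrite /Nop /dd /= hmulx0.
rewrite (_ : iter m (@D2 R) F = Nop 0 m 0 F); last exact/funext.
by rewrite /D2 (Dj_Nop _ _ _ _ _ sF) /= addn1 !mul0r addr0.
Qed.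

End Symmetrization.

(** * Principal series in the open cell *)

Section Matrices.
Variable R : realType.
Notation i0 := (0 : 'I_3).
Notation i1 := (1 : 'I_3).
Notation i2 := (2%:R : 'I_3).

Definition M3 (a b c d e f g h i : R) : 'M[R]_3 :=
  \matrix_(r < 3, s < 3) nth 0 (nth [::] [:: [:: a; b; c]; [:: d; e; f]; [:: g; h; i]] r) s.

Lemma M3_eta (A : 'M[R]_3) :
  A = M3 (A i0 i0) (A i0 i1) (A i0 i2) (A i1 i0) (A i1 i1) (A i1 i2) (A i2 i0) (A i2 i1) (A i2 i2).
Proof.
by apply/matrixP => r s; rewrite mxE; case: (ord3P r) => ->; case: (ord3P s) => ->.
Qed.

Lemma M3_mul a b c d e f g h i a' b' c' d' e' f' g' h' i' :
  M3 a b c d e f g h i * M3 a' b' c' d' e' f' g' h' i' =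
  M3 (a * a' + b * d' + c * g') (a * b' + b * e' + c * h') (a * c' + b * f' + c * i')
     (d * a' + e * d' + f * g') (d * b' + e * e' + f * h') (d * c' + e * f' + f * i')
     (g * a' + h * d' + i * g') (g * b' + h * e' + i * h') (g * c' + h * f' + i * i').
Proof.
apply/matrixP => r s; rewrite -mulmxE mxE sum3E !mxE.
by case: (ord3P r) => ->; case: (ord3P s) => ->.
Qed.

Lemma det_mx22 (A : 'M[R]_2) : \det A = A 0 0 * A 1 1 - A 0 1 * A 1 0.
Proof.
rewrite (expand_det_row _ 0) !big_ord_recl big_ord0 addr0 /cofactor !det_mx11 !mxE.
have -> : lift (0 : 'I_2) (0 : 'I_1) = 1 by apply/val_inj.
have -> : lift (1 : 'I_2) (0 : 'I_1) = 0 by apply/val_inj.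
by rewrite /= expr0 expr1 mul1r mulN1r mulrN.
Qed.

Lemma det_M3 a b c d e f g h i : \det (M3 a b c d e f g h i) =
  a * (e * i - f * h) - b * (d * i - f * g) + c * (d * h - e * g).
Proof.
rewrite (expand_det_row _ i0) sum3E /cofactor.
have -> : (-1) ^+ (i0 + i0) = 1 :> R by [].
have -> : (-1) ^+ (i0 + i1) = -1 :> R by [].
have -> : (-1) ^+ (i0 + i2) = 1 :> R by rewrite -[(i0 + i2)%N]/2%N sqrrN expr1n.
by rewrite !det_mx22 !mxE /=; ring.
Qed.

Lemma nbarE (x : 'rV[R]_3) :
  nbar x = M3 1 0 0 (x 0 i0) 1 0 (x 0 i2 + x 0 i0 * x 0 i1 / 2%:R) (x 0 i1) 1.
Proof.
rewrite /nbar.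
have -> : x 0 0 *: N1m R + x 0 1 *: N2m R + x 0 2 *: N3m R =
    M3 0 0 0 (x 0 i0) 0 0 (x 0 i2) (x 0 i1) 0.
  apply/matrixP => r s; rewrite !mxE.
  by case: (ord3P r) => ->; case: (ord3P s) => -> /=; rewrite ?mulr0 ?mulr1 ?addr0 ?add0r.
rewrite /nexp M3_mul; apply/matrixP => r s; rewrite !mxE.
by case: (ord3P r) => ->; case: (ord3P s) => -> /=; rewrite ?mulr0n ?mulr1n; field.
Qed.

Lemma aexpE t1 t2 : aexp t1 t2 = M3 (expR t1) 0 0 0 (expR (t2 - t1)) 0 0 0 (expR (- t2)) :> 'M[R]_3.
Proof.
apply/matrixP => r s; rewrite !mxE.
by case: (ord3P r) => ->; case: (ord3P s) => -> /=; rewrite ?mulr0n ?mulr1n.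
Qed.

Lemma mdiagE b1 b2 b3 : mdiag b1 b2 b3 = M3 b1 0 0 0 b2 0 0 0 b3 :> 'M[R]_3.
Proof.
apply/matrixP => r s; rewrite !mxE.
by case: (ord3P r) => ->; case: (ord3P s) => -> /=; rewrite ?mulr0n ?mulr1n.
Qed.

Lemma nplusE a b c : nplus a b c = M3 1 a c 0 1 b 0 0 1 :> 'M[R]_3.
Proof. by []. Qed.

Lemma M3_1 : 1 = M3 1 0 0 0 1 0 0 0 1.
Proof.
apply/matrixP => r s; rewrite !mxE.
by case: (ord3P r) => ->; case: (ord3P s) => -> /=; rewrite ?mulr0n ?mulr1n.
Qed.

Lemma SL3M (g h : 'M[R]_3) : SL3 g -> SL3 h -> SL3 (g * h).
Proof. by rewrite /SL3 -mulmxE det_mulmx => -> ->; rewrite mulr1. Qed.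

Lemma SL3_inv (g : 'M[R]_3) : SL3 g -> SL3 (invmx g).
Proof. by move=> sg; rewrite /SL3 det_inv sg invr1. Qed.

Lemma SL3_nbar (x : 'rV[R]_3) : SL3 (nbar x).
Proof. by rewrite /SL3 nbarE det_M3; ring. Qed.

Lemma SL3_nplus (a b c : R) : SL3 (nplus a b c).
Proof. by rewrite /SL3 nplusE det_M3; ring. Qed.

Lemma SL3_aexp (t1 t2 : R) : SL3 (aexp t1 t2).
Proof.
rewrite /SL3 aexpE det_M3 !mulr0 !mul0r !subr0 !addr0 -!expRD.
by rewrite (_ : t1 + (t2 - t1 + - t2) = 0) ?expR0 //; ring.
Qed.

Lemma SL3_mdiag (b1 b2 b3 : R) : b1 * b2 * b3 = 1 -> SL3 (mdiag b1 b2 b3).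
Proof. by move=> b; rewrite /SL3 mdiagE det_M3 -b; ring. Qed.

Lemma nbar0 : nbar (0 : 'rV[R]_3) = 1.
Proof. by rewrite nbarE M3_1 !mxE; congr M3; ring. Qed.

Lemma nbar_hmul (x y : 'rV[R]_3) : nbar (hmul x y) = nbar x * nbar y.
Proof. by rewrite !nbarE M3_mul !mxE /=; congr M3; field. Qed.

Lemma nplus_mul a b c a' b' c' :
  nplus a b c * nplus a' b' c' = nplus (a + a') (b + b') (c + c' + a * b') :> 'M[R]_3.
Proof. by rewrite !nplusE M3_mul; congr M3; ring. Qed.

Lemma nplus0 : nplus 0 0 0 = 1 :> 'M[R]_3.
Proof. by rewrite nplusE M3_1. Qed.

End Matrices.

(** * The complex exponential *)

Section CExp.
Variable R : realType.
Notation C := (R[i]).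
Implicit Types a b : C.

Lemma complex_ext a b : complex.Re a = complex.Re b -> complex.Im a = complex.Im b -> a = b.
Proof. by case: a b => ? ? [? ?] /= -> ->. Qed.

Lemma cexpD a b : cexp (a + b) = cexp a * cexp b.
Proof.
rewrite /cexp RecD ImcD expRD cosD sinD RCM mulrACA; congr (_ * _).
by apply: complex_ext; rewrite ?(RecM, ImcM) /=; ring.
Qed.

Lemma cexp0 : cexp (0 : C) = 1.
Proof. by rewrite /cexp /= expR0 cos0 sin0 mul1r. Qed.

Lemma cexpNK a : cexp (- a) * cexp a = 1.
Proof. by rewrite -cexpD addNr cexp0. Qed.

Lemma cexp_neq0 a : cexp a != 0.
Proof. by apply: contraTneq (oner_neq0 C) => e; rewrite -(cexpNK a) e mulr0 eqxx. Qed.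

Lemma cexpN a : cexp (- a) = (cexp a)^-1.
Proof. by apply: (mulIf (cexp_neq0 a)); rewrite cexpNK mulVf // cexp_neq0. Qed.

Lemma cexp_RC (t : R) : cexp (RC t) = RC (expR t).
Proof. by rewrite /cexp /= cos0 sin0 mulr1. Qed.

Lemma is_cderive_cexp (V : normedModType R) (x v : V) (l : V -> R) (z : C) dl :
  is_derive x v l dl ->
  is_cderive x v (fun y => cexp (z * RC (l y))) (z * RC dl * cexp (z * RC (l x))).
Proof.
move=> Dl; have D (a : R) : is_derive x v (fun y => a * l y) (a * dl).
  by have := is_deriveZ a Dl.
have De := is_derive_comp1 (D (complex.Re z)) (is_derive_expR _).
have Dc := is_derive_comp1 (D (complex.Im z)) (is_derive_cos _).
have Ds := is_derive_comp1 (D (complex.Im z)) (is_derive_sin _).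
have E y : cexp (z * RC (l y)) = RC (expR (complex.Re z * l y)) *
    Complex (cos (complex.Im z * l y)) (sin (complex.Im z * l y)).
  by rewrite /cexp RecM ImcM /= !mulr0 subr0 add0r.
have := is_cderiveM (is_cderive_RC De) (conj Dc Ds : is_cderive _ _
  (fun y => Complex (cos (complex.Im z * l y)) (sin (complex.Im z * l y))) (Complex _ _)).
rewrite (_ : (fun y => _ * _) = (fun y => cexp (z * RC (l y)))); last by apply/funext => y; rewrite E.
congr (is_cderive _ _ _ _); rewrite E /=.
clear De Dc Ds E D; move: (expR _) (cos _) (sin _) => A B S.
by apply: complex_ext; rewrite ?(RecD, ImcD, RecM, ImcM) /=; ring.
Qed.

End CExp.

(** * Jet functionals transported over the group *)

Section PrincipalSeries.
Variable R : realType.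
Notation C := (R[i]).
Notation i0 := (0 : 'I_3).
Notation i1 := (1 : 'I_3).
Notation i2 := (2%:R : 'I_3).
Implicit Types (F G : 'rV[R]_3 -> C) (f : 'M[R]_3 -> C).

(** The restriction to the cell of the left translate of [f] by the inverse of [g]; letting [g] vary
    moves a functional at the origin over the whole group. *)
Definition trans f (g : 'M[R]_3) : 'rV[R]_3 -> C := fun x => f (g * nbar x).

Lemma res_ltr f g x : res (ltr g f) x = trans f (invmx g) x.
Proof. by []. Qed.

Lemma trans_nbar f x y : trans f (nbar x) y = res f (hmul x y).
Proof. by rewrite /trans /res nbar_hmul. Qed.

Lemma trans1 f : trans f 1 = res f.
Proof. by apply/funext => x; rewrite /trans mul1r. Qed.

Section CkMatrix.
Variables (m : nat) (V : set 'rV[R]_m) (oV : open V).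

Lemma Ck_mulmx N (A B : 'rV[R]_m -> 'M[R]_3) :
  (forall i j, Ck N V (fun z => A z i j)) -> (forall i j, Ck N V (fun z => B z i j)) ->
  forall i j, Ck N V (fun z => (A z * B z) i j).
Proof.
move=> CA CB i j; apply: (@Ck_eq _ _ _ _ (fun z => \sum_k A z i k * B z k j) _ oV).
  by move=> z _; rewrite -mulmxE mxE.
by apply: Ck_sum => // k; apply: CkM.
Qed.

Lemma Ck_M3 N (a b c d e f g h k : 'rV[R]_m -> R) :
  Ck N V a -> Ck N V b -> Ck N V c -> Ck N V d -> Ck N V e -> Ck N V f ->
  Ck N V g -> Ck N V h -> Ck N V k ->
  forall i j, Ck N V (fun z => M3 (a z) (b z) (c z) (d z) (e z) (f z) (g z) (h z) (k z) i j).
Proof.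
move=> Ca Cb Cc Cd Ce Cf Cg Ch Ck' i j.
by case: (ord3P i) => ->; case: (ord3P j) => ->; [move: Ca|move: Cb|move: Cc|move: Cd|
  move: Ce|move: Cf|move: Cg|move: Ch|move: Ck']; apply: (Ck_eq oV) => z _; rewrite mxE.
Qed.

Lemma Ck_nbar N (x : 'rV[R]_m -> 'rV[R]_3) : (forall k, Ck N V (fun z => x z 0 k)) ->
  forall i j, Ck N V (fun z => nbar (x z) i j).
Proof.
move=> Cx i j; apply: (Ck_eq oV (fun z _ => congr1 (fun A : 'M[R]_3 => A i j) (esym (nbarE (x z))))).
by apply: Ck_M3; repeat first [exact: Cx | exact: Ck_cst | apply: CkD => // | apply: CkM => //].
Qed.

End CkMatrix.

Lemma smooth_G_comp m f (phi : 'rV[R]_m -> 'M[R]_3) : smooth_G f -> (forall z, SL3 (phi z)) ->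
  (forall N i j, Ck N setT (fun z => phi z i j)) -> smooth_on setT (fun z => f (phi z)).
Proof.
move=> [U [Fx [sF [SU Ff]]]] Sphi Cphi.
apply: (@smooth_eq _ _ _ (Fx \o (fun z => mxvec (phi z)))); first by move=> z _; exact: Ff.
apply: (smooth_comp openT _ _ sF) => [z _|N j]; first exact: SU.
case/mxvec_indexP: j => i j; apply: (Ck_eq openT _ (Cphi N i j)) => z _.
by rewrite mxvecE.
Qed.

Lemma smooth_trans f g : smooth_G f -> SL3 g -> smooth3 (trans f g).
Proof.
move=> sf sg; apply: (smooth_G_comp sf) => [z|N]; first exact: SL3M sg (SL3_nbar z).
apply: (Ck_mulmx openT) => [i j|]; first exact: Ck_cst openT.
by apply: (Ck_nbar openT) => k; exact: Ck_coord openT.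
Qed.

Lemma smooth_res f : smooth_G f -> smooth3 (res f).
Proof. by move=> sf; rewrite -trans1; apply: smooth_trans => //; rewrite /SL3 det1. Qed.

(** A functional on jets at the origin, as a list of coefficients and multi-indices. *)
Definition Pdd (P : seq (C * (nat * nat * nat))) F : C :=
  \sum_(t <- P) t.1 * dd t.2.1.1 t.2.1.2 t.2.2 F 0.

(** The image of [f] under the map that [P] should induce. It is defined on the whole group,
    commutes with left translation by construction, and restricts to [NopP P] on the cell
    ([fP_nbar]). *)
Definition fP P f (g : 'M[R]_3) : C := Pdd P (trans f g).

Lemma eq_Pdd P F G : F =1 G -> Pdd P F = Pdd P G.
Proof. by move=> /funext ->. Qed.

Lemma smooth_fP P f : smooth_G f -> smooth_G (fP P f).
Proof.
move=> [U [Fx [sF [SU Ff]]]].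
(* [Phi] joins the matrix and the cell variable. The preimage of [U] is open and contains the slice
   where the cell variable is [0], so the derivatives there extend [fP P f] smoothly to the same
   [U]. *)
pose Phi (z : 'rV[R]_(3 * 3 + 3)) := mxvec (vec_mx (lsubmx z) * nbar (rsubmx z)).
have oT := @openT ('rV[R]_(3 * 3 + 3)).
have CPhi N j : Ck N setT (fun z => Phi z 0 j).
  case/mxvec_indexP: j => i j.
  apply: (@Ck_eq _ _ _ _ (fun z => (vec_mx (lsubmx z) * nbar (rsubmx z)) i j) _ oT).
    by move=> z _; rewrite /Phi mxvecE.
  apply: (Ck_mulmx oT) => [a b|].
    by apply: (Ck_eq oT _ (Ck_coord N (lshift 3 (mxvec_index a b)) oT)) => z _; rewrite !mxE.
  by apply: (Ck_nbar oT) => k; apply: (Ck_eq oT _ (Ck_coord N (rshift (3 * 3) k) oT)) => z _; rewrite mxE.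
have oU := smooth_open sF.
have oPU : open (Phi @^-1` U).
  apply: open_comp oU => z _.
  by apply: continuous_row => j; exact: (Ck_cont (CPhi 0%N j) (I : setT z)).
have sPhi : smooth_on (Phi @^-1` U) (Fx \o Phi).
  apply: (smooth_comp oPU _ _ sF) => // N j.
  have := CPhi N j; elim: N (fun z => Phi z 0 j) => [|N IH] h [ch dh]; split => //.
  - by move=> x _; exact: ch.
  - by move=> x _; exact: ch.
  move=> i; have [d1 d2] := dh i; split; first by move=> x _; exact: d1.
  exact: IH.
exists U, (fun v => \sum_(t <- P) t.1 * ipd (nseq t.2.1.1 i0 ++ nseq t.2.1.2 i1 ++ nseq t.2.2 i2)
   (fun y => (Fx \o Phi) (row_mx v y)) 0).
split; last (split; first exact: SU).
  apply: smooth_sum => [|t]; first exact: oU.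
  apply: smoothZ; apply: (smooth_param _ sPhi oU) => v Uv.
  by rewrite /Phi /= row_mxKl row_mxKr nbar0 mulr1 vec_mxK.
move=> g sg; apply: eq_bigr => t _; congr (_ * _); apply: eq_dd => y.
by rewrite /trans /= /Phi row_mxKl row_mxKr mxvecK Ff //; exact: SL3M sg (SL3_nbar y).
Qed.

(** The one-parameter subgroups through [E_{1,2}] (for [a = 1, b = 0]) and [E_{2,3}]
    (for [a = 0, b = 1]). *)
Definition nexpp (a b s : R) : 'M[R]_3 := nplus (s * a) (s * b) 0.

Lemma smooth_nexpp f g a b : smooth_G f -> SL3 g ->
  smooth_on setT (fun z : 'rV[R]_(1 + 3) => trans f (g * nexpp a b (lsubmx z 0 0)) (rsubmx z)).
Proof.
move=> sf sg; have oT := @openT ('rV[R]_(1 + 3)).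
apply: (@smooth_G_comp _ f (fun z => g * nexpp a b (lsubmx z 0 0) * nbar (rsubmx z)) sf) => [z|N].
  exact: SL3M (SL3M sg (SL3_nplus _ _ _)) (SL3_nbar _).
have Cl k : Ck N setT (fun z : 'rV[R]_(1 + 3) => lsubmx z 0 k).
  by apply: (Ck_eq oT _ (Ck_coord N (lshift 3 k) oT)) => z _; rewrite mxE.
have Cr k : Ck N setT (fun z : 'rV[R]_(1 + 3) => rsubmx z 0 k).
  by apply: (Ck_eq oT _ (Ck_coord N (rshift 1 k) oT)) => z _; rewrite mxE.
apply: (Ck_mulmx oT); last exact: (Ck_nbar oT).
apply: (Ck_mulmx oT) => [i j|]; first exact: Ck_cst oT.
by apply: (Ck_M3 oT); try exact: (Ck_cst _ _ oT); apply: (CkM oT); rewrite ?Cl //; exact: (Ck_cst _ _ oT).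
Qed.

Lemma smooth_Pdd_param P f g a b : smooth_G f -> SL3 g ->
  smooth_on setT (fun u : 'rV[R]_1 => fP P f (g * nexpp a b (u 0 0))).
Proof.
move=> sf sg; rewrite /fP /Pdd.
apply: smooth_sum => [|t]; first exact: openT.
apply: smoothZ; have := @smooth_param R 1 3 setT setT _ (nseq t.2.1.1 i0 ++ nseq t.2.1.2 i1 ++ nseq t.2.2 i2) 0
  (smooth_nexpp a b sf sg) openT (fun _ _ => I).
by apply: smooth_eq => u _; apply: eq_dd => y; rewrite row_mxKl row_mxKr.
Qed.

Lemma pd_fP P f g a b : smooth_G f -> SL3 g ->
  pd 0 (fun u : 'rV[R]_1 => fP P f (g * nexpp a b (u 0 0))) 0 =
  Pdd P (fun y => pd 0 (fun u : 'rV[R]_1 => trans f (g * nexpp a b (u 0 0)) y) 0).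
Proof.
move=> sf sg; have sN := smooth_nexpp a b sf sg.
have H (u : 'rV[R]_1) y : trans f (g * nexpp a b (lsubmx (row_mx u y) 0 0)) (rsubmx (row_mx u y))
    = trans f (g * nexpp a b (u 0 0)) y.
  by rewrite row_mxKl row_mxKr.
have St (t : C * (nat * nat * nat)) : smooth_on setT (fun u : 'rV[R]_1 => dd t.2.1.1 t.2.1.2 t.2.2 (trans f (g * nexpp a b (u 0 0))) 0).
  have := @smooth_param R 1 3 setT setT _ (nseq t.2.1.1 i0 ++ nseq t.2.1.2 i1 ++ nseq t.2.2 i2) 0
    sN openT (fun _ _ => I).
  by apply: smooth_eq => u _; apply: eq_dd => y; rewrite H.
rewrite /fP /Pdd.
have := @ipd_sum R 1 setT _ P xpredT (fun t u => t.1 * dd t.2.1.1 t.2.1.2 t.2.2 (trans f (g * nexpp a b (u 0 0))) 0)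
  [:: 0] 0 openT (fun t => smoothZ t.1 (St t)) I.
rewrite /= => ->; apply: eq_bigr => t _; rewrite (pdZ _ _ (St t) (I : setT _)); congr (_ * _).
have := @pd_ipd_param R 1 3 setT _ 0 0 0 (nseq t.2.1.1 i0 ++ nseq t.2.1.2 i1 ++ nseq t.2.2 i2) sN I.
have -> : (fun u : 'rV[R]_1 => ipd (nseq t.2.1.1 i0 ++ nseq t.2.1.2 i1 ++ nseq t.2.2 i2)
   (fun y => trans f (g * nexpp a b (lsubmx (row_mx u y) 0 0)) (rsubmx (row_mx u y))) 0) =
   (fun u : 'rV[R]_1 => dd t.2.1.1 t.2.1.2 t.2.2 (trans f (g * nexpp a b (u 0 0))) 0).
  by apply/funext => u; apply: eq_dd => y; rewrite H.
move=> ->; apply: eq_dd => y; congr (pd 0 _ 0); apply/funext => u; exact: H.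
Qed.

End PrincipalSeries.

Opaque dd.

(** * The simple root vectors acting on jets *)

Section InfinitesimalAction.
Variable R : realType.
Notation C := (R[i]).
Notation e_ := (ebasis R).
Notation i0 := (0 : 'I_3).
Notation i1 := (1 : 'I_3).
Notation i2 := (2%:R : 'I_3).
Implicit Types (F G : 'rV[R]_3 -> C) (f : 'M[R]_3 -> C) (lam : C * C).

Lemma mdiag1 : mdiag 1 1 1 = 1 :> 'M[R]_3.
Proof. by rewrite mdiagE M3_1. Qed.

Lemma aexp00 : aexp 0 0 = 1 :> 'M[R]_3.
Proof. by rewrite aexpE M3_1 subr0 oppr0 expR0. Qed.

Lemma chiM1 e : chiM e 1 1 1 = 1 :> C.
Proof. by case: e => [[] []]; rewrite /chiM /= ?normr1 mulr1. Qed.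

Lemma chiA0 lam : chiA lam 0 0 = 1 :> C.
Proof. by rewrite /chiA RC0 !mulr0 addr0 cexp0. Qed.

Lemma Iser_smooth lam e f : Iser lam e f -> smooth_G f. Proof. by case. Qed.

Lemma Iser_man lam e f g b1 b2 b3 t1 t2 a b c : Iser lam e f -> SL3 g ->
  pm1 b1 -> pm1 b2 -> pm1 b3 -> b1 * b2 * b3 = 1 ->
  f (g * (mdiag b1 b2 b3 * aexp t1 t2 * nplus a b c))
  = (chiM e b1 b2 b3)^-1 * (chiA lam t1 t2)^-1 * f g.
Proof.
by move=> [_ If] sg p1 p2 p3 bb; rewrite -(If g b1 b2 b3 t1 t2 a b c sg p1 p2 p3 bb) !mulrA.
Qed.

Lemma Iser_an lam e f g t1 t2 a b c : Iser lam e f -> SL3 g ->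
  f (g * (aexp t1 t2 * nplus a b c)) = (chiA lam t1 t2)^-1 * f g.
Proof.
move=> If sg; have p1 : pm1 (1 : R) by left.
have := Iser_man t1 t2 a b c If sg p1 p1 p1; rewrite !mul1r mdiag1 mul1r => -> //.
by rewrite chiM1 invr1 mul1r.
Qed.

Lemma Iser_nplus lam e f g a b c : Iser lam e f -> SL3 g -> f (g * nplus a b c) = f g.
Proof. by move=> If sg; have := Iser_an 0 0 a b c If sg; rewrite aexp00 mul1r chiA0 invr1 mul1r. Qed.

Definition mono (j : 'I_3) F : 'rV[R]_3 -> C := fun y => RC (y 0 j) * F y.

Lemma smooth_mono j F : smooth3 F -> smooth3 (mono j F).
Proof. by apply: smoothM; apply: smooth_coord; exact: openT. Qed.

(** [pi1 lam] and [pi2 lam] give the derivative at [s = 0] of left translation by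
    [exp (- s E_{1,2})] and [exp (- s E_{2,3})] on restrictions of elements of [I(lam)]. *)
Definition pi1 lam F : 'rV[R]_3 -> C := fun y =>
  - lam.1 * mono i0 F y + - 1 * mono i0 (mono i0 (pd i0 F)) y
  + 2%:R^-1 * mono i0 (mono i1 (pd i1 F)) y + - 1 * mono i2 (pd i1 F) y
  + - 2%:R^-1 * mono i0 (mono i2 (pd i2 F)) y
  + - 4%:R^-1 * mono i0 (mono i0 (mono i1 (pd i2 F))) y.

Definition pi2 lam F : 'rV[R]_3 -> C := fun y =>
  - lam.2 * mono i1 F y + - 1 * mono i1 (mono i1 (pd i1 F)) y
  + 2%:R^-1 * mono i0 (mono i1 (pd i0 F)) y + 1 * mono i2 (pd i0 F) y
  + - 2%:R^-1 * mono i1 (mono i2 (pd i2 F)) y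
  + 4%:R^-1 * mono i0 (mono i1 (mono i1 (pd i2 F))) y.

Lemma dd_lin6 p q r (a1 a2 a3 a4 a5 a6 : C) F1 F2 F3 F4 F5 F6 x (v1 v2 v3 v4 v5 v6 : C) :
  smooth3 F1 -> smooth3 F2 -> smooth3 F3 -> smooth3 F4 -> smooth3 F5 -> smooth3 F6 ->
  dd p q r F1 x = v1 -> dd p q r F2 x = v2 -> dd p q r F3 x = v3 ->
  dd p q r F4 x = v4 -> dd p q r F5 x = v5 -> dd p q r F6 x = v6 ->
  dd p q r (fun y => a1 * F1 y + a2 * F2 y + a3 * F3 y + a4 * F4 y + a5 * F5 y + a6 * F6 y) x =
  a1 * v1 + a2 * v2 + a3 * v3 + a4 * v4 + a5 * v5 + a6 * v6.
Proof.
move=> s1 s2 s3 s4 s5 s6 <- <- <- <- <- <-.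
have z1 := smoothZ a1 s1; have z2 := smoothZ a2 s2; have z3 := smoothZ a3 s3.
have z4 := smoothZ a4 s4; have z5 := smoothZ a5 s5; have z6 := smoothZ a6 s6.
rewrite (ddD _ _ _ _ (smoothD (smoothD (smoothD (smoothD z1 z2) z3) z4) z5) z6).
rewrite (ddD _ _ _ _ (smoothD (smoothD (smoothD z1 z2) z3) z4) z5).
rewrite (ddD _ _ _ _ (smoothD (smoothD z1 z2) z3) z4) (ddD _ _ _ _ (smoothD z1 z2) z3).
rewrite (ddD _ _ _ _ z1 z2) (ddZ _ _ _ _ _ s1) (ddZ _ _ _ _ _ s2) (ddZ _ _ _ _ _ s3).
by rewrite (ddZ _ _ _ _ _ s4) (ddZ _ _ _ _ _ s5) (ddZ _ _ _ _ _ s6).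
Qed.

Lemma dd_mono0 F j p q r : smooth3 F ->
  dd p q r (mono j F) 0 =
  (if j == i0 then p else if j == i1 then q else r)%:R *
  dd (p - (j == i0)) (q - (j == i1)) (r - (j == i2)) F 0.
Proof. exact: dd_coordM0. Qed.

Let idx (j : 'I_3) (p q r : nat) : nat := if j == i0 then p else if j == i1 then q else r.

Lemma dd_mono01 j p q r F v : smooth3 F ->
  dd (p - (j == i0)) (q - (j == i1)) (r - (j == i2)) F 0 = v ->
  dd p q r (mono j F) 0 = (idx j p q r)%:R * v.
Proof. by move=> sF <-; exact: dd_mono0. Qed.

Lemma dd_mono00 j k p q r F v : smooth3 F ->
  dd (p - (j == i0) - (k == i0)) (q - (j == i1) - (k == i1)) (r - (j == i2) - (k == i2)) F 0 = v ->
  dd p q r (mono j (mono k F)) 0 = (idx j p q r)%:R *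
    ((idx k (p - (j == i0)) (q - (j == i1)) (r - (j == i2)))%:R * v).
Proof. by move=> sF E; apply: (dd_mono01 (smooth_mono k sF)); exact: dd_mono01 sF E. Qed.

Lemma dd_mono000 j k l p q r F v : smooth3 F ->
  dd (p - (j == i0) - (k == i0) - (l == i0)) (q - (j == i1) - (k == i1) - (l == i1))
     (r - (j == i2) - (k == i2) - (l == i2)) F 0 = v ->
  dd p q r (mono j (mono k (mono l F))) 0 = (idx j p q r)%:R *
    ((idx k (p - (j == i0)) (q - (j == i1)) (r - (j == i2)))%:R *
    ((idx l (p - (j == i0) - (k == i0)) (q - (j == i1) - (k == i1)) (r - (j == i2) - (k == i2)))%:R * v)).
Proof.
move=> sF E; have sl := smooth_mono l sF.
by apply: (dd_mono01 (smooth_mono k sl)); exact: dd_mono00 sF E.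
Qed.

Opaque mono.

(** The transpose of the first-order operator [pi1] on jet functionals at the origin: coordinates
    lower an index, derivatives raise one. The three terms correspond to three neighbouring
    multi-indices of one bidegree, the source of the three-term recurrences. *)
Lemma dd_pi1 lam F a b e : smooth3 F -> dd a b e (pi1 lam F) 0 =
  a%:R * (- lam.1 - (a%:R - 1) + b%:R / 2%:R - e%:R / 2%:R) * dd a.-1 b e F 0
  - e%:R * dd a b.+1 e.-1 F 0
  - a%:R * (a%:R - 1) * b%:R / 4%:R * dd a.-2 b.-1 e.+1 F 0.
Proof.
move=> sF; have s0 := smooth_pd i0 sF; have s1 := smooth_pd i1 sF; have s2 := smooth_pd i2 sF.
have m j G : smooth3 G -> smooth3 (mono j G) by exact: smooth_mono.
have m1 := m i1 _ s1; have m2 := m i2 _ s2; have m12 := m i1 _ s2; have m00 := m i0 _ s0.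
have m012 := m i0 _ m12.
apply: etrans (dd_lin6 _ _ _ _ _ _ (m i0 _ sF) (m i0 _ m00) (m i0 _ m1) (m i2 _ s1)
  (m i0 _ m2) (m i0 _ m012)
  (dd_mono0 i0 a b e sF)
  (@dd_mono00 i0 i0 a b e _ _ s0 (dd_pd _ _ _ _ _ sF))
  (@dd_mono00 i0 i1 a b e _ _ s1 (dd_pd _ _ _ _ _ sF))
  (@dd_mono01 i2 a b e _ _ s1 (dd_pd _ _ _ _ _ sF))
  (@dd_mono00 i0 i2 a b e _ _ s2 (dd_pd _ _ _ _ _ sF))
  (@dd_mono000 i0 i0 i1 a b e _ _ s2 (dd_pd _ _ _ _ _ sF))) _.
(* Small indices are split off because [.-1] and [.-2] truncate; the coefficients vanish exactly
   there. *)
rewrite /idx /=; pose D p q r := dd p q r F 0; rewrite -!/(D _ _ _); clearbody D.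
clear sF s0 s1 s2 m m1 m2 m12 m00 m012.
case: a => [|[|a]]; case: b => [|b]; case: e => [|e] /=;
  rewrite ?subn0 ?addn0 ?subn1 ?addn1 /= ?mul0r ?mulr0 ?mul0r ?mulr0; by field.
Qed.

Lemma dd_pi2 lam F a b e : smooth3 F -> dd a b e (pi2 lam F) 0 =
  b%:R * (- lam.2 - (b%:R - 1) + a%:R / 2%:R - e%:R / 2%:R) * dd a b.-1 e F 0
  + e%:R * dd a.+1 b e.-1 F 0
  + b%:R * (b%:R - 1) * a%:R / 4%:R * dd a.-1 b.-2 e.+1 F 0.
Proof.
move=> sF; have s0 := smooth_pd i0 sF; have s1 := smooth_pd i1 sF; have s2 := smooth_pd i2 sF.
have m j G : smooth3 G -> smooth3 (mono j G) by exact: smooth_mono.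
have m1 := m i1 _ s1; have m2 := m i2 _ s2; have m12 := m i1 _ s2; have m10 := m i1 _ s0.
have m112 := m i1 _ m12.
apply: etrans (dd_lin6 _ _ _ _ _ _ (m i1 _ sF) (m i1 _ m1) (m i0 _ m10) (m i2 _ s0)
  (m i1 _ m2) (m i0 _ m112)
  (dd_mono0 i1 a b e sF)
  (@dd_mono00 i1 i1 a b e _ _ s1 (dd_pd _ _ _ _ _ sF))
  (@dd_mono00 i0 i1 a b e _ _ s0 (dd_pd _ _ _ _ _ sF))
  (@dd_mono01 i2 a b e _ _ s0 (dd_pd _ _ _ _ _ sF))
  (@dd_mono00 i1 i2 a b e _ _ s2 (dd_pd _ _ _ _ _ sF))
  (@dd_mono000 i0 i1 i1 a b e _ _ s2 (dd_pd _ _ _ _ _ sF))) _.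
rewrite /idx /=; pose D p q r := dd p q r F 0; rewrite -!/(D _ _ _); clearbody D.
clear sF s0 s1 s2 m m1 m2 m12 m10 m112.
case: b => [|[|b]]; case: a => [|a]; case: e => [|e] /=;
  rewrite ?subn0 ?addn0 ?subn1 ?addn1 /= ?mul0r ?mulr0 ?mul0r ?mulr0; by field.
Qed.

Transparent mono.

Definition y31 (y : 'rV[R]_3) := y 0 i2 + y 0 i0 * y 0 i1 / 2%:R.

(** The local action of [exp (s E_{1,2})] on the open cell, read off from the first two columns of
    [nexpp 1 0 s * nbar y]. The denominator is its upper left entry. *)
Definition psi1 (s : R) (y : 'rV[R]_3) : 'rV[R]_3 := \row_j
  [:: y 0 i0 * (1 + s * y 0 i0)^-1; (1 + s * y 0 i0) * y 0 i1 - s * y31 y;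
      y31 y * (1 + s * y 0 i0)^-1
      - y 0 i0 * (1 + s * y 0 i0)^-1 * ((1 + s * y 0 i0) * y 0 i1 - s * y31 y) / 2%:R]`_j.

Definition psi2 (s : R) (y : 'rV[R]_3) : 'rV[R]_3 := \row_j
  [:: y 0 i0 + s * y31 y; y 0 i1 * (1 + s * y 0 i1)^-1;
      y31 y - (y 0 i0 + s * y31 y) * (y 0 i1 * (1 + s * y 0 i1)^-1) / 2%:R]`_j.

(** Positivity of [1 + s * y 0 i0] keeps the component in [M] trivial, so only [A] and [N_+] occur.
    It holds for [s] near [0], which suffices for derivatives. *)
Lemma nexpp1_nbar s (y : 'rV[R]_3) : 0 < 1 + s * y 0 i0 ->
  nexpp 1 0 s * nbar y = nbar (psi1 s y) * (aexp (ln (1 + s * y 0 i0)) 0 *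
    nplus (s / (1 + s * y 0 i0)) 0 0).
Proof.
move=> w0; have w1 : 1 + s * y 0 i0 != 0 by rewrite gt_eqF.
rewrite /nexpp nplusE !nbarE aexpE nplusE !M3_mul sub0r !expRN lnK // expR0 !mxE /= /y31.
by move: (y 0 i0) (y 0 i1) (y 0 i2) w1 => a b c w1; congr M3; field.
Qed.

Lemma nexpp2_nbar s (y : 'rV[R]_3) : 0 < 1 + s * y 0 i1 ->
  nexpp 0 1 s * nbar y = nbar (psi2 s y) * (aexp 0 (ln (1 + s * y 0 i1)) *
    nplus 0 (s / (1 + s * y 0 i1)) 0).
Proof.
move=> w0; have w1 : 1 + s * y 0 i1 != 0 by rewrite gt_eqF.
rewrite /nexpp nplusE !nbarE aexpE nplusE !M3_mul subr0 !expRN lnK // expR0 !mxE /= /y31.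
by move: (y 0 i0) (y 0 i1) (y 0 i2) w1 => a b c w1; congr M3; field.
Qed.

Lemma near_pos (k : R) : nbhs (0 : 'rV[R]_1) [set u : 'rV[R]_1 | 0 < 1 + u 0 0 * k].
Proof.
have c : Ck 0 setT (fun u : 'rV[R]_1 => 1 + u 0 0 * k) by solve_Ck.
have c0 : (fun u : 'rV[R]_1 => 1 + u 0 0 * k) @ (0 : 'rV[R]_1) --> 1 + (0 : 'rV[R]_1) 0 0 * k.
  exact: Ck_cont c 0 I.
have lt01 : 0 < 1 + (0 : 'rV[R]_1) 0 0 * k by rewrite mxE mul0r addr0 ltr01.
exact: cvgr_gt c0 _ lt01.
Qed.

Lemma is_derive_inv_affine (k : R) :
  is_derive (0 : 'rV[R]_1) (e_ 0) (fun u : 'rV[R]_1 => (1 + u 0 0 * k)^-1) (- k).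
Proof.
have D : is_derive (0 : 'rV[R]_1) (e_ 0) (fun u : 'rV[R]_1 => 1 + u 0 0 * k) k.
  by apply: is_derive_eqd; first der; rewrite !mxE /=; ring.
have n0 : 1 + (0 : 'rV[R]_1) 0 0 * k != 0 by rewrite mxE mul0r addr0 oner_neq0.
apply: (is_derive_eqd (is_derive_comp1 D (is_derive1_inv n0))).
by rewrite mxE mul0r addr0 expr1n invr1 mulrN1.
Qed.

Lemma is_derive_ln_affine (k : R) :
  is_derive (0 : 'rV[R]_1) (e_ 0) (fun u : 'rV[R]_1 => ln (1 + u 0 0 * k)) k.
Proof.
have D : is_derive (0 : 'rV[R]_1) (e_ 0) (fun u : 'rV[R]_1 => 1 + u 0 0 * k) k.
  by apply: is_derive_eqd; first der; rewrite !mxE /=; ring.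
have n0 : 0 < 1 + (0 : 'rV[R]_1) 0 0 * k by rewrite mxE mul0r addr0 ltr01.
apply: (is_derive_eqd (is_derive_comp1 D (@exp.is_derive1_ln R _ n0))).
by rewrite mxE mul0r addr0 invr1 mulr1.
Qed.

Lemma chiAV lam t1 t2 : (chiA lam t1 t2)^-1 = cexp (- lam.1 * RC t1) * cexp (- lam.2 * RC t2).
Proof. by rewrite /chiA -cexpN opprD cexpD !mulNr. Qed.

Lemma psi1_deriv (y : 'rV[R]_3) j : is_derive (0 : 'rV[R]_1) (e_ 0) (fun u : 'rV[R]_1 => psi1 (u 0 0) y 0 j)
  ([:: - y 0 i0 ^+ 2; y 0 i0 * y 0 i1 / 2%:R - y 0 i2;
       - (y 0 i0 * y 0 i2 / 2%:R + y 0 i0 ^+ 2 * y 0 i1 / 4%:R)]`_j).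
Proof.
have Di := is_derive_inv_affine (y 0 i0).
case: (ord3P j) => ->.
- apply: (@is_derive_fun_eq _ _ _ _ (fun u : 'rV[R]_1 => y 0 i0 * (1 + u 0 0 * y 0 i0)^-1)).
    by move=> u; rewrite mxE.
  apply: (is_derive_eqd (is_derive_mulf (is_derive_cst _ _ _) Di)).
  by rewrite /= /GRing.scale /= mulr0 ?addr0 ?add0r ?mulrN expr2.
- apply: (@is_derive_fun_eq _ _ _ _ (fun u : 'rV[R]_1 => (1 + u 0 0 * y 0 i0) * y 0 i1 - u 0 0 * y31 y)).
    by move=> u; rewrite mxE.
  by apply: is_derive_eqd; first der; rewrite !mxE /= /y31; field.
apply: (@is_derive_fun_eq _ _ _ _ (fun u : 'rV[R]_1 => y31 y * (1 + u 0 0 * y 0 i0)^-1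
      - y 0 i0 * (1 + u 0 0 * y 0 i0)^-1 * ((1 + u 0 0 * y 0 i0) * y 0 i1 - u 0 0 * y31 y) / 2%:R)).
  by move=> u; rewrite mxE.
apply: is_derive_eqd; first by repeat first [exact: Di | exact: is_derive_coord
  | exact: is_derive_cst | apply: is_derive_addf | apply: is_derive_oppf | apply: is_derive_mulf].
rewrite !mxE /= /y31 /GRing.scale /= !mul0r !addr0 invr1.
by move: (y 0 i0) (y 0 i1) (y 0 i2) => a b c; field.
Qed.

Lemma psi2_deriv (y : 'rV[R]_3) j : is_derive (0 : 'rV[R]_1) (e_ 0) (fun u : 'rV[R]_1 => psi2 (u 0 0) y 0 j)
  ([:: y31 y; - y 0 i1 ^+ 2;
       - (y 0 i1 * y 0 i2 / 2%:R) + y 0 i0 * y 0 i1 ^+ 2 / 4%:R]`_j).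
Proof.
have Di := is_derive_inv_affine (y 0 i1).
case: (ord3P j) => ->.
- apply: (@is_derive_fun_eq _ _ _ _ (fun u : 'rV[R]_1 => y 0 i0 + u 0 0 * y31 y)).
    by move=> u; rewrite mxE.
  by apply: is_derive_eqd; first der; rewrite !mxE /=; ring.
- apply: (@is_derive_fun_eq _ _ _ _ (fun u : 'rV[R]_1 => y 0 i1 * (1 + u 0 0 * y 0 i1)^-1)).
    by move=> u; rewrite mxE.
  apply: (is_derive_eqd (is_derive_mulf (is_derive_cst _ _ _) Di)).
  by rewrite /= /GRing.scale /= mulr0 ?addr0 ?add0r ?mulrN expr2.
apply: (@is_derive_fun_eq _ _ _ _ (fun u : 'rV[R]_1 =>
   y31 y - (y 0 i0 + u 0 0 * y31 y) * (y 0 i1 * (1 + u 0 0 * y 0 i1)^-1) / 2%:R)).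
  by move=> u; rewrite mxE.
apply: is_derive_eqd; first by repeat first [exact: Di | exact: is_derive_coord
  | exact: is_derive_cst | apply: is_derive_addf | apply: is_derive_oppf | apply: is_derive_mulf].
rewrite !mxE /= /y31 /GRing.scale /= !mul0r !addr0 invr1.
by move: (y 0 i0) (y 0 i1) (y 0 i2) => a b c; field.
Qed.

Lemma psi1_0 y : psi1 0 y = y.
Proof. by apply: row3P; rewrite !mxE /= /y31 ?mul0r ?addr0 ?invr1; field. Qed.

Lemma psi2_0 y : psi2 0 y = y.
Proof. by apply: row3P; rewrite !mxE /= /y31 ?mul0r ?addr0 ?invr1; field. Qed.

Lemma is_cderive_eqd (V : normedModType R) (x v : V) (F : V -> C) d d' :
  is_cderive x v F d -> d = d' -> is_cderive x v F d'.
Proof. by move=> ? <-. Qed.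

Lemma pd_nexpp1 lam e f g y : Iser lam e f -> SL3 g ->
  pd 0 (fun u : 'rV[R]_1 => trans f (g * nexpp 1 0 (u 0 0)) y) 0 = pi1 lam (trans f g) y.
Proof.
move=> If sg; apply: is_cderive_pd; have sF := smooth_trans (Iser_smooth If) sg.
apply: (@is_cderive_near _ _ _ _ (fun u : 'rV[R]_1 =>
   cexp (- lam.1 * RC (ln (1 + u 0 0 * y 0 i0))) * (trans f g \o (fun u : 'rV[R]_1 => psi1 (u 0 0) y)) u)).
  have := near_pos (y 0 i0); apply: filterS => u u0.
  rewrite /trans -mulrA nexpp1_nbar // mulrA (Iser_an _ _ _ _ _ If); last exact: SL3M sg (SL3_nbar _).
  by rewrite chiAV RC0 mulr0 cexp0 mulr1.
have D1 := is_cderive_cexp (- lam.1) (is_derive_ln_affine (y 0 i0)).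
have D2 := @is_cderive_chain _ _ _ _ (fun u : 'rV[R]_1 => psi1 (u 0 0) y) _ _ _ _ sF I (fun j => psi1_deriv y j).
apply: (is_cderive_eqd (is_cderiveM D1 D2)).
rewrite /= mxE psi1_0 mul0r addr0 ln1 RC0 mulr0 cexp0 sum3E /pi1 /mono /=.
rewrite !(RC_nat, RCN, RCX, RCV, RCM, RCD).
move: (trans f g y) (pd i0 _ y) (pd i1 _ y) (pd i2 _ y) (RC (y 0 i0)) (RC (y 0 i1)) (RC (y 0 i2)) => T d0 d1 d2 a b c.
by field.
Qed.

Lemma pd_nexpp2 lam e f g y : Iser lam e f -> SL3 g ->
  pd 0 (fun u : 'rV[R]_1 => trans f (g * nexpp 0 1 (u 0 0)) y) 0 = pi2 lam (trans f g) y.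
Proof.
move=> If sg; apply: is_cderive_pd; have sF := smooth_trans (Iser_smooth If) sg.
apply: (@is_cderive_near _ _ _ _ (fun u : 'rV[R]_1 =>
   cexp (- lam.2 * RC (ln (1 + u 0 0 * y 0 i1))) * (trans f g \o (fun u : 'rV[R]_1 => psi2 (u 0 0) y)) u)).
  have := near_pos (y 0 i1); apply: filterS => u u0.
  rewrite /trans -mulrA nexpp2_nbar // mulrA (Iser_an _ _ _ _ _ If); last exact: SL3M sg (SL3_nbar _).
  by rewrite chiAV RC0 mulr0 cexp0 mul1r.
have D1 := is_cderive_cexp (- lam.2) (is_derive_ln_affine (y 0 i1)).
have D2 := @is_cderive_chain _ _ _ _ (fun u : 'rV[R]_1 => psi2 (u 0 0) y) _ _ _ _ sF I (fun j => psi2_deriv y j).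
apply: (is_cderive_eqd (is_cderiveM D1 D2)).
rewrite /= mxE psi2_0 mul0r addr0 ln1 RC0 mulr0 cexp0 sum3E /pi2 /mono /= /y31.
rewrite !(RC_nat, RCN, RCX, RCV, RCM, RCD).
move: (trans f g y) (pd i0 _ y) (pd i1 _ y) (pd i2 _ y) (RC (y 0 i0)) (RC (y 0 i1)) (RC (y 0 i2)) => T d0 d1 d2 a b c.
by field.
Qed.

End InfinitesimalAction.

(** * From annihilation to intertwining *)

Section Intertwining.
Variable R : realType.
Notation C := (R[i]).
Notation e_ := (ebasis R).
Notation i0 := (0 : 'I_3).
Notation i1 := (1 : 'I_3).
Notation i2 := (2%:R : 'I_3).
Implicit Types (F : 'rV[R]_3 -> C) (f : 'M[R]_3 -> C) (lam nu : C * C).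

Lemma const_of_pd0 (psi : 'rV[R]_1 -> C) (s : R) : smooth_on setT psi ->
  (forall u, pd 0 psi u = 0) -> psi (s *: e_ 0) = psi 0.
Proof.
move=> sp d0.
have D t : is_cderive (t *: e_ 0 + 0) (e_ 0) psi 0 by rewrite -(d0 (t *: e_ 0 + 0)); exact: (smooth_der 0 sp).
have L (h : 'rV[R]_1 -> R) : (forall t : R, is_derive (t *: e_ 0 + 0) (e_ 0) h 0) ->
    h (s *: e_ 0) = h 0.
  move=> dh; have H t : is_derive t (1 : R) (fun t => h (t *: e_ 0 + 0)) 0.
    by have [d1 d2] := dh t; have := derivable_line d1; rewrite d2.
  by have := @is_derive_0_is_cst R _ s 0 H; rewrite !addr0 scale0r.
apply: complex_ext; first by apply: (L (fun u => complex.Re (psi u))) => t; have [] := D t.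
by apply: (L (fun u => complex.Im (psi u))) => t; have [] := D t.
Qed.

Lemma nexppD a b s t : a * b = 0 -> nexpp a b (s + t) = nexpp a b s * nexpp a b t :> 'M[R]_3.
Proof.
move=> ab; rewrite /nexpp nplus_mul !mulrDl !addr0 add0r; congr nplus.
by rewrite mulrACA ab mulr0.
Qed.

(** The hypothesis concerns the derivative at [0] only, but at every base point. Since [a * b = 0]
    makes [nexpp a b] a one-parameter group, the base point can be moved along the curve and the
    derivative vanishes throughout. *)
Lemma fP_nexpp P f a b g s : smooth_G f -> SL3 g -> a * b = 0 ->
  (forall g, SL3 g -> pd 0 (fun u : 'rV[R]_1 => fP P f (g * nexpp a b (u 0 0))) 0 = 0) ->
  fP P f (g * nexpp a b s) = fP P f g.
Proof.
move=> sf sg ab H; pose psi (u : 'rV[R]_1) := fP P f (g * nexpp a b (u 0 0)).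
have sp : smooth_on setT psi := smooth_Pdd_param P a b sf sg.
have := @const_of_pd0 psi s sp; rewrite /psi !mxE eqxx mulr1 => ->.
  by rewrite /nexpp !mul0r nplus0 mulr1.
move=> u0; have sgu : SL3 (g * nexpp a b (u0 0 0)) := SL3M sg (SL3_nplus _ _ _).
have := H _ sgu.
have [D1 D2] := smooth_der 0 sp (I : setT u0).
have D : is_cderive (0 : 'rV[R]_1) (e_ 0) (fun u => psi (u0 + u)) (pd 0 psi u0).
  by split; [apply: (@is_derive_shift_arg _ _ (fun u => complex.Re (psi u)))|
    apply: (@is_derive_shift_arg _ _ (fun u => complex.Im (psi u)))]; rewrite addr0.
rewrite -(is_cderive_pd D) => <-; congr (pd 0 _ 0); apply/funext => u.
by rewrite /psi mxE nexppD // mulrA.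
Qed.

(** [E_{1,2}] and [E_{2,3}] generate [N_+]. With first factor of parameter [p], the product has
    corner entry [p + a * (b - 1)]; solving for [c] gives the parameters shown. *)
Lemma nplus_gen (a b c : R) :
  nplus a b c = nexpp 1 0 (c - a * (b - 1)) * nexpp 0 1 1 * nexpp 1 0 (a - (c - a * (b - 1)))
                * nexpp 0 1 (b - 1).
Proof. by rewrite /nexpp !nplus_mul; congr nplus; ring. Qed.

Definition annihilates P lam := forall F, smooth3 F -> Pdd P (pi1 lam F) = 0 /\ Pdd P (pi2 lam F) = 0.

Lemma fP_nplus P lam e f g a b c : annihilates P lam -> Iser lam e f -> SL3 g ->
  fP P f (g * nplus a b c) = fP P f g.
Proof.
move=> aP If sg; have sf := Iser_smooth If.
have H1 h s : SL3 h -> fP P f (h * nexpp 1 0 s) = fP P f h.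
  move=> sh; apply: (@fP_nexpp P f 1 0 h s sf sh); first by rewrite mulr0.
  move=> k sk; rewrite (pd_fP _ _ _ sf sk) (_ : (fun y => _) = pi1 lam (trans f k)).
    by have [] := aP _ (smooth_trans sf sk).
  by apply/funext => y; exact: pd_nexpp1 If sk.
have H2 h s : SL3 h -> fP P f (h * nexpp 0 1 s) = fP P f h.
  move=> sh; apply: (@fP_nexpp P f 0 1 h s sf sh); first by rewrite mul0r.
  move=> k sk; rewrite (pd_fP _ _ _ sf sk) (_ : (fun y => _) = pi2 lam (trans f k)).
    by have [] := aP _ (smooth_trans sf sk).
  by apply/funext => y; exact: pd_nexpp2 If sk.
have sn x y s : SL3 (nexpp x y s : 'M[R]_3) := SL3_nplus _ _ _.
by rewrite nplus_gen !mulrA H2 ?H1 ?H2 ?H1 //; repeat apply: SL3M => //.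
Qed.

Definition scale3 (r1 r2 : R) (y : 'rV[R]_3) : 'rV[R]_3 :=
  \row_j [:: r1 * y 0 i0; r2 * y 0 i1; r1 * r2 * y 0 i2]`_j.

Lemma diag_nbar (h1 h2 h3 : R) y : h1 != 0 -> h2 != 0 -> h3 != 0 ->
  M3 h1 0 0 0 h2 0 0 0 h3 * nbar y = nbar (scale3 (h2 / h1) (h3 / h2) y) * M3 h1 0 0 0 h2 0 0 0 h3.
Proof.
move=> n1 n2 n3; rewrite !nbarE !M3_mul !mxE /=.
by move: (y 0 i0) (y 0 i1) (y 0 i2) => a b c; congr M3; field; rewrite ?n1 ?n2.
Qed.

(** The third weight is a product because the root of [E_{3,1}] is the sum of the roots of [E_{2,1}]
    and [E_{3,2}]. *)
Definition weight3 (r1 r2 : R) (j : 'I_3) : R := [:: r1; r2; r1 * r2]`_j.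

Lemma pd_scale3 F r1 r2 j y : smooth3 F ->
  pd j (F \o scale3 r1 r2) y = RC (weight3 r1 r2 j) * pd j F (scale3 r1 r2 y).
Proof.
move=> sF; apply: is_cderive_pd.
have H k : is_derive y (e_ j) (fun y => scale3 r1 r2 y 0 k) (weight3 r1 r2 k * (j == k)%:R).
  have E : (fun y : 'rV[R]_3 => weight3 r1 r2 k * y 0 k) =1 (fun y => scale3 r1 r2 y 0 k).
    by move=> z; rewrite mxE; case: (ord3P k) => ->.
  apply: (is_derive_fun_eq E).
  apply: (is_derive_eqd (is_derive_mulf (is_derive_cst (weight3 r1 r2 k) _ _) (is_derive_coord _ _ _))).
  by rewrite mxE mulr0 addr0.
have := @is_cderive_chain _ _ _ _ (scale3 r1 r2) _ _ _ _ sF (I : setT (scale3 r1 r2 y)) H.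
congr (is_cderive _ _ _ _); rewrite (bigD1 j) //= eqxx mulr1 big1 ?addr0 // => k kj.
by rewrite eq_sym (negbTE kj) mulr0 RC0 mul0r.
Qed.

Lemma smooth_scale3 F r1 r2 : smooth3 F -> smooth3 (F \o scale3 r1 r2).
Proof.
move=> sF; apply: (smooth_comp openT _ _ sF) => // N k.
have E : forall y : 'rV[R]_3, setT y -> weight3 r1 r2 k * y 0 k = scale3 r1 r2 y 0 k.
  by move=> z _; rewrite mxE; case: (ord3P k) => ->.
by apply: (Ck_eq openT E); solve_Ck.
Qed.

Lemma ipd_scale3 F r1 r2 w y : smooth3 F ->
  ipd w (F \o scale3 r1 r2) y = (\prod_(j <- w) RC (weight3 r1 r2 j)) * ipd w F (scale3 r1 r2 y).
Proof.
move=> sF; elim: w y => [|j w IH] y; first by rewrite big_nil mul1r.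
rewrite big_cons /=.
have sw := smooth_ipd w sF.
have -> : ipd w (F \o scale3 r1 r2) =
    (fun y => (\prod_(j <- w) RC (weight3 r1 r2 j)) * (ipd w F \o scale3 r1 r2) y).
  by apply/funext => z; rewrite IH.
rewrite (pdZ _ j (smooth_scale3 r1 r2 sw) (I : setT y)) (pd_scale3 r1 r2 j y sw).
by rewrite mulrCA mulrA.
Qed.

Lemma dd_scale3 F r1 r2 a b e : smooth3 F ->
  dd a b e (F \o scale3 r1 r2) 0 = RC r1 ^+ (a + e) * RC r2 ^+ (b + e) * dd a b e F 0.
Proof.
move=> sF; rewrite [LHS](ipd_scale3 r1 r2 _ 0 sF) (_ : scale3 r1 r2 0 = 0); last first.
  by apply: row3P; rewrite !mxE /= mulr0.
congr (_ * _); rewrite !big_cat /= !big_nseq !iter_mulr !mulr1 /weight3 /=.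
by rewrite RCM exprMn !exprD; ring.
Qed.

Definition bihomogeneous (P : seq (C * (nat * nat * nat))) (k l : nat) :=
  forall t, t \in P -> (t.2.1.1 + t.2.2 = k)%N /\ (t.2.1.2 + t.2.2 = l)%N.

Definition shift_wt lam (k l : nat) : C * C :=
  (lam.1 + 2%:R * k%:R - l%:R, lam.2 + 2%:R * l%:R - k%:R).

(** The indices cross: when [b1 * b2 * b3 = 1] with entries [1] or [-1], the ratios acting on the
    first two coordinates are [b2 / b1 = b3] and [b3 / b2 = b1]. Thus [k] acts on the sign attached
    to [b3] and [l] on the one attached to [b1]. *)
Definition shift_sgn (e : sgn * sgn) (k l : nat) : sgn * sgn :=
  (smul e.1 (spow l%:Z), smul e.2 (spow k%:Z)).

Lemma pm1_neq0 (b : R) : pm1 b -> b != 0.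
Proof. by case=> ->; rewrite ?oppr_eq0 oner_neq0. Qed.

Lemma pm1V (b : R) : pm1 b -> b^-1 = b.
Proof. by case=> ->; rewrite ?invrN invr1. Qed.

Lemma pm1_sq (b : R) : pm1 b -> b * b = 1.
Proof. by case=> ->; rewrite ?mulrNN mulr1. Qed.

Lemma sabs_spow (s : sgn) (b : R) n : pm1 b -> sabs (smul s (spow n%:Z)) b = sabs s b * b ^+ n.
Proof.
case=> ->; rewrite /spow /= ?expr1n ?mulr1.
  by case: s; case: odd => /=; rewrite ?normr1.
rewrite -signr_odd; case: s; case: odd => /=; rewrite ?normrN ?normr1 ?expr1 ?expr0 ?mulr1 ?mul1r //.
by rewrite mulrNN mulr1.
Qed.

Lemma pm1_sabs (s : sgn) (b : R) : pm1 b -> pm1 (sabs s b).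
Proof. by case: s => //= -[] ->; left; rewrite ?normrN normr1. Qed.

Lemma chiMV e b1 b2 b3 : pm1 b1 -> pm1 b3 -> (chiM e b1 b2 b3)^-1 = chiM e b1 b2 b3 :> C.
Proof.
move=> p1 p3; rewrite /chiM -RCV invfM.
by rewrite (pm1V (pm1_sabs _ p1)) (pm1V (pm1_sabs _ p3)).
Qed.

Lemma aexp_pow (t : R) n : RC (expR t) ^+ n = cexp (RC (n%:R * t)).
Proof. by rewrite -RCX -expRM_natl cexp_RC mulr_natl. Qed.

Definition ratio1 (b1 b2 b3 t1 t2 : R) := b3 * expR (t2 - 2%:R * t1).
Definition ratio2 (b1 b2 b3 t1 t2 : R) := b1 * expR (t1 - 2%:R * t2).

Lemma chi_shift lam e k l b1 b2 b3 t1 t2 : pm1 b1 -> pm1 b2 -> pm1 b3 ->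
  (chiM e b1 b2 b3)^-1 * (chiA lam t1 t2)^-1 *
    (RC (ratio1 b1 b2 b3 t1 t2) ^+ k * RC (ratio2 b1 b2 b3 t1 t2) ^+ l) =
  (chiM (shift_sgn e k l) b1 b2 b3)^-1 * (chiA (shift_wt lam k l) t1 t2)^-1.
Proof.
move=> p1 p2 p3; rewrite !chiMV // /chiM /shift_sgn /= !sabs_spow // /ratio1 /ratio2 !RCM.
rewrite !exprMn !aexp_pow /chiA -!cexpN /= !RCX.
have -> : cexp (- ((lam.1 + 2%:R * k%:R - l%:R) * RC t1 + (lam.2 + 2%:R * l%:R - k%:R) * RC t2)) =
  cexp (- (lam.1 * RC t1 + lam.2 * RC t2)) * cexp (RC (k%:R * (t2 - 2%:R * t1))) * cexp (RC (l%:R * (t1 - 2%:R * t2))).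
  rewrite -!cexpD; congr cexp; rewrite !(RC_nat, RCM, RCN, RCD).
  by move: (RC t1) (RC t2) => u1 u2; ring.
by move: (cexp _) (cexp _) (cexp _) => u1 u2 u3; ring.
Qed.

Lemma ma_nbar b1 b2 b3 t1 t2 (y : 'rV[R]_3) : pm1 b1 -> pm1 b2 -> pm1 b3 -> b1 * b2 * b3 = 1 ->
  mdiag b1 b2 b3 * aexp t1 t2 * nbar y =
  nbar (scale3 (ratio1 b1 b2 b3 t1 t2) (ratio2 b1 b2 b3 t1 t2) y) * (mdiag b1 b2 b3 * aexp t1 t2).
Proof.
move=> p1 p2 p3 bb.
have r1E : b2 * expR (t2 - t1) / (b1 * expR t1) = ratio1 b1 b2 b3 t1 t2.
  rewrite /ratio1 invfM (pm1V p1) -expRN mulrACA -expRD; congr (_ * expR _); last by ring.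
  by rewrite -[RHS]mul1r -bb -mulrA (pm1_sq p3) mulr1 mulrC.
have r2E : b3 * expR (- t2) / (b2 * expR (t2 - t1)) = ratio2 b1 b2 b3 t1 t2.
  rewrite /ratio2 invfM (pm1V p2) -expRN mulrACA -expRD; congr (_ * expR _); last by ring.
  by rewrite -[RHS]mulr1 -bb -mulrA [RHS]mulrA (pm1_sq p1) mul1r mulrC.
rewrite mdiagE aexpE M3_mul !mulr0 !mul0r !addr0 !add0r.
have e0 (t : R) : expR t != 0 by rewrite gt_eqF ?expR_gt0.
have n1 := mulf_neq0 (pm1_neq0 p1) (e0 t1); have n2 := mulf_neq0 (pm1_neq0 p2) (e0 (t2 - t1)).
by rewrite (diag_nbar y n1 n2 (mulf_neq0 (pm1_neq0 p3) (e0 (- t2)))) r1E r2E.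
Qed.

Lemma trans_ma lam e f g b1 b2 b3 t1 t2 y : Iser lam e f -> SL3 g ->
  pm1 b1 -> pm1 b2 -> pm1 b3 -> b1 * b2 * b3 = 1 ->
  trans f (g * (mdiag b1 b2 b3 * aexp t1 t2)) y =
  (chiM e b1 b2 b3)^-1 * (chiA lam t1 t2)^-1 *
    (trans f g \o scale3 (ratio1 b1 b2 b3 t1 t2) (ratio2 b1 b2 b3 t1 t2)) y.
Proof.
move=> If sg p1 p2 p3 bb; rewrite /trans -mulrA ma_nbar // mulrA /=.
rewrite -(Iser_man t1 t2 0 0 0 If (SL3M sg (SL3_nbar _)) p1 p2 p3 bb).
by rewrite nplus0 mulr1.
Qed.

Lemma fP_ma P lam e f g b1 b2 b3 t1 t2 : Iser lam e f -> SL3 g ->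
  pm1 b1 -> pm1 b2 -> pm1 b3 -> b1 * b2 * b3 = 1 ->
  fP P f (g * (mdiag b1 b2 b3 * aexp t1 t2)) =
  \sum_(t <- P) t.1 * ((chiM e b1 b2 b3)^-1 * (chiA lam t1 t2)^-1 *
     (RC (ratio1 b1 b2 b3 t1 t2) ^+ (t.2.1.1 + t.2.2) * RC (ratio2 b1 b2 b3 t1 t2) ^+ (t.2.1.2 + t.2.2))
     * dd t.2.1.1 t.2.1.2 t.2.2 (trans f g) 0).
Proof.
move=> If sg p1 p2 p3 bb; apply: eq_bigr => t _; congr (_ * _).
have sF := smooth_trans (Iser_smooth If) sg.
rewrite (eq_dd _ _ _ _ (fun y => trans_ma t1 t2 y If sg p1 p2 p3 bb)).
by rewrite (ddZ _ _ _ _ _ (smooth_scale3 _ _ sF)) (dd_scale3 _ _ _ _ _ sF) mulrA.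
Qed.

Lemma Iser_fP P lam e f k l : Iser lam e f -> annihilates P lam -> bihomogeneous P k l ->
  Iser (shift_wt lam k l) (shift_sgn e k l) (fP P f).
Proof.
move=> If aP bP; split; first exact: smooth_fP (Iser_smooth If).
move=> g b1 b2 b3 t1 t2 a b c sg p1 p2 p3 bb.
have sh : SL3 (g * mdiag b1 b2 b3 * aexp t1 t2).
  by apply: SL3M (SL3_aexp _ _); apply: SL3M sg (SL3_mdiag bb).
rewrite (fP_nplus _ _ _ aP If sh) -mulrA (fP_ma _ _ _ If sg p1 p2 p3 bb) /fP /Pdd mulr_sumr.
rewrite big_seq [RHS]big_seq; apply: eq_bigr => t tP.
by have [-> ->] := bP t tP; rewrite chi_shift // mulrCA.
Qed.

(** Gauss elimination: two nonvanishing leading minors suffice, and their signs and absolute values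
    give the components in [M] and [A]. *)
Lemma bruhat_cell (g : 'M[R]_3) : SL3 g -> g i0 i0 != 0 ->
  g i0 i0 * g i1 i1 - g i0 i1 * g i1 i0 != 0 ->
  exists x b1 b2 b3 t1 t2 a b c, [/\ pm1 b1, pm1 b2, pm1 b3, b1 * b2 * b3 = 1 &
    g = nbar x * (mdiag b1 b2 b3 * aexp t1 t2 * nplus a b c)].
Proof.
have sg1 (d : R) : d != 0 -> pm1 (Num.sg d).
  by move=> d0; case: sgrP d0 => //; [left|right].
have sgE (d : R) : d != 0 -> Num.sg d * expR (ln `|d|) = d.
  by move=> d0; rewrite lnK ?posrE ?normr_gt0 // -numEsg.
rewrite {1}/SL3 [g]M3_eta det_M3.
move: (g i0 i0) (g i0 i1) (g i0 i2) (g i1 i0) (g i1 i1) (g i1 i2) (g i2 i0) (g i2 i1) (g i2 i2).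
move=> a b c d e f p q r; rewrite !mxE /= => det1 a0 m0.
set m := a * e - b * d in m0.
exists (\row_j [:: d / a; (a * q - p * b) / m; p / a - (d / a) * ((a * q - p * b) / m) / 2%:R]`_j).
(* The leading minors of [mdiag * aexp] are [b1 e^t1] and [b1 b2 e^t2]; they must equal [a] and
   [m]. *)
exists (Num.sg a), (Num.sg a * Num.sg m), (Num.sg m), (ln `|a|), (ln `|m|).
exists (b / a), ((a * f - c * d) / m), (c / a).
have pa := sg1 _ a0; have pm := sg1 _ m0.
split => //.
- by case: pa => ->; case: pm => ->; rewrite ?mulr1 ?mulrNN ?mul1r; [left|right|right|left].
- by rewrite mulrA (pm1_sq pa) mul1r (pm1_sq pm).
rewrite nbarE mdiagE aexpE nplusE !M3_mul !mxE /= !expRD !expRN.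
have Ea := sgE _ a0; have Em := sgE _ m0.
have EV (d' : R) : d' != 0 -> (expR (ln `|d'|))^-1 = Num.sg d' / d'.
  by move=> d0; rewrite lnK ?posrE ?normr_gt0 // normrEsg invfM (pm1V (sg1 _ d0)).
have EaV := EV _ a0; have EmV := EV _ m0.
have H2 : Num.sg a * Num.sg m * (expR (ln `|m|) / expR (ln `|a|)) = m / a.
  rewrite EaV (_ : _ * _ = (Num.sg m * expR (ln `|m|)) * (Num.sg a * Num.sg a) / a).
    by rewrite Em (pm1_sq pa) mulr1.
  by move: (Num.sg m) (Num.sg a) (expR _) a^-1 => u1 u2 u3 u4; ring.
have H3 : Num.sg m * (expR (ln `|m|))^-1 = m^-1 by rewrite EmV mulrA (pm1_sq pm) mul1r.
rewrite !mulr0 !mul0r !addr0 !add0r !mul0r !mulr0 !addr0 !add0r H2 H3 Ea !mulr1 !mul1r.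
have mE : m = a * e - b * d by [].
have det1' : 1 = a * (e * r - f * q) - b * (d * r - f * p) + c * (d * q - e * p) by [].
congr M3; rewrite ?mul1r ?mulr1; try (by rewrite mE in m0 *; field; rewrite ?a0 ?m0).
(* The lower right entry requires determinant one: the third pivot [m^-1] is written as the
   determinant over [m]. *)
have E33 : m^-1 = (a * (e * r - f * q) - b * (d * r - f * p) + c * (d * q - e * p)) / m.
  by rewrite -det1' mul1r.
rewrite [X in _ = _ + X]E33.
by rewrite mE in m0 *; field; rewrite ?a0 ?m0.
Qed.

(** If [h 0] were nonzero, [h] would be nonzero on a ball, every point of which would have a root of
    [p] as its coordinate; that is too many roots. *)
Lemma continuous_poly_zero (h : 'rV[R]_1 -> R) (p : {poly R}) : {for 0, continuous h} ->
  p != 0 -> (forall u : 'rV[R]_1, p.[u 0 0] != 0 -> h u = 0) -> h 0 = 0.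
Proof.
move=> ch p0 hp; apply/eqP; apply: contraT => h0.
have hn : 0 < `|h 0| by rewrite normr_gt0.
have N : nbhs (0 : 'rV[R]_1) [set u | h u != 0].
  have H : nbhs (0 : 'rV[R]_1) [set u | `|h 0 - h u| < `|h 0|].
    exact: (cvgrPdist_lt _ _).1 (ch : h @ (0 : 'rV[R]_1) --> h 0) _ hn.
  apply: (@filterS _ _ _ _ _ _ H) => u /= hu; apply/eqP => hu0.
  by move: hu; rewrite hu0 subr0 ltxx.
have [d /= d0 Hd] := nbhs_norm0P.1 N.
(* As many distinct points as [size p], one more than the degree. The shift by [2] puts them
   strictly inside the ball of radius [d]. *)
pose rs := [seq d / (j%:R + 2%:R) | j <- iota 0 (size p)].
have dpos j : 0 < d / (j%:R + 2%:R) by rewrite divr_gt0 // ltr_wpDl // ler0n.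
have all_root : all (root p) rs.
  apply/allP => x /mapP[j _ ->]; rewrite rootE; apply: contraT => pj.
  have := hp ((d / (j%:R + 2%:R)) *: e_ 0); rewrite !mxE eqxx mulr1 => /(_ pj) h00.
  have : h ((d / (j%:R + 2%:R)) *: e_ 0) != 0; last by rewrite h00 eqxx.
  apply: Hd => /=; apply: (@le_lt_trans _ _ (d / (j%:R + 2%:R))).
    apply: norm_le_coord; first exact: ltW.
    by move=> i; rewrite !mxE (ord1 i) eqxx mulr1 gtr0_norm.
  rewrite ltr_pdivrMr ?ltr_wpDl // ?ler0n // ltr_pMr //.
  by have := ler0n R j; lra.
have uq : uniq rs.
  rewrite map_inj_uniq ?iota_uniq // => i j /(mulfI (lt0r_neq0 d0)) /invr_inj /addIr /eqP.
  by rewrite eqr_nat => /eqP.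
by have := max_poly_roots p0 all_root uq; rewrite size_map size_iota ltnn.
Qed.

Lemma Ck_smooth_cont n (U : set 'rV[R]_n) (F : 'rV[R]_n -> C) x : smooth_on U F -> U x ->
  {for x, continuous (fun y => complex.Re (F y))} /\ {for x, continuous (fun y => complex.Im (F y))}.
Proof. by move=> [_ sF] Ux; have [? [? _]] := sF [::] x Ux. Qed.

Lemma poly_nz (a b c : R) : [|| a != 0, b != 0 | c != 0] ->
  (a%:P + b *: 'X + (c / 2%:R) *: 'X^2 : {poly R}) != 0.
Proof.
move=> H; apply/eqP => /polyP E; move: H.
have := E 0%N; have := E 1%N; have := E 2%N; rewrite !coefE /= !mulr0 ?mulr1 ?addr0 ?add0r => c0 -> ->.
by rewrite eqxx /= -[c](mulfK (x := 2%:R)) ?pnatr_eq0 // mulrAC c0 mul0r eqxx.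
Qed.

(** This makes the image of [f] under an intertwining operator unique, so any witness can be
    compared with [fP P f] on the whole group. *)
Lemma Iser_ext nu d f1 f2 g : Iser nu d f1 -> Iser nu d f2 ->
  (forall x, res f1 x = res f2 x) -> SL3 g -> f1 g = f2 g.
Proof.
move=> I1 I2 E sg.
have cell h : SL3 h -> h i0 i0 != 0 -> h i0 i0 * h i1 i1 - h i0 i1 * h i1 i0 != 0 -> f1 h = f2 h.
  move=> sh h1 h2; have [x [b1 [b2 [b3 [t1 [t2 [a [b [c [p1 p2 p3 bb ->]]]]]]]]]] := bruhat_cell sh h1 h2.
  rewrite (Iser_man _ _ _ _ _ I1 (SL3_nbar x) p1 p2 p3 bb) (Iser_man _ _ _ _ _ I2 (SL3_nbar x) p1 p2 p3 bb).
  by congr (_ * _); exact: E.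
(* The open cell is dense: this curve through [g] leaves it only at zeros of a polynomial. *)
pose n (u : 'rV[R]_1) : 'M[R]_3 := nplus (u 0 0) (u 0 0) (u 0 0 * u 0 0 / 2%:R) * g.
have n0 : n 0 = g by rewrite /n mxE !mul0r nplus0 mul1r.
have sn u : SL3 (n u) := SL3M (SL3_nplus _ _ _) sg.
have oT := @openT ('rV[R]_1).
have Cn N i j : Ck N setT (fun u => n u i j).
  apply: (Ck_mulmx oT) => [{}i {}j|{}i {}j]; last exact: Ck_cst.
  by apply: (Ck_M3 oT); solve_Ck.
have s1 := smooth_G_comp (Iser_smooth I1) sn Cn.
have s2 := smooth_G_comp (Iser_smooth I2) sn Cn.
pose m12 := g i0 i0 * g i1 i1 - g i0 i1 * g i1 i0.
pose m13 := g i0 i0 * g i2 i1 - g i0 i1 * g i2 i0.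
pose m23 := g i1 i0 * g i2 i1 - g i1 i1 * g i2 i0.
(* The factors are the leading minors of [n u], where [n u] is [exp (u (E_{1,2} + E_{2,3})) * g].
   Their coefficients run through the whole first column and through all minors of the first two
   columns, so neither factor is zero when the determinant is one. *)
pose p : {poly R} := ((g i0 i0)%:P + g i1 i0 *: 'X + (g i2 i0 / 2%:R) *: 'X^2) *
  (m12%:P + m13 *: 'X + (m23 / 2%:R) *: 'X^2).
have det : g i0 i2 * m23 - g i1 i2 * m13 + g i2 i2 * m12 = 1.
  by move: sg; rewrite /SL3 {1}[g]M3_eta det_M3 => <-; rewrite /m12 /m13 /m23; ring.
have det' : g i0 i0 * (g i1 i1 * g i2 i2 - g i1 i2 * g i2 i1) - g i1 i0 * (g i0 i1 * g i2 i2 - g i0 i2 * g i2 i1)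
   + g i2 i0 * (g i0 i1 * g i1 i2 - g i0 i2 * g i1 i1) = 1.
  by move: sg; rewrite /SL3 {1}[g]M3_eta det_M3 => <-; ring.
have p0 : p != 0.
  apply: mulf_neq0; apply: poly_nz.
    apply: contraT; rewrite !negb_or !negbK => /and3P[/eqP a0 /eqP b0 /eqP c0].
    by move: det'; rewrite a0 b0 c0 !mul0r subr0 addr0 => /eqP; rewrite eq_sym oner_eq0.
  apply: contraT; rewrite !negb_or !negbK => /and3P[/eqP a0 /eqP b0 /eqP c0].
  by move: det; rewrite a0 b0 c0 !mulr0 subr0 addr0 => /eqP; rewrite eq_sym oner_eq0.
have nz (u : 'rV[R]_1) : p.[u 0 0] != 0 -> f1 (n u) - f2 (n u) = 0.
  rewrite /p hornerM mulf_eq0 negb_or !hornerE => /andP[q1 q2].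
  apply/eqP; rewrite subr_eq0; apply/eqP; apply: cell => //.
    move: q1; rewrite /n [g]M3_eta nplusE M3_mul !mxE /=; congr (_ != 0).
    by move: (u 0 0) (g _ _) (g _ _) (g _ _) => t a b c; field.
  move: q2; rewrite /n /m12 /m13 /m23 [g in nplus _ _ _ * g]M3_eta nplusE M3_mul !mxE /=; congr (_ != 0).
  move: (u 0 0) (g i0 i0) (g i0 i1) (g i1 i0) (g i1 i1) (g i2 i0) (g i2 i1) => t a1 a2 a3 a4 a5 a6.
  by field.
have [c1 c2] := Ck_smooth_cont (smoothB s1 s2) (I : setT 0).
apply/eqP; rewrite -subr_eq0 -n0; apply/eqP; apply: complex_ext.
  by apply: (continuous_poly_zero c1 p0) => u /nz ->.
by apply: (continuous_poly_zero c2 p0) => u /nz ->.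
Qed.

Definition NopP (P : seq (C * (nat * nat * nat))) F : 'rV[R]_3 -> C := fun x => Pdd P (F \o hmul x).

Lemma fP_nbar P f x : fP P f (nbar x) = NopP P (res f) x.
Proof. by apply: eq_Pdd => y; rewrite trans_nbar. Qed.

(** [fP P f] serves as the image. Any other image agrees with it by [Iser_ext], and equivariance is
    then associativity, as [fP] only multiplies its argument on the right. *)
Theorem DiffG_of_annihilates P lam e k l (D : diffop R) : annihilates P lam -> bihomogeneous P k l ->
  diffop_wf D -> (forall F, smooth3 F -> forall x, dapply D F x = NopP P F x) ->
  DiffG e lam (shift_sgn e k l) (shift_wt lam k l) D.
Proof.
move=> aP bP wD HD; split=> //; split.
  move=> f If; exists (fP P f); split; first exact: Iser_fP.
  move=> x; rewrite HD; last exact: smooth_res (Iser_smooth If).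
  exact: fP_nbar.
move=> f f' If If' E g sg x; have sf := Iser_smooth If.
have Eg h : SL3 h -> f' h = fP P f h.
  apply: (Iser_ext If' (Iser_fP If aP bP)) => y.
  by rewrite E HD; [rewrite -fP_nbar|exact: smooth_res].
have sgi := SL3_inv sg.
rewrite HD; last exact: (smooth_trans sf sgi).
rewrite res_ltr /trans (Eg _ (SL3M sgi (SL3_nbar x))).
by apply: eq_Pdd => y; rewrite /trans /= /res /ltr nbar_hmul mulrA.
Qed.

End Intertwining.

(** * Jets of elements of the principal series *)

Section Jets.
Variable R : realType.
Notation C := (R[i]).
Notation e_ := (ebasis R).
Notation i0 := (0 : 'I_3).
Notation i1 := (1 : 'I_3).
Notation i2 := (2%:R : 'I_3).
Implicit Types (F G : 'rV[R]_3 -> C).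

(** Functions flat to order [N] form an ideal; by linearity, multiplication by a smooth function
    respects equality of jets. *)
Lemma ipd_mul_flat n (phi H : 'rV[R]_n -> C) x N : smooth_on setT phi -> smooth_on setT H ->
  (forall w, (size w <= N)%N -> ipd w H x = 0) ->
  forall w, (size w <= N)%N -> ipd w (fun y => phi y * H y) x = 0.
Proof.
elim: N phi H => [|N IH] phi H sphi sH H0 w wN; have Hx : H x = 0 := H0 [::] isT.
  by move: wN; rewrite leqn0 size_eq0 => /eqP -> /=; rewrite Hx mulr0.
case/lastP: w wN => [|w i] wN; first by rewrite /= Hx mulr0.
rewrite size_rcons ltnS in wN.
have E : pd i (fun y => phi y * H y) = (fun y => pd i phi y * H y + phi y * pd i H y).
  by apply/funext => y; rewrite (pdM i sphi sH (I : setT y)).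
have sp := smooth_pd i sphi; have sp' := smooth_pd i sH.
rewrite ipd_rcons E (ipdD w (smoothM sp sH) (smoothM sphi sp') (I : setT x)).
rewrite (IH _ _ sp sH) //; last by move=> v vN; apply: H0; exact: leqW.
rewrite (IH _ _ sphi sp') ?addr0 // => v vN.
by rewrite -ipd_rcons; apply: H0; rewrite size_rcons.
Qed.

Lemma ipd_mul_jet n (phi F G : 'rV[R]_n -> C) x N : smooth_on setT phi ->
  smooth_on setT F -> smooth_on setT G ->
  (forall w, (size w <= N)%N -> ipd w F x = ipd w G x) ->
  forall w, (size w <= N)%N -> ipd w (fun y => phi y * F y) x = ipd w (fun y => phi y * G y) x.
Proof.
move=> sp sF sG FG w wN; apply/eqP; rewrite -subr_eq0.
have N1 (K : 'rV[R]_n -> C) v : smooth_on setT K -> ipd v (fun y => -1 * K y) x = - ipd v K x.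
  by move=> sK; rewrite (ipdZ (-1) v sK (I : setT x)) mulN1r.
rewrite -(N1 _ _ (smoothM sp sG)) -(ipdD w (smoothM sp sF) (smoothZ (-1) (smoothM sp sG)) (I : setT x)).
rewrite (_ : (fun y => _) = (fun y => phi y * (F y + -1 * G y))); last first.
  by apply/funext => y; rewrite mulrDr [phi y * (-1 * _)]mulrCA.
apply/eqP; apply: (ipd_mul_flat sp (smoothD sF (smoothZ (-1) sG)) _ wN) => v vN.
by rewrite (ipdD v sF (smoothZ (-1) sG) (I : setT x)) N1 // FG // subrr.
Qed.

Section Monomials.
Variable x : 'rV[R]_3.

Definition monom (a b c : nat) : 'rV[R]_3 -> C := fun y =>
  RC ((y 0 i0 - x 0 i0) ^+ a * (y 0 i1 - x 0 i1) ^+ b * (y 0 i2 - x 0 i2) ^+ c).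

Lemma is_derive_powB (y v : 'rV[R]_3) j n :
  is_derive y v (fun y => (y 0 j - x 0 j) ^+ n) (n%:R * (y 0 j - x 0 j) ^+ n.-1 * v 0 j).
Proof.
elim: n => [|n IH].
  by rewrite !mul0r; exact: is_derive_cst.
apply: (@is_derive_fun_eq _ _ _ _ (fun y : 'rV[R]_3 => (y 0 j + - x 0 j) * (y 0 j - x 0 j) ^+ n)).
  by move=> z; rewrite exprS.
apply: (is_derive_eqd (is_derive_mulf (is_derive_addf (is_derive_coord _ _ _) (is_derive_cst _ _ _)) IH)).
move: (y 0 j + - x 0 j) (v 0 j) => u c {IH}; case: n => [|n] /=; first by rewrite expr0; ring.
by rewrite exprS -!natr1; ring.
Qed.

Lemma smooth_monom a b c : smooth3 (monom a b c).
Proof.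
have CX N j n : Ck N setT (fun y : 'rV[R]_3 => (y 0 j - x 0 j) ^+ n).
  elim: n => [|n IH]; first by apply: Ck_cst; exact: openT.
  apply: (@Ck_eq _ _ _ _ (fun y : 'rV[R]_3 => (y 0 j - x 0 j) * (y 0 j - x 0 j) ^+ n) _ openT).
    by move=> y _; rewrite exprS.
  by apply: (CkM openT) => //; solve_Ck.
by apply: smooth_RC => [|N]; [exact: openT|do 2?apply: (CkM openT)].
Qed.

Lemma pd_monom a b c j y : pd j (monom a b c) y =
  (if j == i0 then a%:R * monom a.-1 b c y else if j == i1 then b%:R * monom a b.-1 c y
   else c%:R * monom a b c.-1 y).
Proof.
apply: is_cderive_pd.
have := is_cderive_RC (is_derive_mulf (is_derive_mulf (is_derive_powB y (e_ j) i0 a)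
  (is_derive_powB y (e_ j) i1 b)) (is_derive_powB y (e_ j) i2 c)).
congr (is_cderive _ _ _ _); rewrite !mxE /monom.
move: (y 0 i0 - x 0 i0) (y 0 i1 - x 0 i1) (y 0 i2 - x 0 i2) => u1 u2 u3.
by case: (ord3P j) => -> /=; rewrite -RC_nat -RCM; congr RC; ring.
Qed.

Transparent dd.
Lemma dd_monom p q r a b c y : dd p q r (monom a b c) y =
  (a ^_ p * b ^_ q * c ^_ r)%:R * monom (a - p) (b - q) (c - r) y.
Proof.
rewrite /dd !ipd_cat; set w0 := nseq p _; set w1 := nseq q _; set w2 := nseq r _.
have E2 : ipd w2 (monom a b c) = (fun y => (c ^_ r)%:R * monom a b (c - r) y).
  rewrite /w2; elim: r {w2} => [|r IH] /=; first by apply/funext => z; rewrite subn0 mul1r.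
  rewrite IH; apply/funext => z; rewrite (pdZ _ _ (smooth_monom _ _ _) (I : setT z)) pd_monom /=.
  by rewrite ffactnSr subnS natrM mulrA.
have E1 m : ipd w1 (monom a b m) = (fun y => (b ^_ q)%:R * monom a (b - q) m y).
  rewrite /w1; elim: q {w1} => [|q IH] /=; first by apply/funext => z; rewrite subn0 mul1r.
  rewrite IH; apply/funext => z; rewrite (pdZ _ _ (smooth_monom _ _ _) (I : setT z)) pd_monom /=.
  by rewrite ffactnSr subnS natrM mulrA.
have E0 m m' : ipd w0 (monom a m m') = (fun y => (a ^_ p)%:R * monom (a - p) m m' y).
  rewrite /w0; elim: p {w0} => [|p IH] /=; first by apply/funext => z; rewrite subn0 mul1r.
  rewrite IH; apply/funext => z; rewrite (pdZ _ _ (smooth_monom _ _ _) (I : setT z)) pd_monom /=.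
  by rewrite ffactnSr subnS natrM mulrA.
have L w k G z : smooth3 G -> ipd w (fun y => k * G y) z = k * ipd w G z.
  by move=> sG; rewrite (ipdZ k w sG (I : setT z)).
rewrite E2 (_ : ipd w1 _ = (fun y => (c ^_ r)%:R * ((b ^_ q)%:R * monom a (b - q) (c - r) y))); last first.
  by apply/funext => z; rewrite (L w1 _ _ _ (smooth_monom _ _ _)) E1.
rewrite (L w0 _ _ _ (smoothZ _ (smooth_monom _ _ _))) (L w0 _ _ _ (smooth_monom _ _ _)) E0.
by rewrite !natrM; ring.
Qed.
Opaque dd.

Lemma dd_monom_at p q r a b c : dd p q r (monom a b c) x =
  [&& a == p, b == q & c == r]%:R * (a`! * b`! * c`!)%:R.
Proof.
rewrite dd_monom /monom !subrr RCM RCM !RCX RC0.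
have K n m : (n ^_ m)%:R * 0 ^+ (n - m) = (n == m)%:R * n`!%:R :> C.
  case: (ltngtP n m) => [nm|mn|->].
  - by rewrite ffact_small // !mul0r.
  - by rewrite expr0n subn_eq0 leqNgt mn mulr0 mul0r.
  by rewrite subnn ffactnn expr0 mulr1 mul1r.
rewrite !natrM; transitivity (((a ^_ p)%:R * 0 ^+ (a - p)) * ((b ^_ q)%:R * 0 ^+ (b - q)) * ((c ^_ r)%:R * 0 ^+ (c - r)) : C).
  by ring.
rewrite !K; case: (a == p); case: (b == q); case: (c == r); rewrite /= ?mul0r ?mulr0 ?mul1r ?mul0r //.
Qed.

(** The truncation is by a box of exponents, not by total degree: three independent sums are
    simpler, and the box contains every multi-index of order at most [N]. *)
Definition taylor N G : 'rV[R]_3 -> C := fun y =>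
  \sum_(a < N.+1) \sum_(b < N.+1) \sum_(c < N.+1)
    dd a b c G x / (a`! * b`! * c`!)%:R * monom a b c y.

Lemma smooth_taylor N G : smooth3 (taylor N G).
Proof.
apply: smooth_sum => [|a]; first exact: openT.
apply: smooth_sum => [|b]; first exact: openT.
apply: smooth_sum => [|c]; first exact: openT.
exact/smoothZ/smooth_monom.
Qed.

Lemma fact3_neq0 a b c : (a`! * b`! * c`!)%:R != 0 :> C.
Proof. by rewrite pnatr_eq0 -lt0n !muln_gt0 !fact_gt0. Qed.

Lemma taylor_jet N G w : smooth3 G -> (size w <= N)%N -> ipd w (taylor N G) x = ipd w G x.
Proof.
move=> sG wN; rewrite (dd_word _ _ sG) (dd_word _ _ (smooth_taylor N G)).
have cw i : (count_mem i w < N.+1)%N by rewrite ltnS (leq_trans (count_size _ _)).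
set p := count_mem i0 w; set q := count_mem i1 w; set r := count_mem i2 w.
have oT := @openT ('rV[R]_3).
pose K (a b c : nat) y := dd a b c G x / (a`! * b`! * c`!)%:R * monom a b c y.
have sK a b c : smooth3 (K a b c) := smoothZ _ (smooth_monom a b c).
have sK2 a b : smooth3 (fun y => \sum_(c < N.+1) K a b c y) := smooth_sum _ _ oT (fun c => sK a b _).
have sK1 a : smooth3 (fun y => \sum_(b < N.+1) \sum_(c < N.+1) K a b c y) :=
  smooth_sum _ _ oT (fun b => sK2 a _).
have ES (n : nat) (H : 'I_n -> 'rV[R]_3 -> C) : (forall i, smooth3 (H i)) ->
    dd p q r (fun y => \sum_i H i y) x = \sum_i dd p q r (H i) x.
  by move=> sH; exact: (ipd_sum _ _ _ oT sH I).
transitivity (\sum_(a < N.+1) \sum_(b < N.+1) \sum_(c < N.+1) dd p q r (K a b c) x).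
  apply: etrans (ES _ (fun a : 'I_N.+1 => _) (fun a => sK1 a)) _; apply: eq_bigr => a _.
  apply: etrans (ES _ (fun b : 'I_N.+1 => _) (fun b => sK2 a b)) _; apply: eq_bigr => b _.
  exact: (ES _ (fun c : 'I_N.+1 => _) (fun c => sK a b c)).
have KE (a b c : nat) : dd p q r (K a b c) x = [&& a == p, b == q & c == r]%:R * dd p q r G x.
  rewrite [LHS](ddZ _ _ _ _ _ (smooth_monom a b c)) dd_monom_at mulrCA.
  case: and3P => [[/eqP -> /eqP -> /eqP ->]|_]; last by rewrite !mul0r.
  by rewrite divfK // fact3_neq0.
under eq_bigr do under eq_bigr do under eq_bigr do rewrite KE.
rewrite (bigD1 (Ordinal (cw i0))) //= [X in _ + X]big1 ?addr0; last first.
  move=> a ap; rewrite big1 // => b _; rewrite big1 // => c _.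
  have -> : (a == p :> nat) = false by apply: negbTE; apply: contra ap => /eqP E; apply/eqP/val_inj.
  by rewrite /= mul0r.
rewrite (bigD1 (Ordinal (cw i1))) //= [X in _ + X]big1 ?addr0; last first.
  move=> b bq; rewrite big1 // => c _.
  have -> : (b == q :> nat) = false by apply: negbTE; apply: contra bq => /eqP E; apply/eqP/val_inj.
  by rewrite andbF mul0r.
rewrite (bigD1 (Ordinal (cw i2))) //= [X in _ + X]big1 ?addr0; last first.
  move=> c cr; have -> : (c == r :> nat) = false by apply: negbTE; apply: contra cr => /eqP E; apply/eqP/val_inj.
  by rewrite !andbF mul0r.
by rewrite !eqxx /= mul1r.
Qed.

End Monomials.
End Jets.

(** * Test functions with prescribed jets in the principal series *)

Section TestFunctions.
Variable R : realType.
Notation C := (R[i]).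
Notation i0 := (0 : 'I_3).
Notation i1 := (1 : 'I_3).
Notation i2 := (2%:R : 'I_3).
Implicit Types (F : 'rV[R]_3 -> C) (f : 'M[R]_3 -> C) (lam : C * C) (g : 'M[R]_3).

Definition minor g (i j : 'I_3) : R := g i i0 * g j i1 - g i i1 * g j i0.

(** Equals the coordinate [y 0 i2] on [nbar y]: the second summand removes [y 0 i0 * y 0 i1 / 2]
    from the corner entry. It has degree one in the first column and one in the minors. *)
Definition hcoord g : R := g i2 i0 * minor g i0 i1 - g i1 i0 * minor g i0 i2 / 2%:R.

(** [normsq1] and [normsq2] are squared lengths of the first column and of the wedge of the first
    two columns. Both are positive on [SL3], and right multiplication by the upper triangular group
    scales them by squares, so their complex powers adjust the [A]-weight without affecting
    signs. *)
Definition normsq1 g : R := g i0 i0 * g i0 i0 + g i1 i0 * g i1 i0 + g i2 i0 * g i2 i0.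

Definition normsq2 g : R :=
  minor g i0 i1 * minor g i0 i1 + minor g i0 i2 * minor g i0 i2 + minor g i1 i2 * minor g i1 i2.

(** A monomial in [(B1 - x1 A1, B2 - x2 A2, C - x3 A1 A2)] padded by powers of
    [A1 = g_{11}] and [A2] (the leading [2 x 2] minor) to bidegree [(n1, n2)] in the
    first column and the minors of the first two columns. *)
Definition gmonom (x : 'rV[R]_3) (n1 n2 a b c : nat) g : R :=
  (g i1 i0 - x 0 i0 * g i0 i0) ^+ a * (minor g i0 i2 - x 0 i1 * minor g i0 i1) ^+ b
  * (hcoord g - x 0 i2 * (g i0 i0 * minor g i0 i1)) ^+ c
  * g i0 i0 ^+ (n1 - (a + c)) * minor g i0 i1 ^+ (n2 - (b + c)).

Lemma minor_upper g h1 h2 h3 u v w i j :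
  minor (g * M3 h1 u v 0 h2 w 0 0 h3) i j = h1 * h2 * minor g i j.
Proof.
rewrite /minor [X in X * M3 _ _ _ _ _ _ _ _ _](M3_eta g) M3_mul !mxE.
by case: (ord3P i) => ->; case: (ord3P j) => -> /=; ring.
Qed.

Lemma col0_upper g h1 h2 h3 u v w i :
  (g * M3 h1 u v 0 h2 w 0 0 h3) i i0 = h1 * g i i0.
Proof.
rewrite [X in X * M3 _ _ _ _ _ _ _ _ _](M3_eta g) M3_mul !mxE.
by case: (ord3P i) => -> /=; ring.
Qed.

Lemma gmonom_upper x n1 n2 a b c g h1 h2 h3 u v w : (a + c <= n1)%N -> (b + c <= n2)%N ->
  gmonom x n1 n2 a b c (g * M3 h1 u v 0 h2 w 0 0 h3) = h1 ^+ n1 * (h1 * h2) ^+ n2 * gmonom x n1 n2 a b c g.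
Proof.
move=> an bn; rewrite /gmonom /hcoord !minor_upper !col0_upper.
move: (g i0 i0) (g i1 i0) (g i2 i0) (minor g i0 i1) (minor g i0 i2) => g0 g1 g2 m1 m2.
move: (x 0 i0) (x 0 i1) (x 0 i2) => x0 x1 x2.
rewrite (_ : h1 * g1 - x0 * (h1 * g0) = h1 * (g1 - x0 * g0)); last by ring.
rewrite (_ : h1 * h2 * m2 - x1 * (h1 * h2 * m1) = h1 * h2 * (m2 - x1 * m1)); last by ring.
rewrite (_ : h1 * g2 * (h1 * h2 * m1) - h1 * g1 * (h1 * h2 * m2) / 2%:R - x2 * (h1 * g0 * (h1 * h2 * m1))
  = h1 * (h1 * h2) * (g2 * m1 - g1 * m2 / 2%:R - x2 * (g0 * m1))); last by field.
rewrite -{2}(subnKC an) -{2}(subnKC bn) !exprMn !exprD ?exprMn.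
ring.
Qed.

Lemma normsq1_upper g h1 h2 h3 u v w :
  normsq1 (g * M3 h1 u v 0 h2 w 0 0 h3) = h1 ^+ 2 * normsq1 g.
Proof. by rewrite /normsq1 !col0_upper; ring. Qed.

Lemma normsq2_upper g h1 h2 h3 u v w :
  normsq2 (g * M3 h1 u v 0 h2 w 0 0 h3) = (h1 * h2) ^+ 2 * normsq2 g.
Proof. by rewrite /normsq2 !minor_upper; ring. Qed.

Lemma normsq1_gt0 g : SL3 g -> 0 < normsq1 g.
Proof.
rewrite {1}[g]M3_eta /SL3 det_M3 /normsq1 => det.
rewrite lt_def !addr_ge0 ?andbT -?expr2 ?sqr_ge0 //.
rewrite !paddr_eq0 ?addr_ge0 ?sqr_ge0 // !sqrf_eq0; apply/negP => /andP[/andP[/eqP g0 /eqP g1] /eqP g2].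
by move: det; rewrite g0 g1 g2 => /eqP; rewrite (_ : _ + _ = 0) ?(eq_sym 0) ?oner_eq0 //; ring.
Qed.

Lemma normsq2_gt0 g : SL3 g -> 0 < normsq2 g.
Proof.
rewrite {1}[g]M3_eta /SL3 det_M3 /normsq2 => det.
rewrite lt_def !addr_ge0 ?andbT -?expr2 ?sqr_ge0 //.
rewrite !paddr_eq0 ?addr_ge0 ?sqr_ge0 // !sqrf_eq0; apply/negP => /andP[/andP[/eqP g0 /eqP g1] /eqP g2].
have : g i0 i2 * minor g i1 i2 - g i1 i2 * minor g i0 i2 + g i2 i2 * minor g i0 i1 = 1.
  by rewrite -det /minor; ring.
by rewrite g0 g1 g2 !mulr0 subr0 addr0 => /eqP; rewrite eq_sym oner_eq0.
Qed.

Definition cpow (q : R) (z : C) : C := cexp (z * RC (ln q)).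

Lemma cpow_scale (h q : R) (z : C) : 0 < h -> 0 < q -> cpow (h * q) z = cpow h z * cpow q z.
Proof. by move=> h0 q0; rewrite /cpow lnM ?posrE // RCD mulrDr cexpD. Qed.

Lemma cpow_sq_pm (b t : R) (z : C) : pm1 b -> cpow ((b * expR t) ^+ 2) z = cexp (2%:R * z * RC t).
Proof.
move=> pb; have -> : (b * expR t) ^+ 2 = expR (t + t).
  by rewrite exprMn !expr2 (pm1_sq pb) mul1r expRD.
by rewrite /cpow expRK RCD; congr cexp; ring.
Qed.

Definition parity (s : sgn) : nat := if s is Mi then 1 else 0.

Lemma pm1_parity (b : R) s n : pm1 b -> b ^+ (n + n + parity s) = sabs s b.
Proof.
move=> pb; rewrite exprD exprD -exprMn (pm1_sq pb) expr1n mul1r.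
by case: s => /=; rewrite ?expr1 // expr0; case: pb => ->; rewrite ?normrN normr1.
Qed.

Section TestFunction.
Variables (lam : C * C) (e : sgn * sgn) (N : nat) (x : 'rV[R]_3) (k : nat -> nat -> nat -> C).

(** Degrees of at least [2 N] leave room for the exponents [a + c] and [b + c], and being even up to
    [parity] they reproduce the signs of [chiM]. The powers [z1] and [z2] of the squared norms
    correct the remaining positive scaling to weight [- lam]. *)
Let n1 := (N + N + (N + N) + parity e.1)%N.
Let n2 := (N + N + (N + N) + parity e.2)%N.
Let z1 := - (lam.1 + n1%:R) / 2%:R.
Let z2 := - (lam.2 + n2%:R) / 2%:R.

Definition testf g : C :=
  (\sum_(a < N.+1) \sum_(b < N.+1) \sum_(c < N.+1) k a b c * RC (gmonom x n1 n2 a b c g))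
  * cpow (normsq1 g) z1 * cpow (normsq2 g) z2.

Lemma smooth_G_testf : smooth_G testf.
Proof.
pose U := [set v : 'rV[R]_(3 * 3) | 0 < normsq1 (vec_mx v)] `&` [set v | 0 < normsq2 (vec_mx v)].
have oT := @openT ('rV[R]_(3 * 3)).
have Ce K (V : set 'rV[R]_(3 * 3)) i j : open V -> Ck K V (fun v => vec_mx v i j).
  by move=> oV; apply: (Ck_eq oV _ (Ck_coord K (mxvec_index i j) oV)) => v _; rewrite mxE.
have Cm K (V : set 'rV[R]_(3 * 3)) i j : open V -> Ck K V (fun v => minor (vec_mx v) i j).
  by move=> oV; apply: (CkD oV); [|apply: (CkN oV)]; apply: (CkM oV); exact: Ce.
have C1 K V : open V -> Ck K V (fun v => normsq1 (vec_mx v)).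
  by move=> oV; apply: (CkD oV); [apply: (CkD oV)|]; apply: (CkM oV); exact: Ce.
have C2 K V : open V -> Ck K V (fun v => normsq2 (vec_mx v)).
  by move=> oV; apply: (CkD oV); [apply: (CkD oV)|]; apply: (CkM oV); exact: Cm.
have opos (h : 'rV[R]_(3 * 3) -> R) : Ck 0 setT h -> open [set v | 0 < h v].
  move=> ch; have := @open_comp _ _ h [set r | 0 < r] (fun v _ => Ck_cont ch (I : setT v)).
  by apply; exact: open_gt.
have oU : open U by apply: openI; apply: opos; [exact: C1|exact: C2].
have CX K (h : 'rV[R]_(3 * 3) -> R) m : Ck K U h -> Ck K U (fun v => h v ^+ m).
  move=> ch; elim: m => [|m IH]; first exact: Ck_cst.
  by apply: (@Ck_eq _ _ _ _ (fun v => h v * h v ^+ m)) => // [v _|]; [rewrite exprS|exact: CkM].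
exists U, (fun v => testf (vec_mx v)); split; last split.
- apply: smoothM; last by apply: smooth_power => // [v [_ ?]|K] //; exact: C2.
  apply: smoothM; last by apply: smooth_power => // [v [? _]|K] //; exact: C1.
  apply: smooth_sum => [|a]; first exact: oU.
  apply: smooth_sum => [|b]; first exact: oU.
  apply: smooth_sum => [|c]; first exact: oU.
  apply: smoothZ; apply: smooth_RC => [|K]; first exact: oU.
  have E i j := Ce K U i j oU; have M i j := Cm K U i j oU.
  rewrite /gmonom /hcoord.
  repeat first [exact: E | exact: M | exact: (Ck_cst _ _ oU) | apply: CX
    | apply: (CkD oU) | apply: (CkN oU) | apply: (CkM oU)].
- by move=> g sg; split => /=; rewrite mxvecK; [exact: normsq1_gt0|exact: normsq2_gt0].
by move=> g _; rewrite mxvecK.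
Qed.

Lemma RC_expn_cexp (t : R) n z : RC (expR t) ^+ n * cexp (2%:R * (- (z + n%:R) / 2%:R) * RC t) =
  cexp (- (z * RC t)).
Proof.
rewrite aexp_pow -cexpD; congr cexp; rewrite RCM RC_nat.
by field.
Qed.

Lemma Iser_testf : Iser lam e testf.
Proof.
split; first exact: smooth_G_testf.
move=> g b1 b2 b3 t1 t2 a b c sg p1 p2 p3 bb.
have gE : g * mdiag b1 b2 b3 * aexp t1 t2 * nplus a b c =
  g * M3 (b1 * expR t1) (b1 * expR t1 * a) (b1 * expR t1 * c) 0 (b2 * expR (t2 - t1)) (b2 * expR (t2 - t1) * b)
    0 0 (b3 * expR (- t2)).
  by rewrite -!mulrA; congr (_ * _); rewrite mdiagE aexpE nplusE !M3_mul; congr M3; ring.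
(* The minors scale by the product of the first two diagonal entries; [b1 * b2 = b3] matches this
   with the second factors of [chiM] and [chiA]. *)
have hh : b1 * expR t1 * (b2 * expR (t2 - t1)) = b3 * expR t2.
  rewrite mulrACA -expRD (_ : t1 + (t2 - t1) = t2); last by ring.
  by congr (_ * _); rewrite -[RHS]mul1r -bb -mulrA (pm1_sq p3) mulr1.
have hp (b' t : R) : pm1 b' -> 0 < (b' * expR t) ^+ 2.
  by move=> pb; rewrite exprn_even_gt0 //=; apply: mulf_neq0; [exact: pm1_neq0|rewrite gt_eqF ?expR_gt0].
rewrite {}gE /testf normsq1_upper normsq2_upper hh.
rewrite (cpow_scale z1 (hp b1 t1 p1) (normsq1_gt0 sg)) (cpow_scale z2 (hp b3 t2 p3) (normsq2_gt0 sg)).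
set S := (X in X * _ * _ = _); set S' := \sum_(a < N.+1) _.
have -> : S = RC ((b1 * expR t1) ^+ n1 * (b3 * expR t2) ^+ n2) * S'.
  rewrite /S /S' mulr_sumr; apply: eq_bigr => a' _.
  rewrite mulr_sumr; apply: eq_bigr => b' _.
  rewrite mulr_sumr; apply: eq_bigr => c' _.
  rewrite gmonom_upper ?hh.
  - by rewrite [RC (_ * gmonom _ _ _ _ _ _ _)]RCM mulrCA.
  - have := ltn_ord a'; have := ltn_ord c'; rewrite /n1; lia.
  - have := ltn_ord b'; have := ltn_ord c'; rewrite /n2; lia.
rewrite !cpow_sq_pm // chiMV // /chiM !exprMn (pm1_parity e.1 (N + N) p1) (pm1_parity e.2 (N + N) p3).
rewrite /chiA -cexpN opprD cexpD -(RC_expn_cexp t1 n1 lam.1) -(RC_expn_cexp t2 n2 lam.2).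
rewrite -/z1 -/z2 !RCM -!RCX.
move: (cpow _ z1) (cpow _ z2) (cexp _) (cexp _) S' => q1 q2 w1 w2 S'.
move: (RC (sabs _ _)) (RC (sabs _ _)) (RC (_ ^+ n1)) (RC (_ ^+ n2)) => s1 s2 s3 s4.
by ring.
Qed.

Let phi (y : 'rV[R]_3) : C := cpow (normsq1 (nbar y)) z1 * cpow (normsq2 (nbar y)) z2.

Lemma res_testf y : res testf y =
  phi y * \sum_(a < N.+1) \sum_(b < N.+1) \sum_(c < N.+1) k a b c * monom x a b c y.
Proof.
rewrite /res /testf -mulrA mulrC; congr (_ * _).
apply: eq_bigr => a _; apply: eq_bigr => b _; apply: eq_bigr => c _; congr (_ * RC _).
rewrite /gmonom /hcoord /minor nbarE !mxE /=.
move: (y 0 i0) (y 0 i1) (y 0 i2) (x 0 i0) (x 0 i1) (x 0 i2) => y0 y1 y2 x0 x1 x2.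
rewrite (_ : 1 * 1 - 0 * y0 = 1); last by ring.
rewrite (_ : 1 * y1 - 0 * _ = y1); last by ring.
by rewrite !mulr1 !expr1n !mulr1; congr (_ * _ * _ ^+ _); field.
Qed.

End TestFunction.

Lemma smooth_cpow_nbar (q : 'M[R]_3 -> R) z :
  (forall K, Ck K setT (fun y : 'rV[R]_3 => q (nbar y))) -> (forall g, SL3 g -> 0 < q g) ->
  smooth3 (fun y => cpow (q (nbar y)) z).
Proof.
move=> Cq q0; apply: smooth_power => //; first exact: openT.
by move=> y _; apply: q0; exact: SL3_nbar.
Qed.

Lemma Ck_nbar_id K i j : Ck K setT (fun y : 'rV[R]_3 => nbar y i j).
Proof. by apply: (Ck_nbar openT) => l; exact: (Ck_coord _ _ openT). Qed.

Lemma Ck_normsq1 K : Ck K setT (fun y : 'rV[R]_3 => normsq1 (nbar y)).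
Proof.
by apply: (CkD openT); [apply: (CkD openT)|]; apply: (CkM openT); exact: Ck_nbar_id.
Qed.

Lemma Ck_normsq2 K : Ck K setT (fun y : 'rV[R]_3 => normsq2 (nbar y)).
Proof.
have Cm i j : Ck K setT (fun y : 'rV[R]_3 => minor (nbar y) i j).
  by apply: (CkD openT); [|apply: (CkN openT)]; apply: (CkM openT); exact: Ck_nbar_id.
by apply: (CkD openT); [apply: (CkD openT)|]; apply: (CkM openT); exact: Cm.
Qed.

Lemma cpowNK q z : cpow q z * cpow q (- z) = 1.
Proof. by rewrite /cpow mulNr mulrC cexpNK. Qed.

(** Restrictions of [I(lam)] contain every polynomial times a fixed nowhere vanishing
    function, hence realize all jets of smooth functions. *)
Theorem Iser_jets lam e N F x : smooth3 F ->
  exists f, Iser lam e f /\ forall w, (size w <= N)%N -> ipd w (res f) x = ipd w F x.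
Proof.
move=> sF.
pose z1 := - (lam.1 + (N + N + (N + N) + parity e.1)%N%:R) / 2%:R.
pose z2 := - (lam.2 + (N + N + (N + N) + parity e.2)%N%:R) / 2%:R.
pose phi (y : 'rV[R]_3) := cpow (normsq1 (nbar y)) z1 * cpow (normsq2 (nbar y)) z2.
(* [psi] is the reciprocal of [phi]. The test function is [phi] times the Taylor polynomial of
   [psi * F], hence has the jet of [F]. *)
pose psi (y : 'rV[R]_3) := cpow (normsq1 (nbar y)) (- z1) * cpow (normsq2 (nbar y)) (- z2).
have sphi : smooth3 phi := smoothM (smooth_cpow_nbar z1 Ck_normsq1 normsq1_gt0)
  (smooth_cpow_nbar z2 Ck_normsq2 normsq2_gt0).
have spsi : smooth3 psi := smoothM (smooth_cpow_nbar (- z1) Ck_normsq1 normsq1_gt0)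
  (smooth_cpow_nbar (- z2) Ck_normsq2 normsq2_gt0).
have pp y : phi y * psi y = 1 by rewrite /phi /psi mulrACA !cpowNK mulr1.
have sG : smooth3 (fun y => psi y * F y) := smoothM spsi sF.
pose k a b c := dd a b c (fun y => psi y * F y) x / (a`! * b`! * c`!)%:R.
exists (testf lam e N x k); split; first exact: Iser_testf.
move=> w wN; rewrite (_ : res _ = (fun y => phi y * taylor x N (fun y => psi y * F y) y)); last first.
  by apply/funext => y; rewrite res_testf.
rewrite (ipd_mul_jet sphi (smooth_taylor x N _) sG (fun v vN => taylor_jet x sG vN) wN).
by congr (ipd w _ x); apply/funext => y; rewrite mulrA pp mul1r.
Qed.

End TestFunctions.

(** * Intertwining operators as singular vectors *)

Section Necessity.
Variable R : realType.
Notation C := (R[i]).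
Notation e_ := (ebasis R).
Notation i0 := (0 : 'I_3).
Notation i1 := (1 : 'I_3).
Notation i2 := (2%:R : 'I_3).
Implicit Types (F G : 'rV[R]_3 -> C) (f : 'M[R]_3 -> C) (lam nu : C * C) (g : 'M[R]_3).
Implicit Types (P : seq (C * (nat * nat * nat))) (D : diffop R).

Lemma ipd_hmul_jet F G x y N : smooth3 F -> smooth3 G ->
  (forall w, (size w <= N)%N -> ipd w F (hmul x y) = ipd w G (hmul x y)) ->
  forall w, (size w <= N)%N -> ipd w (F \o hmul x) y = ipd w (G \o hmul x) y.
Proof.
elim: N F G => [|N IH] F G sF sG FG w wN.
  by move: wN; rewrite leqn0 size_eq0 => /eqP ->; exact: (FG [::]).
case/lastP: w wN => [|w j] wN; first exact: (FG [::]).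
rewrite size_rcons ltnS in wN.
pose k := RC ((x 0 i1 * (j == i0)%:R - x 0 i0 * (j == i1)%:R) / 2%:R).
pose L H : 'rV[R]_3 -> C := fun z => pd j H z + k * pd i2 H z.
have sL H : smooth3 H -> smooth3 (L H).
  by move=> sH; exact: smoothD (smooth_pd j sH) (smoothZ k (smooth_pd i2 sH)).
have EL H : smooth3 H -> pd j (H \o hmul x) = L H \o hmul x.
  by move=> sH; apply/funext => z; rewrite (pd_hmulr j x z sH).
have JL H v z : smooth3 H -> ipd v (L H) z = ipd (rcons v j) H z + k * ipd (rcons v i2) H z.
  move=> sH; rewrite !ipd_rcons (ipdD v (smooth_pd j sH) (smoothZ k (smooth_pd i2 sH)) (I : setT z)).
  by rewrite (ipdZ k v (smooth_pd i2 sH) (I : setT z)).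
rewrite (ipd_rcons w j (F \o hmul x)) (ipd_rcons w j (G \o hmul x)) (EL F sF) (EL G sG).
apply: (IH _ _ (sL F sF) (sL G sG)) => //.
by move=> v vN; rewrite (JL F) // (JL G) // !FG ?size_rcons.
Qed.

Definition order_le P N := forall t, t \in P -> (t.2.1.1 + t.2.1.2 + t.2.2 <= N)%N.

Lemma ex_order_le P : exists N, order_le P N.
Proof.
exists (\max_(t <- P) (t.2.1.1 + t.2.1.2 + t.2.2))%N => t tP.
exact: (@leq_bigmax_seq _ _ xpredT (fun t : C * (nat * nat * nat) => t.2.1.1 + t.2.1.2 + t.2.2)%N).
Qed.

Transparent dd.
Lemma dd_jet a b c F G x N : (a + b + c <= N)%N ->
  (forall w, (size w <= N)%N -> ipd w F x = ipd w G x) -> dd a b c F x = dd a b c G x.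
Proof. by move=> abc; apply; rewrite !size_cat !size_nseq addnA. Qed.
Opaque dd.

Lemma eq_in_Pdd P F G :
  (forall t, t \in P -> dd t.2.1.1 t.2.1.2 t.2.2 F 0 = dd t.2.1.1 t.2.1.2 t.2.2 G 0) -> Pdd P F = Pdd P G.
Proof. by move=> FG; rewrite /Pdd big_seq [RHS]big_seq; apply: eq_bigr => t /FG ->. Qed.

Lemma Pdd_jet P F G N : order_le P N ->
  (forall w, (size w <= N)%N -> ipd w F 0 = ipd w G 0) -> Pdd P F = Pdd P G.
Proof.
by move=> oP FG; apply: eq_in_Pdd => t /oP tN; exact: dd_jet tN FG.
Qed.

Lemma NopP_jet P F G x N : order_le P N -> smooth3 F -> smooth3 G ->
  (forall w, (size w <= N)%N -> ipd w F x = ipd w G x) -> NopP P F x = NopP P G x.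
Proof.
move=> oP sF sG FG; apply: (Pdd_jet oP) => w wN.
by apply: (ipd_hmul_jet sF sG _ wN); rewrite hmulx0.
Qed.

(** Order [N.+1] covers boundary indices such as [c = 0], where [c.-1] truncates and the formula of
    [dd_pi1] names a derivative of order one higher, with coefficient zero. *)
Lemma dd_pi1_jet lam a b c F G N : (a + b + c <= N)%N -> smooth3 F -> smooth3 G ->
  (forall w, (size w <= N.+1)%N -> ipd w F 0 = ipd w G 0) ->
  dd a b c (pi1 lam F) 0 = dd a b c (pi1 lam G) 0.
Proof.
move=> abc sF sG FG; rewrite (dd_pi1 _ _ _ _ sF) (dd_pi1 _ _ _ _ sG).
have J p q r : (p + q + r <= N.+1)%N -> dd p q r F 0 = dd p q r G 0 by move=> h; exact: dd_jet h FG.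
by congr (_ * _ - _ * _ - _ * _); apply: J; rewrite -!subn1; lia.
Qed.

Lemma dd_pi2_jet lam a b c F G N : (a + b + c <= N)%N -> smooth3 F -> smooth3 G ->
  (forall w, (size w <= N.+1)%N -> ipd w F 0 = ipd w G 0) ->
  dd a b c (pi2 lam F) 0 = dd a b c (pi2 lam G) 0.
Proof.
move=> abc sF sG FG; rewrite (dd_pi2 _ _ _ _ sF) (dd_pi2 _ _ _ _ sG).
have J p q r : (p + q + r <= N.+1)%N -> dd p q r F 0 = dd p q r G 0 by move=> h; exact: dd_jet h FG.
by congr (_ * _ + _ * _ + _ * _); apply: J; rewrite -!subn1; lia.
Qed.

Definition jet0 D : seq (C * (nat * nat * nat)) :=
  [seq (p.1 0, (count_mem i0 p.2, count_mem i1 p.2, count_mem i2 p.2)) | p <- D].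

Lemma Pdd_jet0 D F : smooth3 F -> Pdd (jet0 D) F = dapply D F 0.
Proof. by move=> sF; rewrite /Pdd big_map; apply: eq_bigr => p _; rewrite -dd_word. Qed.

Lemma dapply_jet D F G x : exists N,
  forall F G, (forall w, (size w <= N)%N -> ipd w F x = ipd w G x) -> dapply D F x = dapply D G x.
Proof.
exists (\max_(p <- D) size p.2)%N => F' G' FG; rewrite /dapply big_seq [RHS]big_seq.
apply: eq_bigr => p pD; rewrite FG //.
exact: (@leq_bigmax_seq _ _ xpredT (fun p : ('rV[R]_3 -> C) * seq 'I_3 => size p.2)).
Qed.

Section Coefficients.
Variable P : seq (C * (nat * nat * nat)).

(** [P] may repeat a multi-index, and repeated terms may cancel; only these totals are determined by
    the functional. *)
Definition coef (s : nat * nat * nat) : C := \sum_(t <- P | t.2 == s) t.1.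

Lemma sum_coef (X : nat * nat * nat -> C) (S : seq (nat * nat * nat)) : uniq S ->
  (forall t, t \in P -> t.2 \notin S -> coef t.2 = 0) ->
  \sum_(t <- P) t.1 * X t.2 = \sum_(s <- S) coef s * X s.
Proof.
move=> uS PS; pose T := undup (S ++ [seq t.2 | t <- P]).
transitivity (\sum_(s <- T) coef s * X s).
  under [RHS]eq_bigr do rewrite /coef mulr_suml big_mkcond.
  rewrite exchange_big big_seq [RHS]big_seq; apply: eq_bigr => t tP /=.
  rewrite (bigD1_seq t.2) ?undup_uniq //=; last by rewrite mem_undup mem_cat map_f ?orbT.
  by rewrite eqxx big1 ?addr0 // => s; rewrite eq_sym => /negbTE ->.
rewrite (bigID (mem S)) /= [X in _ + X]big1_seq ?addr0; last first.
  move=> s /andP[sS]; rewrite mem_undup mem_cat (negbTE sS) => /mapP[t tP st].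
  by rewrite st PS ?mul0r // -st.
rewrite -big_filter; apply: perm_big; apply: uniq_perm => //; first exact/filter_uniq/undup_uniq.
by move=> s; rewrite mem_filter mem_undup mem_cat; case: (s \in S).
Qed.

(** Centred monomials are dual, up to factorials, to the partials at the origin, so coefficients can
    be read off by testing. *)
Lemma Pdd_monom a b c : Pdd P (monom 0 a b c) = coef (a, b, c) * (a`! * b`! * c`!)%:R.
Proof.
rewrite /Pdd /coef mulr_suml [RHS]big_mkcond; apply: eq_bigr => t _.
rewrite dd_monom_at; case: t => t1 [[p q] r] /=.
rewrite !xpair_eqE (eq_sym a) (eq_sym b) (eq_sym c) -andbA.
by case: ifP => _; rewrite ?mul1r // mul0r mulr0.
Qed.

End Coefficients.

(** The exponent is recovered as the derivative at [t = 0], which avoids complex logarithms. *)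
Lemma cexp_line_inj (z w : C) : (forall t : R, cexp (z * RC t) = cexp (w * RC t)) -> z = w.
Proof.
move=> zw.
have H (v : C) : pd 0 (fun u : 'rV[R]_1 => cexp (v * RC (u 0 0))) 0 = v.
  have := @is_cderive_pd R 1 0 0 _ _ (is_cderive_cexp v (is_derive_coord 0 (e_ 0) 0)).
  by rewrite !mxE eqxx RC1 mulr1 RC0 mulr0 cexp0 mulr1.
by rewrite -(H z) -[RHS]H; congr (pd 0 _ 0); apply/funext => u; exact: zw.
Qed.

Lemma chiA_inj lam nu : (forall t1 t2, chiA lam t1 t2 = chiA nu t1 t2) -> lam = nu.
Proof.
case: lam nu => [l1 l2] [n1 n2] E.
have E1 : l1 = n1.
  by apply: cexp_line_inj => t; have := E t 0; rewrite /chiA /= RC0 !mulr0 !addr0.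
have E2 : l2 = n2.
  by apply: cexp_line_inj => t; have := E 0 t; rewrite /chiA /= RC0 !mulr0 !add0r.
by rewrite E1 E2.
Qed.

Lemma sabsN1_inj (s s' : sgn) : sabs s (-1 : R) = sabs s' (-1) -> s = s'.
Proof.
have n1 : (1 : R) <> -1 by move=> /eqP; rewrite -subr_eq0 opprK -[1 + 1]/(2%:R) pnatr_eq0.
by case: s; case: s' => //=; rewrite normrN normr1 => // /esym.
Qed.

Lemma chiM_inj (d d' : sgn * sgn) :
  (forall b1 b2 b3 : R, pm1 b1 -> pm1 b2 -> pm1 b3 -> b1 * b2 * b3 = 1 ->
     chiM d b1 b2 b3 = chiM d' b1 b2 b3) -> d = d'.
Proof.
have p1 : pm1 (1 : R) by left. have pN : pm1 (-1 : R) by right.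
have s1 s : sabs s (1 : R) = 1 by case: s; rewrite //= normr1.
case: d d' => [d1 d2] [d1' d2'] E.
have := E (-1) (-1) 1 pN pN p1; have := E 1 (-1) (-1) p1 pN pN.
rewrite /chiM /= !s1 !mulr1 !mul1r mulrNN mulr1 => /(_ erefl) [] /sabsN1_inj -> /(_ erefl) [].
by move=> /sabsN1_inj ->.
Qed.

Lemma res_ltrV f g : res (ltr (invmx g) f) = trans f g.
Proof. by apply/funext => x; rewrite res_ltr invmxK. Qed.

(** [P] freezes the coefficients of [D] at the origin. Since [Iser_jets] realizes every finite jet,
    statements about elements of [I(lam)] become statements about all smooth functions. *)
Theorem DiffG_coef e lam d nu D : DiffG e lam d nu D -> exists P,
  [/\ annihilates P lam,
      forall F, smooth3 F -> forall x, dapply D F x = NopP P F x &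
      forall a b c, coef P (a, b, c) != 0 ->
        nu = shift_wt lam (a + c) (b + c) /\ d = shift_sgn e (a + c) (b + c)].
Proof.
move=> [wD [D2 D3]]; pose P := jet0 D; exists P.
have S1 : SL3 (1 : 'M[R]_3) by rewrite /SL3 det1.
have P2 f : Iser lam e f -> Iser nu d (fP P f).
  move=> If; have [f' [If' rf']] := D2 f If.
  (* Equivariance evaluated at [x = 0] determines the image at every [g] from the jet of a
     translate; hence [fP P f] itself lies in [I(nu)]. *)
  have E g : SL3 g -> f' g = fP P f g.
    move=> sg; have := D3 f f' If If' rf' _ (SL3_inv sg) 0.
    rewrite !res_ltr invmxK /trans nbar0 mulr1 => ->.
    by rewrite res_ltrV; exact: esym (Pdd_jet0 _ (smooth_trans (Iser_smooth If) sg)).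
  split; first exact: smooth_fP (Iser_smooth If).
  move=> g b1 b2 b3 t1 t2 a b c sg q1 q2 q3 bb; rewrite -!E //; first by apply: (proj2 If').
  apply: SL3M (SL3_nplus _ _ _); apply: SL3M (SL3_aexp _ _); exact: SL3M sg (SL3_mdiag bb).
have [N oP] := ex_order_le P.
split.
- move=> F sF.
  have [f [If Jf]] := Iser_jets lam e N.+1 0 sF; have sf := Iser_smooth If.
  (* Elements of [I(nu)] are right invariant under [N_+], so the curve is constant and its
     derivative zero. *)
  have c0 (a b : R) : Pdd P (fun y : 'rV[R]_3 => pd 0 (fun u : 'rV[R]_1 => trans f (1 * nexpp a b (u 0 0)) y) 0) = 0.
    rewrite -(pd_fP P a b sf S1) (_ : (fun u => _) = fun=> fP P f 1).
      by apply: is_cderive_pd; exact: is_cderive_cst.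
    by apply/funext => u; exact: (Iser_nplus _ _ _ (P2 f If) S1).
  have sr := smooth_res sf.
  have := c0 1 0; have := c0 0 1.
  rewrite (_ : (fun y => _) = pi2 lam (res f)); last first.
    by apply/funext => y; rewrite (pd_nexpp2 _ If S1) trans1.
  rewrite (_ : (fun y => _) = pi1 lam (res f)); last first.
    by apply/funext => y; rewrite (pd_nexpp1 _ If S1) trans1.
  move=> z2 z1; split.
    by apply: etrans z1; apply: eq_in_Pdd => t /oP tN; exact: esym (dd_pi1_jet lam tN sr sF Jf).
  by apply: etrans z2; apply: eq_in_Pdd => t /oP tN; exact: esym (dd_pi2_jet lam tN sr sF Jf).
- move=> F sF x; have [N' DJ] := dapply_jet D F F x.
  have [f [If Jf]] := Iser_jets lam e (N + N') x sF.
  rewrite (DJ _ (res f)); last by move=> w wN; rewrite Jf // (leq_trans wN) ?leq_addl.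
  rewrite (NopP_jet (G := res f) oP sF (smooth_res (Iser_smooth If))); last first.
    by move=> w wN; rewrite Jf // (leq_trans wN) ?leq_addr.
  rewrite -fP_nbar; have [f' [If' rf']] := D2 f If; rewrite -rf' /res.
  have := D3 f f' If If' rf' _ (SL3_inv (SL3_nbar x)) 0.
  rewrite !res_ltr invmxK /trans nbar0 mulr1 => ->.
  by rewrite res_ltrV; exact: esym (Pdd_jet0 _ (smooth_trans (Iser_smooth If) (SL3_nbar x))).
move=> a b c abc.
(* A function with the jet of one monomial isolates one coefficient. The action of [MA] on [fP P f]
   at [1] is then known both through [nu], [d] and through the scaling of that monomial. *)
have [f [If Jf]] := Iser_jets lam e N.+1 0 (smooth_monom 0 a b c).
have Pf : fP P f 1 = coef P (a, b, c) * (a`! * b`! * c`!)%:R.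
  rewrite -Pdd_monom /fP trans1; apply: (Pdd_jet oP) => w wN; rewrite Jf //.
  exact: leqW.
have nz : fP P f 1 != 0 by rewrite Pf mulf_neq0 ?fact3_neq0.
have E b1 b2 b3 t1 t2 : pm1 b1 -> pm1 b2 -> pm1 b3 -> b1 * b2 * b3 = 1 ->
    chiM d b1 b2 b3 * chiA nu t1 t2 =
    chiM (shift_sgn e (a + c) (b + c)) b1 b2 b3 * chiA (shift_wt lam (a + c) (b + c)) t1 t2.
  move=> p1 p2 p3 bb; apply: invr_inj; rewrite (invfM (chiM _ _ _ _)) (invfM (chiM (shift_sgn _ _ _) _ _ _)); apply: (mulIf nz).
  have := Iser_man t1 t2 0 0 0 (P2 f If) S1 p1 p2 p3 bb.
  rewrite nplus0 mulr1. move=> <-; rewrite (fP_ma _ _ _ If S1 p1 p2 p3 bb).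
  rewrite Pf /coef !mulr_suml mulr_sumr [RHS]big_mkcond; rewrite big_seq [RHS]big_seq; apply: eq_bigr => t tP.
  have -> : dd t.2.1.1 t.2.1.2 t.2.2 (trans f 1) 0 = dd t.2.1.1 t.2.1.2 t.2.2 (monom 0 a b c) 0.
    by rewrite trans1; apply: dd_jet Jf; exact: leqW (oP _ tP).
  rewrite dd_monom_at.
  case: (t.2 =P (a, b, c)) => [->|ne] /=; first by rewrite !eqxx mul1r chi_shift // mulrCA.
  suff -> : [&& a == t.2.1.1, b == t.2.1.2 & c == t.2.2] = false by rewrite mul0r !mulr0.
  by apply/negP => /and3P[/eqP a' /eqP b' /eqP c']; apply: ne; rewrite a' b' c'; case: (t.2) => [[]].
have p1 : pm1 (1 : R) by left.
split.
  by apply: chiA_inj => t1 t2; have := E 1 1 1 t1 t2 p1 p1 p1; rewrite !chiM1 !mul1r; apply.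
by apply: chiM_inj => b1 b2 b3 q1 q2 q3 bb; have := E b1 b2 b3 0 0 q1 q2 q3 bb; rewrite !chiA0 !mulr1.
Qed.

End Necessity.

(** * Recurrences and classification *)

Section Cayley.
Variable R : realType.
Notation C := (R[i]).
Implicit Types (x y : C) (u v w : nat -> C).

Lemma sum_binS u v m :
  \sum_(j < m.+2) 'C(m.+1, j)%:R * u j * v (m.+1 - j)%N =
  \sum_(j < m.+1) 'C(m, j)%:R * (u j.+1 * v (m - j)%N + u j * v (m - j).+1).
Proof.
have E : \sum_(j < m.+1) 'C(m, j)%:R * u j * v (m - j).+1 =
    u 0 * v m.+1 + \sum_(j < m.+1) 'C(m, j.+1)%:R * u j.+1 * v (m - j)%N.
  rewrite big_ord_recl /= bin0 mul1r subn0; congr (_ + _).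
  rewrite [RHS]big_ord_recr /= bin_small // !mul0r addr0.
  by apply: eq_bigr => j _; rewrite /bump add1n -subSn ?subSS.
rewrite big_ord_recl /= bin0 mul1r subn0.
under eq_bigr do rewrite /bump /= add1n binS natrD subSS !mulrDl.
rewrite big_split /= addrA -E -big_split; apply: eq_bigr => j _ /=; ring.
Qed.

Lemma sum_bin_subr w m :
  \sum_(j < m.+2) 'C(m.+1, j)%:R * (m.+1 - j)%:R * w j =
  m.+1%:R * \sum_(j < m.+1) 'C(m, j)%:R * w j :> C.
Proof.
rewrite big_ord_recr /= subnn mulr0 mul0r addr0 mulr_sumr; apply: eq_bigr => j _.
by rewrite mulrA -!natrM mulnC -mul_bin_down.
Qed.

Lemma sum_bin_mulr w m :
  \sum_(j < m.+2) 'C(m.+1, j)%:R * j%:R * w j =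
  m.+1%:R * \sum_(j < m.+1) 'C(m, j)%:R * w j.+1 :> C.
Proof.
rewrite big_ord_recl /= mulr0 mul0r add0r mulr_sumr; apply: eq_bigr => j _.
by rewrite /bump /= add1n mulrA -!natrM mulnC -mul_bin_diag.
Qed.

Lemma ffactS x j : ffact x j.+1 = ffact x j * (x - j%:R).
Proof. by rewrite /ffact big_ord_recr. Qed.

Lemma rfactS x j : rfact x j.+1 = rfact x j * (x + j%:R).
Proof. by rewrite /rfact big_ord_recr. Qed.

Lemma Cay0 x y : Cay 0 x y = 1.
Proof. by rewrite /Cay big_ord1 /ffact /rfact !big_ord0 bin0 !mul1r. Qed.

(** The expansion of the tridiagonal determinant along its last row, derived here from the binomial
    sum. *)
Lemma CayS m x y : Cay m.+1 x y = x * Cay m x y - m%:R * (y - m%:R + 1) * Cay m.-1 x y.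
Proof.
rewrite /Cay; set a := (x + y) / 2%:R; set b := (x - y) / 2%:R.
have ab : a + b = x by rewrite /a /b; field.
have ba : b - a = - y by rewrite /a /b; field.
pose T j := ffact a j * rfact b (m - j).
(* Pascal's rule raises one of the two factorials in each term; the new factors [a - j] and
   [b + (m - j)] add up. *)
transitivity (\sum_(j < m.+1) 'C(m, j)%:R * T j * (a + b + (m - j)%:R - j%:R)).
  rewrite (sum_binS (ffact a) (rfact b) m); apply: eq_bigr => j _.
  by rewrite ffactS rfactS /T -/(m - j)%N; ring.
have -> : \sum_(j < m.+1) 'C(m, j)%:R * T j * (a + b + (m - j)%:R - j%:R) =
    x * (\sum_(j < m.+1) 'C(m, j)%:R * ffact a j * rfact b (m - j)) +
    (\sum_(j < m.+1) 'C(m, j)%:R * (m - j)%:R * T j - \sum_(j < m.+1) 'C(m, j)%:R * j%:R * T j).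
  rewrite mulr_sumr -sumrB -big_split; apply: eq_bigr => j _ /=.
  by rewrite ab /T; ring.
congr (_ + _); case: m @T => [|m] T.
  by rewrite !big_ord1 subnn !mulr0 !mul0r subr0 oppr0.
(* Absorption of [m - j] and of [j] into the binomial turns both sums into sums of order one less,
   whose terms differ by the factor [b - a + m]. *)
rewrite sum_bin_subr sum_bin_mulr -mulrBr -sumrB -mulrA -mulrN; congr (_ * _).
rewrite -mulNr mulr_sumr; apply: eq_bigr => j _; rewrite /T ffactS subSS.
rewrite subSn -1?ltnS // rfactS natrB -1?ltnS //.
have -> : y = a - b by rewrite -opprB ba opprK.
by rewrite -!natr1; ring.
Qed.

End Cayley.

(** * The two recurrences and their explicit solutions *)

Section Recurrence.
Variable R : realType.
Notation C := (R[i]).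
Implicit Types (s : C) (c : nat -> C) (lam : C * C).

(** The coefficient of [dd (k - m).-1 (l - m) m] after composing the functional with [pi1]: by
    [dd_pi1] the terms [m], [m + 1] and [m - 1] contribute. Subtractions are taken in the complex
    field, free of truncation. *)
Definition rec1 lam (k l : nat) c m : C :=
  (k%:R - m%:R) * (1 - lam.1 - k%:R + l%:R / 2%:R) * c m - m.+1%:R * c m.+1
  - (if m is n.+1 then (k%:R - n%:R) * (k%:R - n%:R - 1) * (l%:R - n%:R) / 4%:R * c n else 0).

Definition rec2 lam (k l : nat) c m : C :=
  (l%:R - m%:R) * (1 - lam.2 - l%:R + k%:R / 2%:R) * c m + m.+1%:R * c m.+1
  + (if m is n.+1 then (l%:R - n%:R) * (l%:R - n%:R - 1) * (k%:R - n%:R) / 4%:R * c n else 0).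

Lemma rec1B lam k l c1 c2 a m :
  rec1 lam k l (fun m => c1 m - a * c2 m) m = rec1 lam k l c1 m - a * rec1 lam k l c2 m.
Proof. by rewrite /rec1; case: m => [|m]; ring. Qed.

Lemma rec1_eq0 lam k l c M : c 0 = 0 -> (forall m, (m <= M)%N -> rec1 lam k l c m = 0) ->
  forall m, (m <= M.+1)%N -> c m = 0.
Proof.
move=> c0 H; elim/ltn_ind => -[//|m] IH mM.
have := H m mM; rewrite /rec1 (IH m) //; last exact: ltnW.
have -> : (if m is n.+1 then (k%:R - n%:R) * (k%:R - n%:R - 1) * (l%:R - n%:R) / 4%:R * c n else 0) = 0.
  by case: m IH mM => // n IH mM; rewrite (IH n) ?mulr0 //; lia.
by rewrite mulr0 sub0r subr0 => /eqP; rewrite oppr_eq0 mulf_eq0 pnatr_eq0 /= => /eqP.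
Qed.

Definition coef_pm (sg : bool) (k l m : nat) : C :=
  (if sg then 1 else -1) ^+ m / 2%:R ^+ m * m`!%:R * 'C(k, m)%:R * 'C(l, m)%:R.

Definition coef_c s (k m : nat) : C := 1 / 2%:R ^+ m * 'C(k, m)%:R * Cay m s k%:R.

Lemma binS_natr (k m : nat) : m.+1%:R * 'C(k, m.+1)%:R = (k%:R - m%:R) * 'C(k, m)%:R :> C.
Proof.
rewrite -natrM mul_bin_left natrM; have [mk|km] := leqP m k; first by rewrite natrB.
by rewrite bin_small // !mulr0.
Qed.

Lemma coef_pmS sg k l m : m.+1%:R * coef_pm sg k l m.+1 =
  (if sg then 1 else -1) / 2%:R * (k%:R - m%:R) * (l%:R - m%:R) * coef_pm sg k l m.
Proof.
rewrite /coef_pm; set e : C := if sg then 1 else -1.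
have := binS_natr k m; have := binS_natr l m.
have : m.+1%:R != 0 :> C by rewrite pnatr_eq0.
rewrite factS natrM [e ^+ m.+1]exprS [2%:R ^+ m.+1]exprS.
have n2 : (2%:R : C) ^+ m != 0 by rewrite expf_neq0 // pnatr_eq0.
move: ('C(k, m.+1)%:R) ('C(l, m.+1)%:R) ('C(k, m)%:R) ('C(l, m)%:R) (m.+1%:R : C) n2 => p q r s n n2 n0 El Ek.
rewrite [RHS](_ : _ = e / 2%:R * (e ^+ m / 2%:R ^+ m * m`!%:R) * ((k%:R - m%:R) * r) * ((l%:R - m%:R) * s)); last by ring.
by rewrite -El -Ek; field.
Qed.

(** The hypotheses make the linear coefficients plus or minus [l / 2] and [k / 2]. Both recurrences
    then follow from the two-term relation [coef_pmS] at [m] and at [m - 1], using that the sign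
    squares to one. *)
Lemma rec_pm sg lam k l m : (if sg then 1 else -1) * l%:R / 2%:R = 1 - lam.1 - k%:R + l%:R / 2%:R ->
  - ((if sg then 1 else -1) * k%:R / 2%:R) = 1 - lam.2 - l%:R + k%:R / 2%:R ->
  rec1 lam k l (coef_pm sg k l) m = 0 /\ rec2 lam k l (coef_pm sg k l) m = 0.
Proof.
rewrite /rec1 /rec2 coef_pmS => <- <-; case: m => [|n]; first by split; field.
have := coef_pmS sg k l n; rewrite -natr1.
move: (coef_pm sg k l n) (coef_pm sg k l n.+1) => p q.
have e2 : (if sg then 1 else -1) * (if sg then 1 else -1) = 1 :> C by case: sg; rewrite ?mulrNN mulr1.
move: (if sg then 1 else -1 : C) e2 => e e2 E.
have E' : (k%:R - n%:R) * (l%:R - n%:R) * p = 2%:R * e * ((n%:R + 1) * q).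
  by rewrite E -[LHS]mul1r -[X in X * _ = _]e2; field.
split.
  rewrite (_ : _ / 4%:R * p = (k%:R - n%:R - 1) / 4%:R * ((k%:R - n%:R) * (l%:R - n%:R) * p)); last by ring.
  by rewrite E'; field.
rewrite (_ : _ / 4%:R * p = (l%:R - n%:R - 1) / 4%:R * ((k%:R - n%:R) * (l%:R - n%:R) * p)); last by ring.
by rewrite E'; field.
Qed.

(** For [k = l] the linear coefficients are [s / 2] and [- s / 2], so the second recurrence is the
    negative of the first. Removing the factor [2 ^ (- m)] and the binomial turns the first into
    [CayS]. *)
Lemma rec_c lam k s m : lam = ((2%:R - k%:R - s) / 2%:R, (2%:R - k%:R + s) / 2%:R) ->
  rec1 lam k k (coef_c s k) m = 0 /\ rec2 lam k k (coef_c s k) m = 0.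
Proof.
move=> ->; have E : rec1 ((2%:R - k%:R - s) / 2%:R, (2%:R - k%:R + s) / 2%:R) k k (coef_c s k) m = 0.
  rewrite /rec1 /coef_c CayS /= [2%:R ^+ m.+1]exprS.
  have n2 j : (2%:R : C) ^+ j != 0 by rewrite expf_neq0 // pnatr_eq0.
  have B1 := binS_natr k m.
  rewrite (_ : m.+1%:R * _ = 1 / (2%:R * 2%:R ^+ m) * (m.+1%:R * 'C(k, m.+1)%:R) *
    (s * Cay m s k%:R - m%:R * (k%:R - m%:R + 1) * Cay m.-1 s k%:R)); last by field.
  rewrite B1; case: m {B1} => [|n] /=; first by rewrite expr0; field.
  have := binS_natr k n; rewrite [2%:R ^+ n.+1]exprS; move: (n2 n); rewrite -natr1.
  move: ('C(k, n.+1)%:R) ('C(k, n)%:R) (2%:R ^+ n) (Cay n.+1 s _) (Cay n s _) => p q w g h w0 Ep.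
  rewrite (_ : (k%:R - n%:R) * (k%:R - n%:R - 1) * (k%:R - n%:R) / 4%:R * (1 / w * q * h) =
    (k%:R - n%:R - 1) * (k%:R - n%:R) / 4%:R * (1 / w) * h * ((k%:R - n%:R) * q)); last by field.
  by rewrite -Ep; field.
by split=> //; rewrite -[RHS]oppr0 -E /rec1 /rec2 /=; case: m {E} => [|m]; field.
Qed.

End Recurrence.

(** * Singular vectors on the multi-indices of one bidegree *)

Section Classification.
Variable R : realType.
Notation C := (R[i]).
Implicit Types (F : 'rV[R]_3 -> C) (c : nat -> C) (lam nu : C * C) (e d : sgn * sgn).
Implicit Types (D : diffop R).

(** These are all the multi-indices of bidegree [(k, l)]. The recurrence at the last one also refers
    to [c (minn k l).+1], which later statements require to be zero. *)
Definition line (k l : nat) c : seq (C * (nat * nat * nat)) :=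
  [seq (c m, ((k - m)%N, (l - m)%N, m)) | m <- index_iota 0 (minn k l).+1].

Lemma Pdd_line k l c F : Pdd (line k l c) F =
  \sum_(0 <= m < (minn k l).+1) c m * dd (k - m)%N (l - m)%N m F 0.
Proof. by rewrite /Pdd big_map. Qed.

Lemma bihomogeneous_line k l c : bihomogeneous (line k l c) k l.
Proof. by move=> _ /mapP[m + ->]; rewrite mem_index_iota /=; lia. Qed.

(** Reindexing collects the contributions to each [X m]. The two hypotheses remove the terms past
    the end; in the applications [b M = 0] because a factor [k - M] or [l - M] vanishes at
    [M = minn k l]. *)
Lemma sum_shift M (a b c X : nat -> C) : c M.+1 = 0 -> b M = 0 ->
  \sum_(0 <= m < M.+1) (a m * X m - (if m is n.+1 then m%:R * c m * X n else 0) - b m * X m.+1) =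
  \sum_(0 <= m < M.+1) (a m - m.+1%:R * c m.+1 - (if m is n.+1 then b n else 0)) * X m.
Proof.
move=> cM bM; rewrite !sumrB; under [RHS]eq_bigr do rewrite !mulrBl; rewrite !sumrB.
congr (_ - _ - _).
  rewrite [LHS]big_nat_recl // add0r [RHS]big_nat_recr //= cM mulr0 mul0r addr0.
  by apply: eq_bigr => m _; rewrite ?mulrA.
rewrite [LHS]big_nat_recr //= bM mul0r addr0 [RHS]big_nat_recl // mul0r add0r.
by [].
Qed.

Lemma Pdd_pi1_line lam k l c F : smooth3 F -> c (minn k l).+1 = 0 ->
  Pdd (line k l c) (pi1 lam F) =
  \sum_(0 <= m < (minn k l).+1) rec1 lam k l c m * dd (k - m).-1 (l - m)%N m F 0.
Proof.
move=> sF cM; rewrite Pdd_line.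
rewrite -(@sum_shift _ _ (fun n => (k%:R - n%:R) * (k%:R - n%:R - 1) * (l%:R - n%:R) / 4%:R * c n) c
  (fun m => dd (k - m).-1 (l - m)%N m F 0)) //; last first.
  by have [kl|kl] := leqP k l; rewrite ?subrr ?(mul0r, mulr0).
rewrite big_seq [RHS]big_seq; apply: eq_bigr => m; rewrite mem_index_iota => /andP[_ mM].
have [mk ml] : (m <= k)%N /\ (m <= l)%N by lia.
rewrite (dd_pi1 _ _ _ _ sF) !natrB // (_ : (k - m.+1).-1 = (k - m).-2) ?subnS //.
rewrite -[(l - m).-1]subnS; move: (dd _ (l - m.+1)%N _ _ _) => Z.
case: m mM mk ml => [|m] mM mk ml; first by move: (dd _ _ _ _ _) => X /=; rewrite !subn0; field.
have El : (l - m.+1).+1 = (l - m)%N by lia.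
have Ek : (k - m.+1)%N = (k - m).-1 by lia.
rewrite El [in dd (k - m.+1)%N _ m]Ek /=.
move: (dd (k - m.+1).-1 _ _ _ _) => X.
move: (dd (k - m).-1 _ _ _ _) => Y.
by field.
Qed.

Lemma Pdd_pi2_line lam k l c F : smooth3 F -> c (minn k l).+1 = 0 ->
  Pdd (line k l c) (pi2 lam F) =
  \sum_(0 <= m < (minn k l).+1) rec2 lam k l c m * dd (k - m)%N (l - m).-1 m F 0.
Proof.
move=> sF cM; rewrite Pdd_line.
transitivity (\sum_(0 <= m < (minn k l).+1)
  ((l%:R - m%:R) * (1 - lam.2 - l%:R + k%:R / 2%:R) * c m - m.+1%:R * (- c m.+1)
  - (if m is n.+1 then - ((l%:R - n%:R) * (l%:R - n%:R - 1) * (k%:R - n%:R) / 4%:R * c n) else 0))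
  * dd (k - m)%N (l - m).-1 m F 0); last first.
  by apply: eq_bigr => m _; congr (_ * _); rewrite /rec2; case: m => [|m]; ring.
rewrite -(@sum_shift _ _ (fun n => - ((l%:R - n%:R) * (l%:R - n%:R - 1) * (k%:R - n%:R) / 4%:R * c n))
  (fun m => - c m) (fun m => dd (k - m)%N (l - m).-1 m F 0)) ?cM ?oppr0 //; last first.
  by have [kl|kl] := leqP k l; rewrite ?subrr ?(mul0r, mulr0) oppr0.
rewrite big_seq [RHS]big_seq; apply: eq_bigr => m; rewrite mem_index_iota => /andP[_ mM].
have [mk ml] : (m <= k)%N /\ (m <= l)%N by lia.
rewrite (dd_pi2 _ _ _ _ sF) !natrB // (_ : (l - m.+1).-1 = (l - m).-2) ?subnS //.
rewrite -[(k - m).-1]subnS; move: (dd (k - m.+1)%N _ m.+1 _ _) => Z.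
case: m mM mk ml => [|m] mM mk ml; first by move: (dd _ _ _ _ _) => X /=; rewrite !subn0; field.
have Ek : (k - m.+1).+1 = (k - m)%N by lia.
have El : (l - m.+1)%N = (l - m).-1 by lia.
rewrite Ek El /=.
move: (dd (k - m.+1)%N _ _ _ _) => X.
move: (dd (k - m)%N _ _ _ _) => Y.
by field.
Qed.

Lemma annihilates_line lam k l c : c (minn k l).+1 = 0 ->
  (forall m, (m <= minn k l)%N -> rec1 lam k l c m = 0 /\ rec2 lam k l c m = 0) ->
  annihilates (line k l c) lam.
Proof.
move=> cM H F sF; rewrite Pdd_pi1_line // Pdd_pi2_line //.
by split; rewrite big_seq big1 // => m; rewrite mem_index_iota => /H[E1 E2]; rewrite ?E1 ?E2 mul0r.
Qed.

(** Each recurrence is isolated by testing on one monomial; its third exponent [m] already separates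
    the terms of the line. *)
Lemma line_annihilates lam k l c m : c (minn k l).+1 = 0 -> annihilates (line k l c) lam ->
  (m <= minn k l)%N -> rec1 lam k l c m = 0 /\ rec2 lam k l c m = 0.
Proof.
move=> cM aL mM.
have K (r : nat -> C) (p q : nat -> nat) (a b : nat) : p m = a -> q m = b ->
    \sum_(0 <= n < (minn k l).+1) r n * dd (p n) (q n) n (monom 0 a b m) 0 = 0 -> r m = 0.
  move=> pa qb; rewrite (bigD1_seq m) ?iota_uniq ?mem_index_iota //= big1 ?addr0; last first.
    by move=> n nm; rewrite dd_monom_at eq_sym [m == n]eq_sym (negbTE nm) !andbF mul0r mulr0.
  rewrite dd_monom_at pa qb !eqxx mul1r => /eqP.
  by rewrite mulf_eq0 (negbTE (fact3_neq0 _ _ _ _)) orbF => /eqP.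
have [H1 _] := aL _ (smooth_monom 0 (k - m).-1 (l - m)%N m).
have [_ H2] := aL _ (smooth_monom 0 (k - m)%N (l - m).-1 m).
rewrite Pdd_pi1_line // in H1; last exact: smooth_monom.
rewrite Pdd_pi2_line // in H2; last exact: smooth_monom.
by split; [exact: (K _ _ _ _ _ _ _ H1)|exact: (K _ _ _ _ _ _ _ H2)].
Qed.

(** The Cartan matrix with rows [(2, -1)] and [(-1, 2)] has determinant [3]. *)
Lemma shift_wt_inj lam k l k' l' : shift_wt lam k l = shift_wt lam k' l' -> k = k' /\ l = l'.
Proof.
move=> [E1 E2].
have three : (3%:R : C) != 0 by rewrite pnatr_eq0.
split; apply/eqP; rewrite -(eqr_nat C); apply/eqP; apply: (mulfI three).
  transitivity (2%:R * (lam.1 + 2%:R * k%:R - l%:R) + (lam.2 + 2%:R * l%:R - k%:R) - 2%:R * lam.1 - lam.2).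
    by ring.
  by rewrite E1 E2; ring.
transitivity ((lam.1 + 2%:R * k%:R - l%:R) + 2%:R * (lam.2 + 2%:R * l%:R - k%:R) - lam.1 - 2%:R * lam.2).
  by ring.
by rewrite E1 E2; ring.
Qed.

(** One nonzero coefficient determines [nu], and [nu] determines the bidegree, so all nonzero
    coefficients lie on a single line. *)
Lemma DiffG_line e lam d nu D : DiffG e lam d nu D ->
  (forall F, smooth3 F -> forall x, dapply D F x = 0) \/
  exists k l c, [/\ nu = shift_wt lam k l, d = shift_sgn e k l, c 0%N != 0, c (minn k l).+1 = 0 &
    (forall m, (m <= minn k l)%N -> rec1 lam k l c m = 0 /\ rec2 lam k l c m = 0) /\
    forall F, smooth3 F -> forall x, dapply D F x = NopP (line k l c) F x].
Proof.
move=> DD; have [P [aP DP wP]] := DiffG_coef DD.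
have [[[[a b] c] abc]|P0] := pselect (exists s, coef P s != 0); last first.
  left => F sF x; rewrite DP // /NopP /Pdd.
  have C0 s : coef P s = 0 by apply/eqP; apply/negPn/negP => h; apply: P0; exists s.
  rewrite (@sum_coef R P (fun s => dd s.1.1 s.1.2 s.2 (F \o hmul x) 0) [::]) ?big_nil //.
right; have [nuE dE] := wP a b c abc; set k := (a + c)%N in nuE dE; set l := (b + c)%N in nuE dE.
(* The cutoff supplies the zero past the end, since [k - m] and [l - m] would truncate there. *)
pose h m := if (m <= minn k l)%N then coef P ((k - m)%N, (l - m)%N, m) else 0.
have hM : h (minn k l).+1 = 0 by rewrite /h ltnn.
have PL G : Pdd P G = Pdd (line k l h) G.
  rewrite /Pdd big_map.
  rewrite (@sum_coef R P (fun s => dd s.1.1 s.1.2 s.2 G 0)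
    [seq ((k - m)%N, (l - m)%N, m) | m <- index_iota 0 (minn k l).+1]); first last.
  - move=> t tP tS; apply/eqP; apply/negPn/negP; case: (t.2) tS => [[p q] r] tS pqr.
    have [E _] := wP _ _ _ pqr; rewrite nuE in E; have [kE lE] := shift_wt_inj E.
    case/negP: tS; apply/mapP; exists r; first by rewrite mem_index_iota; lia.
    by rewrite kE lE !addnK.
  - by rewrite map_inj_uniq ?iota_uniq // => m n [].
  rewrite big_map big_seq [RHS]big_seq; apply: eq_bigr => m; rewrite mem_index_iota ltnS /= => mM.
  by rewrite /h mM.
have rec m : (m <= minn k l)%N -> rec1 lam k l h m = 0 /\ rec2 lam k l h m = 0.
  by apply: line_annihilates => // F sF; rewrite -!PL; exact: aP.
exists k, l, h; split => //; last by split=> // F sF x; rewrite DP // /NopP PL.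
(* If [h 0] were zero, [rec1] would propagate zero along the line up to the chosen nonzero
   coefficient at [c]. *)
apply: contraNneq abc => h0.
have := rec1_eq0 h0 (fun m mM => (rec m mM).1) (m := c).
rewrite /h (_ : (c <= minn k l)%N) /k /l ?addnK; last by lia.
by move=> -> //; lia.
Qed.

(** One-dimensionality: for another solution [h], the difference [h - h 0 * c] solves [rec1] with
    initial value zero, hence vanishes. *)
Lemma DiffG_eq_line e lam k l c (T : ('rV[R]_3 -> C) -> ('rV[R]_3 -> C)) :
  c 0%N = 1 -> c (minn k l).+1 = 0 ->
  (forall m, (m <= minn k l)%N -> rec1 lam k l c m = 0 /\ rec2 lam k l c m = 0) ->
  (forall F x, smooth3 F -> T F x = NopP (line k l c) F x) ->
  DiffG_eq e lam (shift_sgn e k l) (shift_wt lam k l) T.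
Proof.
move=> c0 cM rc TE D; split=> [DD|[wD [a DT]]].
  split; first by case: DD.
  have [D0|[k' [l' [h [nuE _ h0 hM [rh DE]]]]]] := DiffG_line DD.
    by exists 0 => F sF x; rewrite D0 // mul0r.
  have [kE lE] := shift_wt_inj nuE; subst k' l'.
  exists (h 0%N) => F sF x; rewrite DE // TE // /NopP !Pdd_line mulr_sumr.
  rewrite big_seq [RHS]big_seq; apply: eq_bigr => m; rewrite mem_index_iota ltnS /= => mM.
  rewrite mulrA; congr (_ * _); apply/eqP; rewrite -subr_eq0; apply/eqP.
  apply: (@rec1_eq0 R lam k l (fun m => h m - h 0%N * c m) (minn k l)); rewrite ?c0 ?mulr1 ?subrr //; last exact: leqW.
  by move=> n nM; rewrite rec1B (rh n nM).1 (rc n nM).1 mulr0 subrr.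
apply: (@DiffG_of_annihilates R (line k l (fun m => a * c m))) => //.
- apply: annihilates_line; first by rewrite cM mulr0.
  move=> m /rc[E1 E2]; split; [rewrite -[RHS](mulr0 a) -E1|rewrite -[RHS](mulr0 a) -E2].
    by rewrite /rec1; case: m {E1 E2} => [|m]; ring.
  by rewrite /rec2; case: m {E1 E2} => [|m]; ring.
- exact: bihomogeneous_line.
move=> F sF x; rewrite DT // TE // /NopP !Pdd_line mulr_sumr; apply: eq_bigr => m _.
by rewrite mulrA.
Qed.

End Classification.

(** * The individual parameter families *)

Section Cases.
Variable R : realType.
Notation C := (R[i]).
Implicit Types (F : 'rV[R]_3 -> C) (c : nat -> C) (lam nu : C * C) (e d : sgn * sgn).

Lemma smulPl s : smul s Pl = s. Proof. by case: s. Qed.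

Definition delta0 (m : nat) : C := (m == 0%N)%:R.

Lemma NopP_edge k l F x : minn k l = 0%N -> NopP (line k l delta0) F x = Nop k l 0 F x.
Proof. by move=> kl; rewrite /NopP Pdd_line kl big_nat1 /delta0 eqxx mul1r !subn0. Qed.

Lemma DiffG_eq_edge e lam k l T : minn k l = 0%N ->
  rec1 lam k l delta0 0%N = 0 -> rec2 lam k l delta0 0%N = 0 ->
  (forall F x, smooth3 F -> T F x = Nop k l 0 F x) ->
  DiffG_eq e lam (shift_sgn e k l) (shift_wt lam k l) T.
Proof.
move=> kl r1 r2 TE; apply: (@DiffG_eq_line R e lam k l delta0).
- by rewrite /delta0 eqxx.
- by [].
- by move=> m; rewrite kl leqn0 => /eqP ->.
by move=> F x sF; rewrite NopP_edge // TE.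
Qed.

Lemma DiffG_eq_id e lam : DiffG_eq e lam e lam (fun F => F).
Proof.
have := @DiffG_eq_edge e lam 0 0 (fun F => F).
have -> : shift_sgn e 0 0 = e by case: e => ? ?; rewrite /shift_sgn /= !smulPl.
have -> : shift_wt lam 0 0 = lam.
  by case: lam => l1 l2; rewrite /shift_wt /=; congr pair; ring.
apply=> //; try by rewrite /rec1 /rec2 /delta0 /=; ring.
by move=> F x sF; rewrite -iter_D1.
Qed.

Lemma DiffG_eq_a e d lam nu m : Xi_a_at e d lam nu m -> DiffG_eq e lam d nu (iter (1 + m) (@D1 R)).
Proof.
move=> [l1 [-> ->]].
have -> : (2%:R - lam.1, lam.1 + lam.2 - 1) = shift_wt lam m.+1 0.
  by rewrite /shift_wt l1 -natr1; congr pair; ring.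
have -> : (e.1, smul e.2 (spow (1 - (- m%:Z)))) = shift_sgn e m.+1 0.
  by rewrite /shift_sgn smulPl opprK -intS.
apply: DiffG_eq_edge; rewrite ?minn0 //.
- by rewrite /rec1 /delta0 l1 -natr1 /=; field.
- by rewrite /rec2 /delta0 /=; ring.
by move=> F x sF; rewrite iter_D1.
Qed.

Lemma DiffG_eq_a' e d lam nu m : Xi_a'_at e d lam nu m -> DiffG_eq e lam d nu (iter (1 + m) (@D2 R)).
Proof.
move=> [l2 [-> ->]].
have -> : (lam.1 + lam.2 - 1, 2%:R - lam.2) = shift_wt lam 0 m.+1.
  by rewrite /shift_wt l2 -natr1; congr pair; ring.
have -> : (smul e.1 (spow (1 - (- m%:Z))), e.2) = shift_sgn e 0 m.+1.
  by rewrite /shift_sgn smulPl opprK -intS.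
apply: DiffG_eq_edge; rewrite ?min0n //.
- by rewrite /rec1 /delta0 /=; ring.
- by rewrite /rec2 /delta0 l2 -natr1 /=; field.
by move=> F x sF; rewrite iter_D2.
Qed.

Lemma Dpm_NopP sg k l F x : smooth3 F -> Dpm sg k l F x = NopP (line k l (coef_pm R sg k l)) F x.
Proof.
move=> sF; rewrite /NopP Pdd_line big_mkord; apply: eq_bigr => m _.
by rewrite symD_Nop.
Qed.

Lemma Dc_NopP s k F x : smooth3 F -> Dc s k F x = NopP (line k k (coef_c s k)) F x.
Proof.
move=> sF; rewrite /NopP Pdd_line big_mkord minnn; apply: eq_bigr => m _.
by rewrite symD_Nop.
Qed.

Lemma DiffG_eq_pm sg e lam k l :
  (if sg then 1 else -1) * l%:R / 2%:R = 1 - lam.1 - k%:R + l%:R / 2%:R ->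
  - ((if sg then 1 else -1) * k%:R / 2%:R) = 1 - lam.2 - l%:R + k%:R / 2%:R ->
  DiffG_eq e lam (shift_sgn e k l) (shift_wt lam k l) (@Dpm R sg k l).
Proof.
move=> E1 E2; apply: (@DiffG_eq_line R e lam k l (coef_pm R sg k l)).
- by rewrite /coef_pm !expr0 fact0 !bin0 divr1 !mulr1.
- rewrite /coef_pm; have [kl|kl] := leqP k l.
    by rewrite (bin_small (ltnSn k)) mulr0 mul0r.
  by rewrite (bin_small (ltnSn l)) mulr0.
- by move=> m _; exact: rec_pm.
exact: Dpm_NopP.
Qed.

Lemma DiffG_eq_b e d lam nu k l : Xi_b_at e d lam nu k l -> DiffG_eq e lam d nu (@Dplus R k l).
Proof.
move=> [_ [_ [-> [-> ->]]]] /=; set lam' := (_, _).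
have -> : (1 - l%:R + k%:R, 3%:R - (1 - k%:R) - (1 - l%:R + k%:R)) = shift_wt lam' k l.
  by rewrite /shift_wt /=; congr pair; ring.
have -> : (smul e.1 (spow (2 - (1 - k%:Z) - (1 - l%:Z + k%:Z))), smul e.2 (spow (1 - (1 - k%:Z)))) =
    shift_sgn e k l.
  by rewrite /shift_sgn; congr (_ _ (spow _), _ _ (spow _)); ring.
by apply: DiffG_eq_pm; rewrite /=; field.
Qed.

Lemma DiffG_eq_b' e d lam nu k l : Xi_b'_at e d lam nu k l -> DiffG_eq e lam d nu (@Dminus R k l).
Proof.
move=> [_ [_ [-> [-> ->]]]] /=; set lam' := (_, _).
have -> : (3%:R - (1 - k%:R + l%:R) - (1 - l%:R), 1 - k%:R + l%:R) = shift_wt lam' k l.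
  by rewrite /shift_wt /=; congr pair; ring.
have -> : (smul e.1 (spow (1 - (1 - l%:Z))), smul e.2 (spow (2 - (1 - k%:Z + l%:Z) - (1 - l%:Z)))) =
    shift_sgn e k l.
  by rewrite /shift_sgn; congr (_ _ (spow _), _ _ (spow _)); ring.
by apply: DiffG_eq_pm; rewrite /=; field.
Qed.

Lemma DiffG_eq_c e d lam nu k s : Xi_c_at e d lam nu k s -> DiffG_eq e lam d nu (@Dc R (lam.2 - lam.1) k).
Proof.
move=> [_ [lamE [-> ->]]].
have -> : (2%:R - lam.2, 2%:R - lam.1) = shift_wt lam k k.
  by rewrite /shift_wt lamE /=; congr pair; field.
have -> : lam.2 - lam.1 = s by rewrite lamE /=; field.
apply: (@DiffG_eq_line R e lam k k (coef_c s k)).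
- by rewrite /coef_c Cay0 expr0 bin0 divr1 !mulr1.
- by rewrite minnn /coef_c bin_small // mulr0 mul0r.
- by move=> m _; exact: rec_c.
exact: Dc_NopP.
Qed.

(** The zero function lies in every principal series and serves as the image; [Iser_ext] shows that
    any other image vanishes as well. *)
Lemma dapply0_DiffG e lam d nu D : diffop_wf D -> (forall F, smooth3 F -> forall x, dapply D F x = 0) ->
  DiffG e lam d nu D.
Proof.
move=> wD D0; have I0 : Iser nu d (fun=> 0 : C).
  split; last by move=> *; rewrite mulr0.
  by exists setT, (fun=> 0); split; [apply: smooth_cst; exact: openT|split].
have r0 g f : Iser lam e f -> SL3 g -> forall x, dapply D (res (ltr g f)) x = 0.
  by move=> If sg x; apply: D0; exact: (smooth_trans (Iser_smooth If) (SL3_inv sg)).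
split=> //; split=> [f If|f f' If If' rf g sg x].
  by exists (fun=> 0); split=> // x; rewrite D0 //; exact: smooth_res (Iser_smooth If).
rewrite r0 // res_ltr /trans; apply: (Iser_ext If' I0); last exact: SL3M (SL3_inv sg) (SL3_nbar x).
by move=> y; rewrite rf D0 //; exact: smooth_res (Iser_smooth If).
Qed.

Lemma classification e lam k l c : c 0%N != 0 -> c (minn k l).+1 = 0 ->
  (forall m, (m <= minn k l)%N -> rec1 lam k l c m = 0 /\ rec2 lam k l c m = 0) ->
  let d := shift_sgn e k l in let nu := shift_wt lam k l in
  Xi_id e d lam nu \/ Xi_a e d lam nu \/ Xi_a' e d lam nu \/
  Xi_b e d lam nu \/ Xi_b' e d lam nu \/ Xi_c e d lam nu.
Proof.
move=> c0 cM rc /=; have [r10 r20] := rc 0%N (leq0n _).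
rewrite /rec1 /rec2 !subr0 /= mul1r in r10 r20.
case: k l cM rc r10 r20 => [|k] [|l] cM rc r10 r20.
- left; case: e lam {cM rc r10 r20} => [? ?] [l1 l2]; rewrite /Xi_id /shift_sgn /shift_wt /= !smulPl.
  by split=> //; congr pair; ring.
- right; right; left; exists l.
  (* On an edge of the quadrant the line has a single point, so [c 1] is zero and the condition for
     [m = 0] alone fixes [lam.2]. *)
  rewrite min0n in cM; rewrite cM !addr0 mul0r addr0 in r20.
  have lE : lam.2 = - l%:R.
    move: r20 => /eqP; rewrite !mulf_eq0 (negbTE c0) orbF pnatr_eq0 /= -natr1 => /eqP E.
    by apply/eqP; rewrite -subr_eq0 -oppr_eq0 -[X in _ == X]E; apply/eqP; ring.
  split=> //; split; first by rewrite /shift_wt lE -natr1; congr pair; ring.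
  by rewrite /shift_sgn smulPl opprK -intS.
- right; left; exists k.
  rewrite minn0 in cM; rewrite cM subr0 mul0r addr0 in r10.
  have lE : lam.1 = - k%:R.
    move: r10 => /eqP; rewrite !mulf_eq0 (negbTE c0) orbF pnatr_eq0 /= -natr1 => /eqP E.
    by apply/eqP; rewrite -subr_eq0 -oppr_eq0 -[X in _ == X]E; apply/eqP; ring.
  split=> //; split; first by rewrite /shift_wt lE -natr1; congr pair; ring.
  by rewrite /shift_sgn smulPl opprK -intS.
do 3 right.
have M1 : (0 < minn k.+1 l.+1)%N by rewrite leq_min.
have [r11 r21] := rc 1%N M1.
rewrite /rec1 /rec2 !subr0 in r11 r21.
move: r10 r20 r11 r21; set A1 := 1 - lam.1 - _ + _; set A2 := 1 - lam.2 - _ + _.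
set a : C := k.+1%:R; set b : C := l.+1%:R => r10 r20 r11 r21.
have a0 : a != 0 by rewrite /a pnatr_eq0. have b0 : b != 0 by rewrite /b pnatr_eq0.
(* The sum of the two conditions for [m = 0], in which [c 1] cancels. *)
have E1 : a * A1 = - (b * A2).
  apply: (mulIf c0); apply/eqP; rewrite -subr_eq0; apply/eqP.
  by rewrite -[RHS](addr0 0) -{1}r10 -r20; ring.
(* Eliminating [c 1], [c 2] and [A2] leaves [(k - l) (A1^2 - l^2 / 4) = 0]. *)
have E2 : (a - b) * ((A1 - b / 2%:R) * (A1 + b / 2%:R)) = 0.
  have c1 : c 1%N = a * A1 * c 0%N by apply/eqP; rewrite -subr_eq0 -oppr_eq0 -[X in _ == X]r10; apply/eqP; ring.
  have A2E : A2 = - (a * A1) / b by rewrite E1; field.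
  have ab0 : a * c 0%N / b != 0 by rewrite !mulf_neq0 ?invr_eq0.
  apply: (mulIf ab0); rewrite mul0r -[RHS](addr0 0) -{1}r11 -r21 c1 A2E.
  by field.
(* The factors [a - b], [A1 - b / 2] and [A1 + b / 2] lead to [Xi_c], [Xi_b] and [Xi_b']
   respectively; [E1] then supplies the second parameter. *)
move/eqP: E2; rewrite !mulf_eq0 subr_eq0 => /orP[kl|/orP[]].
- do 2 right; have {}kl : k = l by apply/eqP; rewrite -eqSS -(eqr_nat C).
  subst l; exists k.+1, (lam.2 - lam.1).
  have L : lam.1 + lam.2 = 2%:R - a.
    have : a * (A1 + A2) = 0 by rewrite mulrDr E1 /b addNr.
    move=> /eqP; rewrite mulf_eq0 (negbTE a0) /= => /eqP E.
    by rewrite -[RHS]subr0 -E /A1 /A2 /a; field.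
  split=> //; rewrite /shift_wt -/a; rewrite {1}(surjective_pairing lam).
  move: lam.1 lam.2 L => l1 l2 L /=; have aE : a = 2%:R - l1 - l2 by rewrite -addrA -opprD L; ring.
  split; first by rewrite aE; congr pair; field.
  by split=> //; rewrite aE; congr pair; field.
- rewrite subr_eq0 => /eqP A1E; left; exists k.+1, l.+1.
  have A2E : A2 = - a / 2%:R.
    by apply: (mulfI b0); rewrite -[LHS]opprK -E1 A1E; field.
  have L1 : lam.1 = 1 - a by rewrite -[LHS]addr0 -(subrr A1) {2}A1E /A1 -/a -/b; field.
  have L2 : lam.2 = 1 - b + a by rewrite -[LHS]addr0 -(subrr A2) {2}A2E /A2 -/a -/b; field.
  split=> //; split=> //; rewrite /shift_wt /shift_sgn L1 L2 -/a -/b /=.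
  split; first by rewrite -L1 -L2; case: (lam).
  split; first by congr pair; ring.
  by congr (_ _ (spow _), _ _ (spow _)); ring.
rewrite addr_eq0 => /eqP A1E; right; left; exists k.+1, l.+1.
have A2E : A2 = a / 2%:R.
  by apply: (mulfI b0); rewrite -[LHS]opprK -E1 A1E; field.
have L1 : lam.1 = 1 - a + b by rewrite -[LHS]addr0 -(subrr A1) {2}A1E /A1 -/a -/b; field.
have L2 : lam.2 = 1 - b by rewrite -[LHS]addr0 -(subrr A2) {2}A2E /A2 -/a -/b; field.
split=> //; split=> //; rewrite /shift_wt /shift_sgn L1 L2 -/a -/b /=.
split; first by rewrite -L1 -L2; case: (lam).
split; first by congr pair; ring.
by congr (_ _ (spow _), _ _ (spow _)); ring.
Qed.

End Cases.

Theorem theorem4p3 (R : realType) (eps delta : sgn * sgn)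
    (lam nu : R[i] * R[i]) :
  [/\ Xi_id eps delta lam nu ->
        DiffG_eq eps lam delta nu (fun F => F),
      forall m : nat, Xi_a_at eps delta lam nu m ->
        (* D_1^{1 - lam_1}, lam_1 = -m *)
        DiffG_eq eps lam delta nu (iter (1 + m) (@D1 R)),
      forall m : nat, Xi_a'_at eps delta lam nu m ->
        (* D_2^{1 - lam_2}, lam_2 = -m *)
        DiffG_eq eps lam delta nu (iter (1 + m) (@D2 R)),
      forall k l : nat, Xi_b_at eps delta lam nu k l ->
        (* D_+^{(1 - lam_1, 2 - lam_1 - lam_2)} = D_+^{(k, l)} *)
        DiffG_eq eps lam delta nu (@Dplus R k l) &
     [/\ forall k l : nat, Xi_b'_at eps delta lam nu k l ->
        (* D_-^{(2 - lam_1 - lam_2, 1 - lam_2)} = D_-^{(k, l)} *)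
        DiffG_eq eps lam delta nu (@Dminus R k l),
      forall (k : nat) (s : R[i]), Xi_c_at eps delta lam nu k s ->
        (* D_c^{(lam_2 - lam_1; 2 - lam_1 - lam_2)}, 2 - lam_1 - lam_2 = k *)
        DiffG_eq eps lam delta nu (@Dc R (lam.2 - lam.1) k) &
      ~ Xi_id eps delta lam nu -> ~ Xi_a eps delta lam nu ->
      ~ Xi_a' eps delta lam nu -> ~ Xi_b eps delta lam nu ->
      ~ Xi_b' eps delta lam nu -> ~ Xi_c eps delta lam nu ->
        DiffG_zero eps lam delta nu]].
Proof.
split; last split.
- by move=> [-> ->]; exact: DiffG_eq_id.
- by move=> m; exact: DiffG_eq_a.
- by move=> m; exact: DiffG_eq_a'.
- by move=> k l; exact: DiffG_eq_b.
- by move=> k l; exact: DiffG_eq_b'.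
- by move=> k s; exact: DiffG_eq_c.
move=> nid na na' nb nb' nc D; split=> [DD|[wD D0]]; last exact: dapply0_DiffG.
split; first by case: DD.
have [//|[k [l [c [nuE dE c0 cM [rc _]]]]]] := DiffG_line DD.
have := classification eps c0 cM rc; rewrite /= -nuE -dE.
by case=> [//|[//|[//|[//|[//|//]]]]].
Qed.
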